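(* Let $\xi_1,\xi_2\in L^1_{loc}(\mathbb{R}^N)$ be such that $0\le\xi_1\le\xi_2$ a.e. in $\mathbb{R}^N$ and $\xi_1^{-1}\in L^1_{loc}(\mathbb{R}^N)$. Let $f\in L^2_{loc}(\mathbb{R}^N)$ and $y_d\in L^2(\Omega)$ be given functions, and assume that the set of admissible controls $\mathcal{R}_{ad}$ is nonempty. Then the optimal control problem of minimizing $$I(\rho,y)=\int_\Omega|y-y_d|^2\,dx+\int_\Omega|\nabla y|^2\rho\,dx+\int_\Omega|D\rho|$$ over $(\rho,y)\in\Xi_W$ admits at least one weak optimal solution; that is, there exists a pair $(\rho^{opt},y^{opt})\in\Xi_W\subset L^1(\Omega)\times W^{1,1}(\Omega;\Gamma_D)$, with $y^{opt}\in W_{\rho^{opt}}$, such that $$I(\rho^{opt},y^{opt})=\inf_{(\rho,y)\in\Xi_W}I(\rho,y).$$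
   Context: $\Omega\subset\mathbb{R}^N$ ($N\ge1$) is a bounded open set with Lipschitz boundary, and $\partial\Omega=\Gamma_D\cup\Gamma_N$ with $\Gamma_D,\Gamma_N$ disjoint. $C_0^\infty(\mathbb{R}^N;\Gamma_D)=\{\varphi\in C_0^\infty(\mathbb{R}^N):\varphi=0\text{ on }\Gamma_D\}$; $C_0^\infty(\Omega;\Gamma_D)$ denotes the restrictions of these functions to $\Omega$ (they need not vanish on $\Gamma_N$). $W^{1,1}(\Omega;\Gamma_D)$ is the closure of $C_0^\infty(\mathbb{R}^N;\Gamma_D)$ in $W^{1,1}(\Omega)$. For $\rho\in L^1(\Omega)$, $\int_\Omega|D\rho|=\sup\{\int_\Omega\rho\,\mathrm{div}\,\varphi\,dx:\varphi\in C_0^1(\Omega;\mathbb{R}^N),\ |\varphi(x)|\le1\text{ for }x\in\Omega\}$, and $BV(\Omega)$ is the set of $\rho\in L^1(\Omega)$ for which this is finite, with norm $\|\rho\|_{BV(\Omega)}=\|\rho\|_{L^1(\Omega)}+\int_\Omega|D\rho|$. A number $m>0$ is fixed. The set of admissible controls is $$\mathcal{R}_{ad}=\Big\{\rho\in BV(\Omega):\ \rho\ge0,\ \int_\Omega\rho\,dx=m,\ \xi_1(x)\le\rho(x)\le\xi_2(x)\text{ a.e. in }\Omega\Big\}.$$ For a nonnegative $\rho$ with $\rho,\rho^{-1}\in L^1(\Omega)$ (in particular for $\rho\in\mathcal{R}_{ad}$), $W_\rho$ is the set of $y\in W^{1,1}(\Omega;\Gamma_D)$ for which $\|y\|_\rho=\big(\int_\Omega(y^2+\rho|\nabla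 y|^2)\,dx\big)^{1/2}$ is finite. The set of weak admissible pairs is $$\Xi_W=\Big\{(\rho,y):\ \rho\in\mathcal{R}_{ad},\ y\in W_\rho,\ \int_\Omega(\rho\nabla y\cdot\nabla\varphi+y\varphi)\,dx=\int_\Omega f\varphi\,dx\ \ \forall\varphi\in C_0^\infty(\Omega;\Gamma_D)\Big\},$$ i.e. $y$ is a weak solution of $-\mathrm{div}(\rho\nabla y)+y=f$ in $\Omega$, $y=0$ on $\Gamma_D$, $\rho\,\partial y/\partial\nu=0$ on $\Gamma_N$. *)

(* Defs.v *)
From HB Require Import structures.
From mathcomp Require Import all_boot all_order all_algebra.
From mathcomp Require Import all_classical all_reals all_analysis.

Set Implicit Arguments.
Unset Strict Implicit.
Unset Printing Implicit Defensive.

Import Order.TTheory GRing.Theory Num.Theory.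
Import numFieldNormedType.Exports.

Local Open Scope classical_set_scope.
Local Open Scope ring_scope.

(* The sigma-algebra on 'rV[R]_n generated by the coordinates, i.e. the Borel
   sigma-algebra of R^n. *)
Section measurable_rV.
Context {R : realType}.
Variable n : nat.

Let coord : 'I_n -> 'rV[R]_n -> R := fun i v => v ord0 i.

Let rV_set0 : g_sigma_preimage coord set0.
Proof. exact: sigma_algebra0. Qed.

Let rV_setC A : g_sigma_preimage coord A -> g_sigma_preimage coord (~` A).
Proof. exact: sigma_algebraC. Qed.

Let rV_bigcup (F : _^nat) : (forall i, g_sigma_preimage coord (F i)) ->
  g_sigma_preimage coord (\bigcup_i (F i)).
Proof. exact: sigma_algebra_bigcup. Qed.

HB.instance Definition _ := @isMeasurable.Build default_measure_display
  'rV[R]_n (g_sigma_preimage coord) rV_set0 rV_setC rV_bigcup.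

End measurable_rV.

Section lebesgue_measure_rV.
Context {R : realType}.

Lemma measurable_coord n (i : 'I_n) :
  measurable_fun [set: 'rV[R]_n] (fun v : 'rV[R]_n => v ord0 i).
Proof.
move=> _ Y mY; rewrite setTI; apply: sub_sigma_algebra => /=.
rewrite -bigcup_seq/=; exists i => /=; first by rewrite mem_index_enum.
by exists Y => //; rewrite setTI.
Qed.

Lemma measurable_fun_rVP d (T : measurableType d) n (f : T -> 'rV[R]_n) :
  (forall i, measurable_fun [set: T] (fun x => f x ord0 i)) ->
  measurable_fun [set: T] f.
Proof.
move=> mf; suff fS : preimage_set_system [set: T] f
    (g_sigma_preimage (fun (i : 'I_n) (v : 'rV[R]_n) => v ord0 i)) `<=` measurable.
  by move=> _ A mA; apply: fS; exists A.
rewrite -g_sigma_preimage_comp.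
apply: smallest_sub; first exact: sigma_algebra_measurable.
rewrite -bigcup_seq; apply: bigcup_sub => i _ A [B mB <-].
exact: mf.
Qed.

Definition rV_cons n (p : R * 'rV[R]_n) : 'rV[R]_n.+1 :=
  \row_i (if unlift ord0 i is Some j then p.2 ord0 j else p.1).

Definition rV_uncons n (v : 'rV[R]_n.+1) : R * 'rV[R]_n :=
  (v ord0 ord0, \row_j v ord0 (lift ord0 j)).

Lemma rV_consK n : cancel (@rV_cons n) (@rV_uncons n).
Proof.
move=> [x v]; rewrite /rV_uncons mxE unlift_none; congr pair.
by apply/rowP => j; rewrite !mxE liftK.
Qed.

Lemma measurable_rV_cons n :
  measurable_fun [set: measurableTypeR R * 'rV[R]_n] (@rV_cons n).
Proof.
apply: measurable_fun_rVP => i; under eq_fun do rewrite mxE.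
case: (unlift _ i) => [j|]; last exact: measurable_fst.
exact: measurableT_comp (measurable_coord j) measurable_snd.
Qed.

Lemma measurable_rV_uncons n :
  measurable_fun [set: 'rV[R]_n.+1]
    (@rV_uncons n : _ -> measurableTypeR R * 'rV[R]_n).
Proof.
apply: measurable_fun_pair; first exact: measurable_coord.
apply: measurable_fun_rVP => i; under eq_fun do rewrite /= mxE.
exact: measurable_coord.
Qed.

Section step.
Local Open Scope ereal_scope.
Context n (mu : {sigma_finite_measure set 'rV[R]_n -> \bar R}).

Definition lebesgue_rV_step : set 'rV[R]_n.+1 -> \bar R :=
  pushforward (@lebesgue_measure R \x mu) (@rV_cons n).

Let step0 : lebesgue_rV_step set0 = 0.
Proof. by rewrite /lebesgue_rV_step /pushforward preimage_set0 measure0. Qed.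

Let step_ge0 A : 0 <= lebesgue_rV_step A.
Proof. by rewrite /lebesgue_rV_step /pushforward measure_ge0. Qed.

Let step_sigma_additive : semi_sigma_additive lebesgue_rV_step.
Proof.
move=> F mF tF mUF; rewrite /lebesgue_rV_step /pushforward preimage_bigcup.
apply: measure_semi_sigma_additive.
- by move=> k; rewrite -[X in measurable X]setTI; exact: measurable_rV_cons.
- apply/trivIsetP => /= i j _ _ ij; rewrite -preimage_setI.
  by move/trivIsetP : tF => /(_ _ _ _ _ ij) ->//; rewrite preimage_set0.
- rewrite -preimage_bigcup -[X in measurable X]setTI.
  exact: measurable_rV_cons.
Qed.

HB.instance Definition _ := isMeasure.Build _ _ _ lebesgue_rV_step
  step0 step_ge0 step_sigma_additive.

Let step_sigma_finite : sigma_finite setT lebesgue_rV_step.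
Proof.
have /sigma_finiteP[F [FT Fnd Foo]] := sigma_finiteT (@lebesgue_measure R).
have /sigma_finiteP[G [GT Gnd Goo]] := sigma_finiteT mu.
exists (fun i => @rV_uncons n @^-1` (F i `*` G i)).
  apply/esym; rewrite -subTset => v _.
  have [i _ Fi] : (\bigcup_k F k) (v ord0 ord0) by rewrite -FT.
  have [j _ Gj] : (\bigcup_k G k) (rV_uncons v).2 by rewrite -GT.
  exists (maxn i j) => //; split => /=.
    by move: Fi; exact/subsetPset/Fnd/leq_maxl.
  by move: Gj; exact/subsetPset/Gnd/leq_maxr.
move=> i; have [mF Fi] := Foo i; have [mG Gi] := Goo i; split.
  rewrite -[X in measurable X]setTI.
  by apply: measurable_rV_uncons => //; exact: measurableX.
rewrite /lebesgue_rV_step /pushforward -comp_preimage.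
rewrite (_ : _ \o _ = id); last by apply/funext => p; exact: rV_consK.
by rewrite preimage_id product_measure1E// lte_mul_pinfty// ge0_fin_numE.
Qed.

HB.instance Definition _ := Measure_isSigmaFinite.Build _ _ _ lebesgue_rV_step
  step_sigma_finite.

End step.

(* Iterated product of the one-dimensional Lebesgue measure, transported from
   R * R^n to R^(n+1) by rV_cons; lebesgue_rV_box gives its value on boxes. *)
Fixpoint lebesgue_rV n : {sigma_finite_measure set 'rV[R]_n -> \bar R} :=
  match n with
  | 0 => @dirac _ 'rV[R]_0 0 R
  | n'.+1 => lebesgue_rV_step (lebesgue_rV n')
  end.

Lemma lebesgue_rV_box n (A : 'I_n -> set R) : (forall i, measurable (A i)) ->
  lebesgue_rV n [set v | forall i, A i (v ord0 i)] =
  (\prod_(i < n) lebesgue_measure (A i))%E.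
Proof.
elim: n A => [A _|n IH A mA].
  by rewrite big_ord0 /= diracE mem_set// => -[].
rewrite big_ord_recl -(IH (fun i => A (lift ord0 i)))//.
rewrite [LHS]/= /lebesgue_rV_step /pushforward.
rewrite (_ : _ @^-1` _ = A ord0 `*`
    [set v : 'rV[R]_n | forall i, A (lift ord0 i) (v ord0 i)]); last first.
  apply/seteqP; split=> [[x v]/= Av|[x v]/= [A0 Av] i].
    split=> [|i]; first by have := Av ord0; rewrite mxE unlift_none.
    by have := Av (lift ord0 i); rewrite mxE liftK.
  by rewrite mxE; case: unliftP => [j ->|->//]; exact: Av.
rewrite product_measure1E//; first exact: mA.
rewrite [X in measurable X](_ : _ = \bigcap_(i in [set: 'I_n])
    ((fun v : 'rV[R]_n => v ord0 i) @^-1` A (lift ord0 i))).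
  apply: fin_bigcap_measurable => [|i _]; first exact: finite_finset.
  by rewrite -[X in measurable X]setTI; exact: measurable_coord.
by apply/seteqP; split=> [v Av i _|v Av i]; exact: Av.
Qed.

End lebesgue_measure_rV.

Section function_spaces.
Context {R : realType} {n : nat}.
Local Notation E := 'rV[R]_n.
Implicit Types (Omega Gamma : set E) (rho y : E -> R).

Definition dotv (u v : E) : R := \sum_(i < n) u ord0 i * v ord0 i.

(* The library norm of 'rV[R]_n is the sup norm. *)
Definition enorm (v : E) : R := Num.sqrt (dotv v v).

Definition partial (i : 'I_n) (f : E -> R) : E -> R :=
  fun x => 'D_(delta_mx ord0 i) f x.

Definition grad (f : E -> R) (x : E) : E := \row_i partial i f x.

Definition divergence (phi : E -> E) (x : E) : R :=
  \sum_(i < n) partial i (fun z => phi z ord0 i) x.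

Fixpoint Ck (k : nat) (f : E -> R) : Prop :=
  if k is k'.+1 then
    continuous f /\
    forall i : 'I_n, (forall x, derivable f x (delta_mx ord0 i)) /\
                     Ck k' (partial i f)
  else continuous f.

Definition tsupport (Z : nmodType) (f : E -> Z) : set E :=
  closure [set x | f x != 0].

Definition Coo0 (A : set E) : set (E -> R) :=
  [set phi | [/\ forall k, Ck k phi, compact (tsupport phi)
               & tsupport phi `<=` A]].

Definition Coo0_vanishing (Gamma : set E) : set (E -> R) :=
  [set phi | Coo0 setT phi /\ forall x, Gamma x -> phi x = 0].

Definition C10_vec (A : set E) : set (E -> E) :=
  [set phi | [/\ forall i : 'I_n, Ck 1 (fun x => phi x ord0 i),
                 compact (tsupport phi) & tsupport phi `<=` A]].

(* Elements of the spaces below are Borel representatives E -> R; only their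
   values on A matter, and every condition is invariant under modification on a
   null set. *)
Local Notation leb := (@lebesgue_rV R n).

(* Extended-real-valued so that 1 / xi is allowed, with 0^-1 = +oo in \bar R. *)
Definition L1 (A : set E) (f : E -> \bar R) : Prop := leb.-integrable A f.

Definition L2 (A : set E) (f : E -> R) : Prop :=
  measurable_fun A f /\ leb.-integrable A (fun x => (f x ^+ 2)%:E).

Definition L1loc (f : E -> \bar R) : Prop := forall K, compact K -> L1 K f.

Definition L2loc (f : E -> R) : Prop := forall K, compact K -> L2 K f.

Definition is_weak_grad Omega y (g : E -> E) : Prop :=
  (forall i : 'I_n, L1 Omega (fun x => (g x ord0 i)%:E)) /\
  forall phi, Coo0 Omega phi -> forall i : 'I_n,
    (\int[leb]_(x in Omega) (y x * partial i phi x)%:E =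
     - \int[leb]_(x in Omega) (g x ord0 i * phi x)%:E)%E.

(* A choice of representative: weak gradients are unique up to null sets. *)
Definition weak_grad Omega y : E -> E :=
  xget (fun=> 0) [set g | is_weak_grad Omega y g].

Definition W11 Omega : set (E -> R) :=
  [set y | L1 Omega (EFin \o y) /\ exists g, is_weak_grad Omega y g].

Definition W11norm Omega y : \bar R :=
  (\int[leb]_(x in Omega) (`|y x|%R)%:E +
   \int[leb]_(x in Omega) (enorm (weak_grad Omega y x))%:E)%E.

Definition W11_vanishing Omega Gamma : set (E -> R) :=
  [set y | W11 Omega y /\
    forall e : R, 0 < e -> exists2 phi, Coo0_vanishing Gamma phi &
      (W11norm Omega (y \- phi)%R < e%:E)%E].

Definition div_variation Omega rho : \bar R :=
  ereal_sup [set (\int[leb]_(x in Omega) (rho x * divergence phi x)%:E)%E |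
    phi in [set phi | C10_vec Omega phi /\
                      forall x, Omega x -> enorm (phi x) <= 1]].

Definition BV Omega : set (E -> R) :=
  [set rho | L1 Omega (EFin \o rho) /\ (div_variation Omega rho < +oo)%E].

Definition R_ad Omega (xi1 xi2 : E -> R) (m : R) : set (E -> R) :=
  [set rho | [/\ BV Omega rho,
     {ae leb, forall x, Omega x -> 0 <= rho x},
     (\int[leb]_(x in Omega) (rho x)%:E)%E = m%:E &
     {ae leb, forall x, Omega x -> xi1 x <= rho x <= xi2 x}]].

Definition Wnorm Omega rho y : \bar R :=
  ((\int[leb]_(x in Omega)
      (y x ^+ 2 + rho x * enorm (weak_grad Omega y x) ^+ 2)%:E) `^ 2^-1)%E.

Definition W_ Omega GammaD rho : set (E -> R) :=
  [set y | W11_vanishing Omega GammaD y /\ (Wnorm Omega rho y < +oo)%E].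

Definition Xi_W Omega GammaD (xi1 xi2 : E -> R) (m : R) (f : E -> R) :
    set ((E -> R) * (E -> R)) :=
  [set p | let: (rho, y) := p in
    [/\ R_ad Omega xi1 xi2 m rho, W_ Omega GammaD rho y &
        forall phi, Coo0_vanishing GammaD phi ->
          (\int[leb]_(x in Omega)
             (rho x * dotv (weak_grad Omega y x) (grad phi x)
              + y x * phi x)%:E =
           \int[leb]_(x in Omega) (f x * phi x)%:E)%E]].

Definition cost Omega (yd : E -> R) (p : (E -> R) * (E -> R)) : \bar R :=
  let: (rho, y) := p in
  (\int[leb]_(x in Omega) ((`|y x - yd x| ^+ 2)%R)%:E +
   \int[leb]_(x in Omega) (enorm (weak_grad Omega y x) ^+ 2 * rho x)%:E +
   div_variation Omega rho)%E.

Definition boundary (A : set E) : set E := closure A `\` interior A.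

End function_spaces.

(* Around each boundary point, in suitable orthonormal coordinates, the set is
   the strict epigraph of a Lipschitz function of the first n coordinates. *)
Definition lipschitz_boundary (R : realType) (n : nat)
    (Omega : set 'rV[R]_n.+1) : Prop :=
  forall x0, boundary Omega x0 ->
    exists (Q : 'M[R]_n.+1) (gamma : 'rV[R]_n -> R) (L r : R),
      [/\ Q *m Q^T = 1%:M, L.-lipschitz gamma, 0 < r &
          forall x, enorm (x - x0) < r ->
            (Omega x <-> gamma (col' ord_max (x *m Q)) < (x *m Q) ord0 ord_max)].

(* Main.v *)
(* Take a minimizing sequence (rho_k, y_k).  The controls are bounded in BV and
   lie between xi1 and xi2, so a subsequence converges almost everywhere: the
   averages of rho_k over the cells of a fine grid converge along an ultrafilter,
   they differ from rho_k in L^1 by at most the mesh size times the variation of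
   rho_k (up to a constant), and the domination by xi2 takes care of the layer
   near the boundary, which can therefore be arbitrary.

   Put v_k = sqrt(rho_k) grad y_k.  The pairs (y_k, v_k) are bounded in L^2;
   instead of weak compactness we use that near minimizers of the norm on the
   shrinking midpoint hulls of the tails of the sequence converge strongly, by the
   parallelogram identity, and that convex bounds and the weak form of the
   equation pass to midpoints.  The gradients of the convex combinations then
   converge in L^1 to rho^(-1/2) v, because rho_k^(-1/2) converges to rho^(-1/2)
   in L^2 by domination by xi1^(-1/2).  So the limit y belongs to
   W^{1,1}(Omega; Gamma_D) and solves the state equation for rho, and the cost is
   lower semicontinuous.  The same limit theorem, applied with rho_k = rho to a
   minimizing sequence of test functions for the quadratic energy, shows that the
   state equation is solvable, so that there are admissible pairs. *)

(* The gradients of the states live in weighted spaces that change with the control, so no single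
   space contains a minimizing sequence. The factor sqrt(rho_k) moves them to one L^2, and the way
   back is a multiplication by rho^(-1/2), which is square integrable because 1/xi1 is integrable.
   What is lost is the link between the limit field and a gradient. It is recovered by carrying
   triples (y, grad y, v) together with the property that (y, grad y) is an L^1 limit of test
   functions and their gradients: this property is convex, survives L^1 limits, implies that the
   second component is the weak gradient, and is membership in W^{1,1}(Omega; Gamma_D).

   Energy and total variation are not treated by two separate lower limits. For one fixed field phi
   the integral of rho_k div phi simply converges, so near optimality bounds the state cost along a
   tail by a constant that depends on phi; this bound passes to the limit, and only then is the
   supremum over phi taken. The same inequality shows that the limit control has finite
   variation. *)
Require Import Defs.
From mathcomp Require Import all_boot all_order all_algebra.
From mathcomp Require Import all_classical all_reals all_analysis.
From mathcomp Require Import measurable_realfun lra.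
Import Order.TTheory GRing.Theory Num.Theory.
Import numFieldNormedType.Exports.
Local Open Scope classical_set_scope.
Local Open Scope ring_scope.
Set Implicit Arguments.
Unset Strict Implicit.
Unset Printing Implicit Defensive.

(** * Real-valued Lebesgue integrals *)

Lemma geometric_bound_le0 (R : realType) (x c : R) k :
  (forall j, (k <= j)%N -> x <= c / 2 ^+ j) -> x <= 0.
Proof.
move=> h; rewrite leNgt; apply/negP => x0.
have [m mP] : exists m : nat, `|c| / x < m%:R.
  by exists (Num.Def.archi_bound (`|c| / x)); apply: archi_boundP; rewrite divr_ge0// ltW.
have := h (maxn k m) (leq_maxl _ _).
rewrite ler_pdivlMr ?exprn_gt0// leNgt => /negP; apply.
apply: (le_lt_trans (ler_norm c)); move: mP; rewrite ltr_pdivrMr// mulrC => /lt_le_trans; apply.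
rewrite ler_pM2l// -natrX ler_nat (leq_trans (leq_maxr k m))// ltnW// ltn_expl//.
Qed.

Section real_integral.
Context d (T : measurableType d) (R : realType) (mu : {measure set T -> \bar R}).
Context (D : set T) (mD : measurable D).
Implicit Types (f g : T -> R).

(** Estimates are carried out on real integrals of real functions, where [lra] and [nra] apply;
    [EFin_Rintegral] is the bridge to the extended-real integrals of the problem. *)
Definition itg (f : T -> R) := mu.-integrable D (EFin \o f).

Definition square_itg (f : T -> R) :=
  measurable_fun D f /\ itg (fun x => f x ^+ 2).

Lemma itg_meas f : itg f -> measurable_fun D f.
Proof. by move=> /measurable_int /measurable_EFinP. Qed.

Lemma itgP f : measurable_fun D f ->
  (\int[mu]_(x in D) (`|f x|)%:E < +oo)%E -> itg f.
Proof. by move=> mf f_lt; apply/integrableP; split=> //; exact/measurable_EFinP. Qed.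

Lemma eq_itg f g : (forall x, D x -> f x = g x) -> itg f -> itg g.
Proof.
by move=> fg; apply: eq_integrable => // x; rewrite inE => Dx /=; rewrite fg.
Qed.

Lemma itg0 : itg (fun=> 0).
Proof. exact: integrable0. Qed.

Lemma itgD f g : itg f -> itg g -> itg (fun x => f x + g x).
Proof. by move=> hf hg; have := integrableD mD hf hg. Qed.

Lemma itgB f g : itg f -> itg g -> itg (fun x => f x - g x).
Proof. by move=> hf hg; have := integrableB mD hf hg. Qed.

Lemma itgZ k f : itg f -> itg (fun x => k * f x).
Proof. by move=> hf; have := integrableZl mD k hf. Qed.

Lemma itg_norm f : itg f -> itg (fun x => `|f x|).
Proof. exact: integrable_norm. Qed.

Lemma itg_le f g : measurable_fun D f -> (forall x, D x -> `|f x| <= g x) ->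
  itg g -> itg f.
Proof.
move=> mf fg; apply: le_integrable => //; first exact/measurable_EFinP.
by move=> x Dx /=; rewrite lee_fin (le_trans (fg _ Dx))// ler_norm.
Qed.

Lemma itg_sum (I : Type) (s : seq I) (F : I -> T -> R) : (forall i, itg (F i)) ->
  itg (fun x => \sum_(i <- s) F i x).
Proof.
move=> hF; elim: s => [|i s IH].
  by apply: eq_itg itg0 => x _; rewrite big_nil.
by apply: eq_itg (itgD (hF i) IH) => x _; rewrite big_cons.
Qed.

Lemma EFin_Rintegral f : itg f ->
  ((\int[mu]_(x in D) f x)%:E = \int[mu]_(x in D) (f x)%:E)%E.
Proof. by move=> hf; rewrite /Rintegral fineK//; exact: integrable_fin_num. Qed.

Lemma Rintegral_sum (I : Type) (s : seq I) (F : I -> T -> R) :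
  (forall i, itg (F i)) ->
  \int[mu]_(x in D) (\sum_(i <- s) F i x) = \sum_(i <- s) \int[mu]_(x in D) F i x.
Proof.
move=> hF; elim: s => [|i s IH].
  rewrite big_nil (@eq_Rintegral _ _ _ _ _ (fun=> 0)); last first.
    by move=> x _; rewrite big_nil.
  by rewrite Rintegral_cst// mul0r.
rewrite big_cons -IH -RintegralD//; [|exact: hF|exact: itg_sum].
by apply: eq_Rintegral => x _; rewrite big_cons.
Qed.

Lemma itg_indic f A : measurable A -> itg f -> itg (fun x => f x * \1_A x).
Proof.
move=> mA hf; apply: itg_le (itg_norm hf).
  by apply: measurable_funM; [exact: itg_meas|exact: measurable_indic].
move=> x _; rewrite indicE; case: (x \in A); first by rewrite mulr1.
by rewrite mulr0 normr0.
Qed.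

Lemma Rintegral_indic f A : measurable A -> A `<=` D ->
  \int[mu]_(x in D) (f x * \1_A x) = \int[mu]_(x in A) f x.
Proof.
move=> mA AD; rewrite -{2}(setIidr AD) [RHS]Rintegral_mkcondr.
apply: eq_Rintegral => x _; rewrite patchE indicE; case: (x \in A); rewrite ?mulr1//.
by rewrite mulr0.
Qed.

Lemma itgS f A : measurable A -> A `<=` D -> itg f -> mu.-integrable A (EFin \o f).
Proof. by move=> mA AD; exact: integrableS. Qed.

Lemma le_Rintegral_norm f g : itg f -> itg g ->
  (forall x, D x -> `|f x| <= g x) ->
  `|\int[mu]_(x in D) f x| <= \int[mu]_(x in D) g x.
Proof.
move=> hf hg fg; apply: (le_trans (le_normr_Rintegral mD hf)).
by apply: le_Rintegral => //; exact: itg_norm.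
Qed.

Lemma itg_le_ae f g : measurable_fun D f ->
  {ae mu, forall x, D x -> `|f x| <= g x} -> itg g -> itg f.
Proof.
move=> mf fg ig; apply/integrableP; split; first exact/measurable_EFinP.
have /integrableP[_] := ig; apply: le_lt_trans; apply: ae_ge0_le_integral => //.
- by apply: measurableT_comp => //; exact/measurable_EFinP.
- by apply: measurableT_comp => //; exact/measurable_EFinP/(itg_meas ig).
- by apply: filterS fg => x h Dx; rewrite /= lee_fin (le_trans (h Dx))// ler_norm.
Qed.

Lemma square_itg_le_ae f g : measurable_fun D f ->
  {ae mu, forall x, D x -> f x ^+ 2 <= g x} -> itg g -> square_itg f.
Proof.
move=> mf fg ig; split=> //; apply: itg_le_ae ig; first exact: measurable_funX.
by apply: filterS fg => x h Dx; rewrite ger0_norm ?sqr_ge0// h.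
Qed.

Lemma Rintegral_dominated_ae (F : (T -> R)^nat) f g :
  (forall n, measurable_fun D (F n)) -> measurable_fun D f ->
  {ae mu, forall x, D x -> F ^~ x @ \oo --> f x} -> itg g ->
  (forall n, {ae mu, forall x, D x -> `|F n x| <= g x}) ->
  [/\ itg f, \int[mu]_(x in D) F n x @[n --> \oo] --> \int[mu]_(x in D) f x &
    \int[mu]_(x in D) `|F n x - f x| @[n --> \oo] --> 0].
Proof.
move=> mF mf Ff ig Fg.
have iF n : itg (F n) by exact: itg_le_ae (mF n) (Fg n) ig.
have [] := @dominated_convergence _ _ _ mu D mD (fun n => EFin \o F n) (EFin \o f)
  (EFin \o g).
- by move=> n; exact/measurable_EFinP.
- exact/measurable_EFinP.
- by apply: filterS Ff => x h Dx; apply: cvg_EFin; [exact: nearW|exact: h].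
- exact: ig.
- have := Fg; move=> /ae_foralln; apply: filterS => x h n Dx.
  by rewrite /= lee_fin; exact: h.
move=> fi F0 FI; split=> //.
- apply/fine_cvg; rewrite EFin_Rintegral//.
- apply/fine_cvg; move: F0; congr (_ @ \oo --> _).
Qed.

Lemma Rintegral_dominated (F : (T -> R)^nat) f g :
  (forall n, measurable_fun D (F n)) ->
  (forall x, D x -> F ^~ x @ \oo --> f x) -> itg g ->
  (forall n x, D x -> `|F n x| <= g x) ->
  [/\ itg f, \int[mu]_(x in D) F n x @[n --> \oo] --> \int[mu]_(x in D) f x &
    \int[mu]_(x in D) `|F n x - f x| @[n --> \oo] --> 0].
Proof.
move=> mF Ff ig Fg; apply: Rintegral_dominated_ae ig _ => //.
- exact: measurable_fun_cvg Ff.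
- exact: aeW.
- by move=> n; apply: aeW; exact: Fg.
Qed.

Lemma Rintegral_fatou (F : (T -> R)^nat) f c :
  (forall n, itg (F n)) -> (forall n x, D x -> 0 <= F n x) ->
  (forall x, D x -> F ^~ x @ \oo --> f x) ->
  (forall n, \int[mu]_(x in D) F n x <= c) ->
  itg f /\ \int[mu]_(x in D) f x <= c.
Proof.
move=> iF F0 Ff Fc.
have mF n : measurable_fun D (F n) by exact: itg_meas.
have mf : measurable_fun D f by exact: measurable_fun_cvg Ff.
have f0 x : D x -> 0 <= f x.
  by move=> Dx; apply: (cvgr_to_ge (Ff x Dx)); apply: nearW => n; exact: F0.
have fle : (\int[mu]_(x in D) (f x)%:E <= c%:E)%E.
  have := @fatou _ _ _ mu D mD (fun n => EFin \o F n).
  have -> : (\int[mu]_(x in D) limn_einf (fun n => (EFin \o F n) x) =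
             \int[mu]_(x in D) (f x)%:E)%E.
    apply: eq_integral => x; rewrite inE => Dx.
    have /cvg_limn_einf_sup[-> _] // : (fun n => (EFin \o F n) x) @ \oo --> (f x)%:E.
    by apply: cvg_EFin; [exact: nearW|exact: Ff].
  move=> /(_ _ _)/le_trans; apply.
  - by move=> n; exact/measurable_EFinP.
  - by move=> n x Dx; rewrite lee_fin F0.
  apply: (@le_trans _ _ (limn_einf (fun=> c%:E))).
    rewrite limn_einf_lim limn_einf_lim; apply: lee_lim; [exact: is_cvg_einfs..|].
    apply: nearW => n; rewrite /=.
    apply: (@le_trans _ _ (\int[mu]_(x in D) (F n x)%:E)%E); last first.
      by apply: le_ereal_inf_tmp => _ [m /= nm <-]; rewrite -EFin_Rintegral// lee_fin.
    by apply: ereal_inf_lbound; exists n => /=.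
  have /cvg_limn_einf_sup[-> _] // : (fun _ : nat => c%:E) @ \oo --> c%:E.
  exact: cvg_cst.
have fi : itg f.
  apply: itgP => //; rewrite (eq_integral (fun x => (f x)%:E)).
    exact: le_lt_trans fle (ltry _).
  by move=> x; rewrite inE => Dx; rewrite ger0_norm// f0.
by split=> //; rewrite -lee_fin EFin_Rintegral.
Qed.

(** The sum of the increments |F (n+1) - F n| has a finite integral, hence is finite almost
    everywhere; there the telescoping series converges absolutely. *)
Lemma fast_cauchy_ae_cvg (F : (T -> R)^nat) (c : R) :
  (forall n, itg (F n)) ->
  (forall n, \int[mu]_(x in D) `|F n.+1 x - F n x| <= c / 2 ^+ n) ->
  {ae mu, forall x, D x -> cvgn (F ^~ x)}.
Proof.
move=> iF Fc.
pose G n x := `|F n.+1 x - F n x|.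
have iG n : itg (G n) by apply: itg_norm; exact: itgB.
have mG n : measurable_fun D (EFin \o G n) by exact/measurable_EFinP/itg_meas.
have c0 : 0 <= c.
  have := le_trans (Rintegral_ge0 _ _) (Fc 0%N).
  by rewrite expr0 divr1; apply => x _.
pose S x := (\sum_(n <oo) (G n x)%:E)%E.
have iS : mu.-integrable D S.
  apply/integrableP; split.
    by apply: ge0_emeasurable_sum => [n x Dx _|n _]; [rewrite lee_fin normr_ge0|exact: mG].
  have S0 x : (0 <= S x)%E by apply: nneseries_ge0 => n _; rewrite lee_fin normr_ge0.
  rewrite (eq_integral S); last by move=> x _; rewrite gee0_abs.
  rewrite integral_nneseries//; last by move=> n x Dx; rewrite lee_fin normr_ge0.
  apply: (@le_lt_trans _ _ (\sum_(n <oo) (c / 2 ^+ n)%:E)%E).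
    apply: lee_nneseries => [n _ _|n _].
      by apply: integral_ge0 => x _; rewrite lee_fin normr_ge0.
    by rewrite -EFin_Rintegral ?lee_fin; [exact: Fc|exact: iG].
  have -> : (\sum_(n <oo) (c / 2 ^+ n)%:E)%E = (c / (1 - 2^-1))%:E.
    have h : series (geometric c (2^-1 : R)) @ \oo --> c / (1 - 2^-1).
      by apply: cvg_geometric_series; rewrite ger0_norm ?invf_lt1 ?ltr1n.
    apply/cvg_lim => //.
    have -> : (fun n => (\sum_(0 <= k < n) (c / 2 ^+ k)%:E)%E) =
              EFin \o series (geometric c (2^-1 : R)).
      apply/funext => n /=; rewrite sumEFin; congr EFin.
      by apply: eq_bigr => k _; rewrite /geometric /= exprVn.
    by apply: cvg_EFin => //; exact: nearW.
  exact: ltry.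
apply: filterS (integrable_ae mD iS) => x + Dx => /(_ Dx) Sx.
have cG : cvgn (series (G ^~ x)).
  apply: nondecreasing_is_cvgn.
    by apply: nondecreasing_series => n _ _; exact: normr_ge0.
  exists (fine (S x)) => _ [n _ <-].
  rewrite -lee_fin fineK// -sumEFin.
  by apply: nneseries_lim_ge => k _ _; rewrite lee_fin normr_ge0.
have cT : cvgn (series (telescope (F ^~ x))) by exact: normed_cvg.
rewrite (_ : F ^~ x = (fun n => series (telescope (F ^~ x)) n + F 0%N x)).
  by apply: is_cvgD => //; exact: is_cvg_cst.
by apply/funext => n; rewrite addrC; exact: (eq_sum_telescope (F ^~ x) n).
Qed.

Lemma Rintegral_negligible (N : set T) f : measurable N -> mu N = 0 -> itg f ->
  \int[mu]_(x in D `\` N) f x = \int[mu]_(x in D) f x.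
Proof. by move=> mN N0 hf; rewrite /Rintegral -negligible_integral. Qed.

Lemma Rintegral_ae_eq f g : itg f -> itg g ->
  {ae mu, forall x, D x -> f x = g x} ->
  \int[mu]_(x in D) f x = \int[mu]_(x in D) g x.
Proof.
move=> hf hg fg; rewrite /Rintegral; congr fine.
apply: ae_eq_integral => //; [exact/measurable_EFinP/itg_meas..|].
by apply: filterS fg => x h Dx; rewrite h.
Qed.

Lemma itg_ae_eq f g : itg f -> measurable_fun D g ->
  {ae mu, forall x, D x -> f x = g x} ->
  itg g /\ \int[mu]_(x in D) f x = \int[mu]_(x in D) g x.
Proof.
move=> hf mg fg; have ig : itg g.
  by apply: itg_le_ae (itg_norm hf) => //; apply: filterS fg => x h Dx; rewrite h.
by split=> //; exact: Rintegral_ae_eq.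
Qed.

Lemma le_Rintegral_ae f g : itg f -> itg g ->
  {ae mu, forall x, D x -> f x <= g x} ->
  \int[mu]_(x in D) f x <= \int[mu]_(x in D) g x.
Proof.
move=> hf hg [N [mN N0 sub]]; rewrite -!(Rintegral_negligible mN N0)//.
have mDN : measurable (D `\` N) by exact: measurableD.
apply: le_Rintegral => //; [by apply: integrableS hf|by apply: integrableS hg|].
by move=> x [Dx Nx]; apply: contrapT => h; apply: Nx; apply: sub => /(_ Dx).
Qed.

Lemma itg_bounded (M : R) f : (mu D < +oo)%E -> measurable_fun D f ->
  (forall x, D x -> `|f x| <= M) -> itg f.
Proof.
move=> Doo mf fM; apply: measurable_bounded_integrable => //.
by exists M; split; [exact: num_real|move=> y My x Dx; exact: le_trans (fM x Dx) (ltW My)].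
Qed.

Lemma square_itgM f g : square_itg f -> square_itg g -> itg (fun x => f x * g x).
Proof.
move=> [mf if2] [mg ig2].
apply: (@itg_le _ (fun x => f x ^+ 2 + g x ^+ 2)).
- exact: measurable_funM.
- move=> x _; rewrite normrM -(real_normK (num_real (f x))) -(real_normK (num_real (g x))).
  by have := normr_ge0 (f x); have := normr_ge0 (g x); nra.
- exact: itgD.
Qed.

Lemma square_itgD f g : square_itg f -> square_itg g ->
  square_itg (fun x => f x + g x).
Proof.
move=> hf hg; have := square_itgM hf hg.
move: hf hg => [mf if2] [mg ig2] ifg; split; first exact: measurable_funD.
apply: (@eq_itg (fun x => f x ^+ 2 + 2 * (f x * g x) + g x ^+ 2)).
  by move=> x _; lra.
by apply: itgD => //; apply: itgD => //; exact: itgZ.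
Qed.

Lemma square_itgZ k f : square_itg f -> square_itg (fun x => k * f x).
Proof.
move=> [mf if2]; split; first exact: measurable_funM.
by apply: (@eq_itg (fun x => k ^+ 2 * f x ^+ 2)) (itgZ _ if2) => x _; rewrite exprMn.
Qed.

Lemma square_itgB f g : square_itg f -> square_itg g ->
  square_itg (fun x => f x - g x).
Proof.
move=> hf /(square_itgZ (-1))/(square_itgD hf)[mfg ifg]; split.
  by apply: eq_measurable_fun mfg => x _; rewrite mulN1r.
by apply: eq_itg ifg => x _; rewrite mulN1r.
Qed.

(* Young's inequality replaces the Cauchy-Schwarz inequality, so that no square
   root of an integral is needed. *)
Lemma Rintegral_young f g (t : R) : 0 < t -> square_itg f -> square_itg g ->
  \int[mu]_(x in D) `|f x * g x| <=
  (t * \int[mu]_(x in D) (f x ^+ 2) + t^-1 * \int[mu]_(x in D) (g x ^+ 2)) / 2.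
Proof.
move=> t0 hf hg; have ifg := square_itgM hf hg.
move: hf hg => [mf if2] [mg ig2].
rewrite -!RintegralZl// -RintegralD//; [|exact: itgZ..].
rewrite -RintegralZr//; last by apply: itgD; exact: itgZ.
apply: le_Rintegral => //.
- exact: itg_norm.
- apply: (@eq_itg (fun x => 2^-1 * (t * f x ^+ 2 + t^-1 * g x ^+ 2))).
    by move=> x _; rewrite mulrC.
  by apply: itgZ; apply: itgD; exact: itgZ.
move=> x _; rewrite normrM -(real_normK (num_real (f x))) -(real_normK (num_real (g x))).
set a := `|f x|; set b := `|g x|.
(* The claim is the expansion of t (a - b/t)^2 >= 0; the cancellation of t with its inverse is
   supplied to [nra] in the two products where it occurs. *)
have tt : t * t^-1 = 1 by rewrite divff// gt_eqF.
have h1 : t * t^-1 * (a * b) = a * b by rewrite tt mul1r.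
have h2 : t * t^-1 * (t^-1 * b ^+ 2) = t^-1 * b ^+ 2 by rewrite tt mul1r.
have : 0 <= t * (a - t^-1 * b) ^+ 2 by rewrite mulr_ge0 ?sqr_ge0// ltW.
by move: h1 h2; set u := t^-1; nra.
Qed.

End real_integral.

Section fast_cauchy.
Context d (T : measurableType d) (R : realType) (mu : {measure set T -> \bar R}).
Context (D : set T) (mD : measurable D).

(** Completeness of L^1 with a rate. The pointwise limit is set to 0 off the convergence set, and
    Fatou's lemma applied to |F (n + m) - F n| as m grows gives both integrability and the rate. *)
Lemma fast_cauchy_lim (F : (T -> R)^nat) (c : R) :
  (forall n, itg mu D (F n)) ->
  (forall n, \int[mu]_(x in D) `|F n.+1 x - F n x| <= c / 2 ^+ n) ->
  exists f, [/\ itg mu D f, {ae mu, forall x, D x -> F ^~ x @ \oo --> f x} &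
    forall n, \int[mu]_(x in D) `|f x - F n x| <= 2 * c / 2 ^+ n].
Proof.
move=> iF Fc; have [N [mN N0 sub]] := fast_cauchy_ae_cvg mD iF Fc.
have Fcv x : (D `\` N) x -> cvgn (F ^~ x).
  by move=> [Dx Nx]; apply: contrapT => h; apply: Nx; apply: sub => /= /(_ Dx).
have mDN : measurable (D `\` N) by exact: measurableD.
pose f := (fun x => limn (F ^~ x)) \_ (D `\` N).
have fE x : (D `\` N) x -> f x = limn (F ^~ x).
  by move=> h; rewrite /f patchE mem_set.
have Ff x : (D `\` N) x -> F ^~ x @ \oo --> f x by move=> h; rewrite fE//; exact: Fcv.
have itgDN g : itg mu D g -> mu.-integrable (D `\` N) (EFin \o g).
  by apply: integrableS => //; exact: measurableD.
have mf : measurable_fun (D `\` N) f.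
  by apply: measurable_fun_cvg Ff => n; exact: measurable_funS (itg_meas (iF n)).
(* The exact geometric sum, remainder included, is what makes the induction on [m] close. *)
have bnd n m : \int[mu]_(x in D) `|F (n + m)%N x - F n x| <= 2 * c / 2 ^+ n - 2 * c / 2 ^+ (n + m).
  elim: m => [|m IH].
    rewrite addn0 subrr (@eq_Rintegral _ _ _ _ _ (fun=> 0)) ?Rintegral_cst ?mul0r// => x _.
    by rewrite subrr normr0.
  have h : \int[mu]_(x in D) `|F (n + m.+1)%N x - F n x| <=
      \int[mu]_(x in D) `|F (n + m).+1 x - F (n + m)%N x| + \int[mu]_(x in D) `|F (n + m)%N x - F n x|.
    rewrite -RintegralD//; [|by apply: itg_norm; exact: itgB..].
    apply: le_Rintegral => //.
    - by apply: itg_norm; exact: itgB.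
    - by apply: (itgD mD); apply: itg_norm; exact: itgB.
    - by move=> x _; rewrite addnS; apply: ler_distD.
  apply: (le_trans h); apply: (le_trans (lerD (Fc _) IH)).
  rewrite addnS exprS; have : (2 : R) ^+ (n + m) != 0 by rewrite expf_neq0.
  by rewrite invfM; set t := (2 ^+ (n + m))^-1; lra.
have c0 : 0 <= c.
  have := le_trans (Rintegral_ge0 _ _) (Fc 0%N).
  by rewrite expr0 divr1; apply => x _.
have fat n : mu.-integrable (D `\` N) (EFin \o (fun x => `|f x - F n x|)) /\
    \int[mu]_(x in D `\` N) `|f x - F n x| <= 2 * c / 2 ^+ n.
  apply: (@Rintegral_fatou _ _ _ _ _ mDN (fun m x => `|F (n + m)%N x - F n x|)) => //.
  - by move=> m; apply: itgDN; apply: itg_norm; exact: itgB.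
  - move=> x DNx; apply: cvg_norm; apply: cvgB; last exact: cvg_cst.
    by have := Ff x DNx; rewrite -(cvg_shiftn n); under eq_fun do rewrite addnC.
  - move=> m; rewrite Rintegral_negligible//; last by apply: itg_norm; exact: itgB.
    apply: (le_trans (bnd n m)); rewrite lerBlDr lerDl divr_ge0 ?exprn_ge0//.
    by rewrite mulr_ge0.
have ifDN : mu.-integrable (D `\` N) (EFin \o f).
  apply: (@itg_le _ _ _ _ _ _ _ (fun x => `|f x - F 0%N x| + `|F 0%N x|)) => //.
    by move=> x _; rewrite -{1}(subrK (F 0%N x) (f x)) ler_normD.
  by apply: (itgD mDN) => //; [exact: (fat 0%N).1|apply: itgDN; exact: itg_norm].
have if_ : itg mu D f.
  have /(integrable_mkcond _ mDN) h := ifDN.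
  apply: (integrableS measurableT) => //; apply: eq_integrable h => // x _.
  by rewrite patchE; case: ifPn => // h; rewrite /= /f patchE (negbTE h).
exists f; split=> //.
  exists N; split=> // x /= /not_implyP[Dx nF].
  by apply: contrapT => Nx; apply: nF; apply: Ff.
move=> n; rewrite -(Rintegral_negligible mD mN N0); last by apply: itg_norm; exact: itgB.
exact: (fat n).2.
Qed.

End fast_cauchy.

(** * Lebesgue measure on R^n *)

(* Coercing once and for all to plain measures keeps a single path from
   [lebesgue_rV] to the measure structure in the terms to be rewritten. *)
Definition leb_rV {R : realType} n : {measure set 'rV[R]_n -> \bar R} :=
  lebesgue_rV n.

Section boxes.
Context {R : realType} {n : nat}.
Local Notation E := 'rV[R]_n.+1.
Local Notation leb := (@leb_rV R n.+1).
Implicit Types (a b v x y : E).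

Lemma rV_ballP x y (e : R) : 0 < e ->
  ball x e y <-> forall i, `|x ord0 i - y ord0 i| < e.
Proof.
move=> e0; split=> [[_ h] i|h]; first exact: (h ord0 i).
by split=> // i j; rewrite ord1; exact: h.
Qed.

Lemma open_rVP (O : set E) x : open O -> O x ->
  exists2 e : R, 0 < e & forall y, (forall i, `|x ord0 i - y ord0 i| < e) -> O y.
Proof.
move=> oO Ox; have /nbhs_ballP[e /= e0 eO] : nbhs x O by exact: open_nbhs_nbhs.
by exists e => // y xy; apply: eO; exact/rV_ballP.
Qed.

Lemma coord_le_norm x i : `|x ord0 i| <= `|x|.
Proof.
rewrite [leRHS]mx_normrE; apply: (le_trans _ (@le_bigmax _ _ _ 0 (fun i => `|x i.1 i.2|) (ord0, i))) => //.
Qed.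

(** Half-open boxes are stable under intersection and are cut into disjoint half-open boxes, with no
    faces to discard. *)
Definition box a b : set E := [set v | forall i, a ord0 i < v ord0 i <= b ord0 i].

Lemma boxI a b a' b' : box a b `&` box a' b' =
  box (\row_i Num.max (a ord0 i) (a' ord0 i)) (\row_i Num.min (b ord0 i) (b' ord0 i)).
Proof.
apply/seteqP; split=> v.
  by move=> [h h'] i; move: (h i) (h' i); rewrite !mxE gt_max le_min => /andP[-> ->] /andP[-> ->].
by move=> h; split=> i; move: (h i); rewrite !mxE gt_max le_min;
  move=> /andP[/andP[? ?] /andP[? ?]]; apply/andP.
Qed.

Lemma rV_measurable_pi (A : 'I_n.+1 -> set R) : (forall i, measurable (A i)) ->
  measurable [set v : E | forall i, A i (v ord0 i)].
Proof.
move=> mA; rewrite (_ : [set _ | _] =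
    \bigcap_(i in [set: 'I_n.+1]) ((fun v : E => v ord0 i) @^-1` A i)).
  apply: fin_bigcap_measurable => [|i _]; first exact: finite_finset.
  by rewrite -[X in measurable X]setTI; exact: measurable_coord.
by apply/seteqP; split=> [v Av i _|v Av i]; exact: Av.
Qed.

Lemma boxE a b :
  box a b = [set v | forall i, `]a ord0 i, b ord0 i]%classic (v ord0 i)].
Proof. by apply/seteqP; split=> v h i; move: (h i); rewrite /= in_itv. Qed.

Lemma measurable_box a b : measurable (box a b).
Proof.
rewrite boxE; apply: (rV_measurable_pi (A := fun i => `]a ord0 i, b ord0 i]%classic)) => i.
exact: measurable_itv.
Qed.

Lemma leb_box a b : (forall i, a ord0 i <= b ord0 i) ->
  leb (box a b) = (\prod_(i < n.+1) (b ord0 i - a ord0 i))%:E.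
Proof.
move=> ab; rewrite boxE [LHS](lebesgue_rV_box (A := fun i => `]a ord0 i, b ord0 i]%classic))//.
rewrite -prodEFin; apply: eq_bigr => i _; rewrite lebesgue_measure_itv/= lte_fin.
case: ltgtP (ab i) => // -> _; by rewrite subrr.
Qed.

Lemma box_eq0 a b i : b ord0 i <= a ord0 i -> box a b = set0.
Proof.
move=> ba; rewrite -subset0 => v /(_ i) /andP[av vb].
by have := lt_le_trans av (le_trans vb ba); rewrite ltxx.
Qed.

Lemma leb_box_fin a b : (leb (box a b) < +oo)%E.
Proof.
have [ab|/existsNP[i /negP]] := pselect (forall i, a ord0 i <= b ord0 i).
  by rewrite leb_box// ltry.
by rewrite -ltNge => /ltW /box_eq0 ->; rewrite measure0.
Qed.

(** The sigma-algebra is generated by the coordinates, so an open set is exhibited as a countable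
    union of open cubes with rational centres and sides of length 2/(k+1). *)
Lemma open_measurable (O : set E) : open O -> measurable O.
Proof.
move=> oO.
pose r2R (q : 'rV[rat]_n.+1) i : R := ratr (q ord0 i).
pose B (p : 'rV[rat]_n.+1 * nat) : set E :=
  [set v | forall i, `]r2R p.1 i - p.2.+1%:R^-1, r2R p.1 i + p.2.+1%:R^-1[%classic (v ord0 i)].
have -> : O = \bigcup_(p in [set p | B p `<=` O]) B p.
  apply/seteqP; split=> [x Ox|x [p /= pO px]]; last exact: pO.
  have [e e0 eO] := open_rVP oO Ox.
  (* A cube of half-side 1/(k+1) < e/2 around a rational point that is 1/(k+1)-close to [x] contains
     [x] and stays within distance [e] of it. *)
  have /ltr_add_invr[k] : (0 : R) < e / 2 by rewrite divr_gt0.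
  rewrite add0r => ke.
  have k0 : (0 : R) < k.+1%:R^-1 by rewrite invr_gt0.
  have q_ex i : exists q : rat, ratr q \in `]x ord0 i - k.+1%:R^-1, x ord0 i + k.+1%:R^-1[.
    by apply: rat_in_itvoo; move: k0; set t := k.+1%:R^-1; lra.
  have [q qP] := choice q_ex.
  exists (\row_i q i, k) => /=.
    move=> y yB; apply: eO => i.
    move: (yB i) (qP i); rewrite /r2R /= mxE !in_itv/=; move: ke; set t := k.+1%:R^-1 => ke.
    by rewrite ltr_norml; lra.
  move=> i; move: (qP i); rewrite /r2R /= mxE !in_itv/=; set t := k.+1%:R^-1.
  by lra.
rewrite bigcup_mkcond; apply: countable_bigcupT_measurable; first exact: countableP.
move=> p; case: ifPn => _ //.
by apply: (rV_measurable_pi (A := fun i => `]_, _[%classic)) => i; exact: measurable_itv.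
Qed.

Lemma measurable_continuous (f : E -> R) (D : set E) :
  measurable D -> continuous f -> measurable_fun D f.
Proof.
move=> mD cf; apply: (measurable_funS measurableT) => //.
apply: (measurability _ (RGenOpens.measurableE R)) => _ [_ [x [y ->]] <-].
by rewrite setTI; apply: open_measurable; move/continuousP: cf; apply; exact: interval_open.
Qed.

Lemma closed_measurable (C : set E) : closed C -> measurable C.
Proof. by rewrite -openC => /open_measurable /measurableC; rewrite setCK. Qed.

Lemma compact_measurable (K : set E) : compact K -> measurable K.
Proof. by move=> /(compact_closed (@norm_hausdorff _ _)); exact: closed_measurable. Qed.

Definition rV_const (c : R) : E := \row_i c.

Lemma bounded_sub_box (K : set E) : bounded_set K ->
  exists2 M : R, 0 < M & K `<=` box (rV_const (- M)) (rV_const M).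
Proof.
move=> [M [_ KM]]; exists (Num.max M 0 + 2); first by rewrite ltr_wpDl// le_max lexx orbT.
move=> v Kv i; rewrite !mxE.
have /(KM _)/(_ v Kv) : M < Num.max M 0 + 1.
  by rewrite ltr_pwDr// le_max lexx.
by move=> /(le_trans (coord_le_norm v i)); rewrite ler_norml => /andP[]; lra.
Qed.

Lemma leb_bounded_fin (K : set E) : measurable K -> bounded_set K -> (leb K < +oo)%E.
Proof.
move=> mK /bounded_sub_box[M _ KM].
apply: le_lt_trans (leb_box_fin (rV_const (- M)) (rV_const M)).
by apply: le_measure => //; rewrite inE//; exact: measurable_box.
Qed.

Definition boxes : set (set E) := [set A | exists a b, A = box a b].

Lemma boxes_setI : setI_closed boxes.
Proof.
by move=> _ _ [a [b ->]] [a' [b' ->]]; rewrite boxI; eexists; eexists; reflexivity.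
Qed.

Lemma bigcup_box : \bigcup_k box (rV_const (- k%:R)) (rV_const k%:R) = [set: E].
Proof.
rewrite -subTset => v _; have [k vk] : exists k : nat, `|v| < k%:R.
  by exists (Num.Def.archi_bound `|v|); apply: archi_boundP.
exists k => // i; rewrite !mxE.
by have := le_lt_trans (coord_le_norm v i) vk; rewrite ltr_norml => /andP[-> /ltW].
Qed.

(** Boxes thus form a generating family stable under intersection, on which a measure is determined.
    For the nontrivial inclusion, the sets [B] whose i-th cylinder is generated by boxes form a
    sigma-algebra, and the cylinder over ]c, d] is a union of boxes whose other sides grow. *)
Lemma boxes_generate : (@measurable _ E : set (set E)) = <<s boxes >>.
Proof.
apply/seteqP; split; last first.
  apply: smallest_sub; first exact: sigma_algebra_measurable.
  by move=> _ [a [b ->]]; exact: measurable_box.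
apply: smallest_sub; first exact: smallest_sigma_algebra.
rewrite -bigcup_seq; apply: bigcup_sub => i _ A [B mB <-]; rewrite setTI.
suff : (@measurable _ (measurableTypeR R)) `<=` [set B | <<s boxes >> ((fun v : E => v ord0 i) @^-1` B)].
  by apply.
apply: smallest_sub.
  have [s0 sC sU] := smallest_sigma_algebra [set: E] boxes; split=> /=.
  - by rewrite preimage_set0.
  - by move=> C; rewrite !setTD => /sC; rewrite setTD.
  - by move=> F FP; rewrite preimage_bigcup; exact: sU.
move=> _ /= [[c d] _ <-] /=.
rewrite (_ : _ @^-1` _ = \bigcup_k box (\row_j if j == i then c else - k%:R)
   (\row_j if j == i then d else k%:R)).
  have [_ _ sU] := smallest_sigma_algebra [set: E] boxes.
  by apply: sU => k; apply: sub_sigma_algebra; eexists; eexists; reflexivity.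
apply/seteqP; split=> [v /= vcd|v [k _ /(_ i)]]; last by rewrite !mxE eqxx /= in_itv.
have : (\bigcup_k box (rV_const (- k%:R)) (rV_const k%:R)) v by rewrite bigcup_box.
move=> [k _ vk]; exists k => // j; rewrite !mxE; case: eqVneq => [->|_].
  by move: vcd; rewrite in_itv.
by move: (vk j); rewrite !mxE.
Qed.

Definition translate (h v : E) : E := v + h.

Lemma measurable_translate h : measurable_fun [set: E] (translate h).
Proof.
apply: measurable_fun_rVP => i; under eq_fun do rewrite mxE.
by apply: measurable_funD => //; exact: measurable_coord.
Qed.

(** Uniqueness of measures requires a bundled measure; the existential leaves of it only the
    equation between set functions. *)
Lemma translated_measure h : exists m : {measure set E -> \bar R},
  m = pushforward leb (translate h) :> (set E -> \bar R).
Proof.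
unshelve eexists [the measure _ _ of pushforward leb (translate h)]; last by [].
exact: measurable_translate.
Qed.

(** Both sides are measures that agree on boxes, whose volume depends on the side lengths alone. *)
Lemma leb_translate h A : measurable A -> leb (translate h @^-1` A) = leb A.
Proof.
move=> mA.
have [m2 m2E] := translated_measure h.
have -> : leb (translate h @^-1` A) = m2 A by rewrite m2E.
apply: (measure_unique boxes
  (fun k => box (rV_const (- k%:R)) (rV_const k%:R))) => //.
- exact: boxes_generate.
- exact: boxes_setI.
- by move=> k; eexists; eexists; reflexivity.
- exact: bigcup_box.
- move=> _ [a [b ->]]; rewrite m2E /pushforward.
  have -> : translate h @^-1` box a b = box (a - h) (b - h).
    apply/seteqP; split=> v hv i; move: (hv i); rewrite /= ?mxE.
      by rewrite ltrBlDr lerBrDr.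
    by rewrite ltrBlDr lerBrDr.
  have [ab|/existsNP[i /negP]] := pselect (forall i, a ord0 i <= b ord0 i).
    rewrite [RHS]leb_box// leb_box; last by move=> i; rewrite !mxE lerD2r.
    by congr EFin; apply: eq_bigr => i _; rewrite !mxE; lra.
  rewrite -ltNge => /ltW ba; rewrite (box_eq0 ba) (@box_eq0 _ _ i) ?measure0//.
  by rewrite !mxE lerD2r.
- move=> k; rewrite m2E /pushforward.
  have -> : translate h @^-1` box (rV_const (- k%:R)) (rV_const k%:R) =
      box (rV_const (- k%:R) - h) (rV_const k%:R - h).
    apply/seteqP; split=> v hv i; move: (hv i); rewrite /= ?mxE.
      by rewrite ltrBlDr lerBrDr.
    by rewrite ltrBlDr lerBrDr.
  exact: leb_box_fin.
Qed.

(** Used to see that difference quotients have integral zero, which is the source of integration by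
    parts. *)
Lemma Rintegral_translate h (f : E -> R) : leb.-integrable setT (EFin \o f) ->
  leb.-integrable setT (EFin \o (fun v => f (v + h))) /\
  \int[leb]_v f (v + h) = \int[leb]_v f v.
Proof.
move=> fi.
have [m2 m2E] := translated_measure h.
have m2leb A : measurable A -> A `<=` [set: E] -> m2 A = leb A.
  by move=> mA _; rewrite m2E; exact: leb_translate.
have mf : measurable_fun [set: E] (EFin \o f) by exact: measurable_int fi.
have mft : measurable_fun [set: E] (EFin \o (fun v => f (v + h))).
  exact: measurableT_comp mf (measurable_translate h).
have fi2 : leb.-integrable setT (EFin \o (fun v => f (v + h))).
  apply/integrableP; split=> //.
  have := @ge0_integral_pushforward _ _ _ _ _ _ (measurable_translate h) leb setT
    (abse \o (EFin \o f)) measurableT.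
  rewrite preimage_setT => /(_ _ _)/esym; rewrite -m2E => ->.
  - by rewrite (eq_measure_integral leb)//; case/integrableP: fi.
  - exact: measurableT_comp.
  - by move=> y _; rewrite /= lee_fin.
split=> //; rewrite /Rintegral; congr fine.
have := @integral_pushforward _ _ _ _ _ _ (measurable_translate h) leb setT _ mf.
rewrite preimage_setT => /(_ fi2 measurableT)/esym; rewrite -m2E => ->.
by apply: eq_measure_integral => A mA sA; rewrite m2leb.
Qed.

End boxes.

(** * Partitions into cells *)

Section tilings.
Context {R : realType} {n : nat}.
Local Notation E := 'rV[R]_n.+1.
Local Notation leb := (@leb_rV R n.+1).
Implicit Types (a w x : E) (i j : 'I_n.+1) (s : seq E) (U : set E) (u : E -> R).

Definition cell w a : set E := box a (a + w).

Definition vol w : R := \prod_(i < n.+1) w ord0 i.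

(** Subtracted from the width of a cell it gives the width of the two halves in direction [i]; added
    to the corner it gives the corner of the upper half. *)
Definition half i w : E := (w ord0 i / 2) *: delta_mx ord0 i.

Definition pos_width w := forall i, 0 < w ord0 i.

Lemma half_coord i w j : half i w ord0 j = if j == i then w ord0 i / 2 else 0.
Proof. by rewrite !mxE eqxx /=; case: eqP => _; rewrite ?mulr1 ?mulr0. Qed.

Lemma sub_half_coord i w j :
  (w - half i w) ord0 j = if j == i then w ord0 i / 2 else w ord0 j.
Proof.
rewrite mxE [X in _ + X]mxE half_coord; case: eqP => [->|_]; last by rewrite subr0.
by lra.
Qed.

Lemma pos_half i w : pos_width w -> pos_width (w - half i w).
Proof. by move=> w0 j; rewrite sub_half_coord; case: eqP => // _; rewrite divr_gt0. Qed.

Lemma vol_half i w : vol (w - half i w) = vol w / 2.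
Proof.
rewrite /vol (bigD1 i)//= [in RHS](bigD1 i)//= sub_half_coord eqxx.
rewrite (eq_bigr (fun j => w ord0 j)); first by rewrite mulrAC.
by move=> j ji; rewrite sub_half_coord (negbTE ji).
Qed.

Lemma vol_gt0 w : pos_width w -> 0 < vol w.
Proof. by move=> w0; apply: prodr_gt0 => i _; exact: w0. Qed.

Lemma measurable_cell w a : measurable (cell w a).
Proof. exact: measurable_box. Qed.

Lemma leb_cell w a : pos_width w -> leb (cell w a) = (vol w)%:E.
Proof.
move=> w0; rewrite leb_box => [|i]; last by rewrite mxE lerDl ltW.
by congr EFin; apply: eq_bigr => i _; rewrite mxE addrAC subrr add0r.
Qed.

Lemma cellL i w a x : pos_width w ->
  cell (w - half i w) a x <-> cell w a x /\ x ord0 i <= a ord0 i + w ord0 i / 2.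
Proof.
have addE (u v : E) j : (u + v) ord0 j = u ord0 j + v ord0 j by rewrite mxE.
move=> w0; split=> [h|[h xi] j].
  split=> [j|]; last by move: (h i); rewrite addE sub_half_coord eqxx => /andP[].
  move: (h j) (w0 j); rewrite !(addE a) sub_half_coord.
  by case: eqP => [->|_//]; lra.
by move: (h j); rewrite !(addE a) sub_half_coord; case: eqP => [->|_//]; lra.
Qed.

Lemma cellR i w a x : pos_width w ->
  cell (w - half i w) (a + half i w) x <->
  cell w a x /\ a ord0 i + w ord0 i / 2 < x ord0 i.
Proof.
have cE j : (a + half i w) ord0 j = a ord0 j + half i w ord0 j by rewrite mxE.
have dE j : (a + half i w + (w - half i w)) ord0 j = (a + w) ord0 j.
  by congr (fun_of_matrix _ _ _); rewrite -addrA (addrC (half i w)) subrK.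
move=> w0; split=> [h|[h xi] j].
  split=> [j|]; last by move: (h i); rewrite dE cE half_coord eqxx => /andP[].
  move: (h j) (w0 i); rewrite dE cE half_coord.
  by case: eqP => [->|_]; [lra|rewrite addr0].
by move: (h j); rewrite dE cE half_coord; case: eqP => [->|_]; [lra|rewrite addr0].
Qed.

Lemma indic_half i w a x : pos_width w ->
  \1_(cell w a) x = \1_(cell (w - half i w) a) x +
                    \1_(cell (w - half i w) (a + half i w)) x :> R.
Proof.
move=> w0; have hL := cellL i a x w0; have hR := cellR i a x w0.
rewrite !indicE; have [h|h] := pselect (cell w a x).
  rewrite mem_set//; have [xi|xi] := leP (x ord0 i) (a ord0 i + w ord0 i / 2).
    rewrite mem_set ?memNset ?addr0//; last by apply/hL.
    by move=> /hR[_]; rewrite ltNge xi.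
  rewrite memNset ?mem_set ?add0r//; first by apply/hR.
  by move=> /hL[_]; rewrite leNgt xi.
by rewrite !memNset ?addr0//; [move=> /hR[]|move=> /hL[]].
Qed.

(** One equation says both that the cells cover [U] and that they are disjoint, and integrals over
    [U] split by linearity. *)
Definition tiles w s U := forall x, \sum_(a <- s) \1_(cell w a) x = \1_U x :> R.

Lemma tiles_sub w s U a : tiles w s U -> a \in s -> cell w a `<=` U.
Proof.
move=> sU sa x ax; apply: contrapT => Ux.
have := sU x; rewrite [RHS]indicE memNset// (big_rem a)//= indicE mem_set//=.
have : 0 <= \sum_(b <- rem a s) \1_(cell w b) x :> R by apply: sumr_ge0.
by move=> h /eqP; rewrite gt_eqF//; apply: ltr_wpDr.
Qed.

Lemma tiles_ex w s U x : tiles w s U -> U x -> exists2 a, a \in s & cell w a x.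
Proof.
move=> sU Ux; apply: contrapT => h.
have := sU x; rewrite [RHS]indicE mem_set// big1_seq => [/eqP|a /andP[_ sa]].
  by rewrite eq_sym oner_eq0.
by rewrite indicE memNset// => ax; apply: h; exists a.
Qed.

(** Only one direction is halved at a time, so that one step compares the means over two adjacent
    halves, a quantity controlled by the variation in that direction. A round of [refine] then
    halves every direction once. *)
Definition split i (p : E * seq E) : E * seq E :=
  (p.1 - half i p.1, p.2 ++ [seq a + half i p.1 | a <- p.2]).

Lemma tiles_split i w s U : pos_width w -> tiles w s U ->
  tiles (split i (w, s)).1 (split i (w, s)).2 U.
Proof.
move=> w0 sU x; rewrite -sU big_cat/= big_map -big_split/=.
by apply: eq_bigr => a _; rewrite -indic_half.
Qed.

Definition refine (p : E * seq E) (k : nat) : E * seq E :=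
  iter k (fun p => foldr split p (enum 'I_n.+1)) p.

Lemma foldr_split_width (ds : seq 'I_n.+1) p j : uniq ds ->
  (foldr split p ds).1 ord0 j = if j \in ds then p.1 ord0 j / 2 else p.1 ord0 j.
Proof.
elim: ds j => [|i ds IH] j//= /andP[ids uds].
rewrite sub_half_coord !IH// (negbTE ids) in_cons.
by case: eqP => [->|_].
Qed.

Lemma refine_width p k j : (refine p k).1 ord0 j = p.1 ord0 j / 2 ^+ k.
Proof.
elim: k => [|k IH]; first by rewrite expr0 divr1.
rewrite /refine iterS -/(refine p k) foldr_split_width ?enum_uniq// mem_enum IH.
by rewrite exprSr invfM mulrA.
Qed.

Lemma refine_tiles w s U k : pos_width w -> tiles w s U ->
  pos_width (refine (w, s) k).1 /\ tiles (refine (w, s) k).1 (refine (w, s) k).2 U.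
Proof.
move=> w0 sU; elim: k => [//|k].
rewrite /refine iterS -/(refine (w, s) k); elim: (enum 'I_n.+1) => [//|i ds IH] h.
have [w1 s1] := IH h; split; first exact: pos_half.
by have := tiles_split i w1 s1; rewrite -surjective_pairing.
Qed.

(** The conditional expectation of [u] given the partition into cells. *)
Definition step_avg w s u x : R :=
  \sum_(a <- s) ((\int[leb]_(y in cell w a) u y) / vol w) * \1_(cell w a) x.

(** Open sets are the intersection-stable generator used below in a Dynkin argument. For the
    coordinates, continuity gives measurability with respect to the sigma-algebra of open sets. *)
Lemma open_generate : (@measurable _ E : set (set E)) = <<s open >>.
Proof.
apply/seteqP; split; last first.
  apply: smallest_sub; first exact: sigma_algebra_measurable.
  by move=> A; exact: open_measurable.
rewrite boxes_generate; apply: smallest_sub; first exact: smallest_sigma_algebra.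
move=> _ [a [b ->]]; pose gE := g_sigma_algebraType (@open E).
rewrite (_ : box a b = \bigcap_(i in [set: 'I_n.+1])
    ((fun v : gE => v ord0 i : measurableTypeR R) @^-1` `]a ord0 i, b ord0 i]%classic)).
  apply: (@fin_bigcap_measurable _ gE) => [|i _]; first exact: finite_finset.
  rewrite -[X in measurable X]setTI.
  suff : measurable_fun setT (fun v : gE => v ord0 i : measurableTypeR R) by apply.
  apply: (measurability _ (RGenOpens.measurableE R)) => _ [_ [x [y ->]] <-].
  rewrite setTI; apply: sub_sigma_algebra.
  have /continuousP := @coord_continuous R 1 n.+1 ord0 i; apply; exact: interval_open.
by rewrite boxE; apply/seteqP; split=> [v Av i _|v Av i]; exact: Av.
Qed.

Section on_a_tiled_set.
Variables (U : set E) (mU : measurable U).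

Lemma Rintegral_tiles w s u : tiles w s U -> itg leb U u ->
  \int[leb]_(x in U) u x = \sum_(a <- s) \int[leb]_(x in cell w a) u x.
Proof.
move=> sU iu; rewrite (@eq_Rintegral _ _ _ _ _ (fun x => \sum_(a <- s) u x * \1_(cell w a) x)).
  rewrite (Rintegral_sum mU) => [|a]; last by apply: itg_indic => //; exact: measurable_cell.
  apply: eq_big_seq => a sa; rewrite Rintegral_indic//; first exact: measurable_cell.
  exact: tiles_sub sU sa.
by move=> x; rewrite inE => Ux; rewrite -mulr_sumr sU indicE mem_set// mulr1.
Qed.

Lemma tiles_lty w s : pos_width w -> tiles w s U -> (leb U < +oo)%E.
Proof.
move=> w0 sU; have -> : U = \big[setU/set0]_(a <- s) cell w a.
  rewrite -bigcup_seq; apply/seteqP; split=> [x Ux|x [a /= sa ax]]; last exact: tiles_sub sU sa _ ax.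
  by have [a sa ax] := tiles_ex sU Ux; exists a.
suff : measurable (\big[setU/set0]_(a <- s) cell w a) /\
    (leb (\big[setU/set0]_(a <- s) cell w a) < +oo)%E by case.
elim/big_rec: _ => [|a A _ [mA Aoo]]; first by split=> //; rewrite measure0.
split; first by apply: measurableU => //; exact: measurable_cell.
apply: (le_lt_trans (measureU2 _ _ _)) => //; first exact: measurable_cell.
by rewrite lte_add_pinfty//; exact: leb_box_fin.
Qed.

Lemma itg_step_avg w s u : pos_width w -> tiles w s U -> itg leb U (step_avg w s u).
Proof.
move=> w0 sU; apply: itg_sum => // a; apply: itgZ => //.
apply: (@itg_bounded _ _ _ _ _ mU 1) => //.
- exact: tiles_lty sU.
- by apply: measurable_indic; exact: measurable_cell.
- by move=> x _; rewrite indicE; case: (_ \in _); rewrite ?normr1 ?normr0.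
Qed.

Lemma Rintegral_indic_cell w s a : pos_width w -> tiles w s U -> a \in s ->
  \int[leb]_(x in U) \1_(cell w a) x = vol w.
Proof.
move=> w0 sU sa; rewrite (@eq_Rintegral _ _ _ _ _ (fun x => 1 * \1_(cell w a) x)).
  rewrite Rintegral_indic//; [|exact: measurable_cell|exact: tiles_sub sU sa].
  rewrite Rintegral_cst; last exact: measurable_cell.
  by rewrite mul1r -[RHS]/(fine (vol w)%:E); congr fine; exact: leb_cell.
by move=> x _; rewrite mul1r.
Qed.

(** If [L] and [Rt] are the integrals over the two halves, the new mean differs from the old one by
    (L - Rt) / vol w on the lower half and by the opposite on the upper half; over the whole cell
    this integrates to |Rt - L|. *)
Lemma step_avg_split i w s u : pos_width w -> tiles w s U -> itg leb U u ->
  \int[leb]_(x in U) `|step_avg (split i (w, s)).1 (split i (w, s)).2 u x - step_avg w s u x| <=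
  \sum_(a <- s) `|\int[leb]_(x in cell (w - half i w) (a + half i w)) u x -
                  \int[leb]_(x in cell (w - half i w) a) u x|.
Proof.
move=> w0 sU iu; set w' := w - half i w.
have w'0 : pos_width w' by exact: pos_half.
pose L a := \int[leb]_(x in cell w' a) u x.
pose Rt a := \int[leb]_(x in cell w' (a + half i w)) u x.
have i1 a : itg leb U (fun x => \1_(cell w a) x : R).
  apply: (@itg_bounded _ _ _ _ _ mU 1) => //.
  - exact: tiles_lty sU.
  - by apply: measurable_indic; exact: measurable_cell.
  - by move=> x _; rewrite indicE; case: (_ \in _); rewrite ?normr1 ?normr0.
have avgE a : a \in s -> \int[leb]_(y in cell w a) u y = L a + Rt a.
  move=> sa; have aU := tiles_sub sU sa.
  have sub b : (forall x, cell w' b x -> cell w a x) -> cell w' b `<=` U.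
    by move=> h x /h; exact: aU.
  have subL : cell w' a `<=` U by apply: sub => x /(cellL i a x w0)[].
  have subR : cell w' (a + half i w) `<=` U by apply: sub => x /(cellR i a x w0)[].
  have IE A : measurable A -> A `<=` U ->
      \int[leb]_(y in A) u y = \int[leb]_(y in U) (u y * \1_A y).
    by move=> mA AU; rewrite Rintegral_indic.
  rewrite /L /Rt !IE//; [|exact: measurable_cell..].
  rewrite -RintegralD//; [|by apply: itg_indic => //; exact: measurable_cell..].
  by apply: eq_Rintegral => x _; rewrite -mulrDr -indic_half.
have v0 := vol_gt0 w0.
apply: (@le_trans _ _ (\int[leb]_(x in U) \sum_(a <- s) (`|Rt a - L a| / vol w * \1_(cell w a) x))).
  apply: le_Rintegral => //.
  - apply: itg_norm; apply: (itgB mU); last exact: itg_step_avg.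
    exact/itg_step_avg/tiles_split.
  - by apply: itg_sum => // a; apply: itgZ.
  move=> x _; rewrite /step_avg big_cat/= big_map -big_split/= -sumrB.
  rewrite big_seq [leRHS]big_seq; apply: (le_trans (ler_norm_sum _ _ _)); apply: ler_sum => a sa.
  rewrite avgE// vol_half -/w' -/(L a) -/(Rt a) (indic_half i a x w0) -/w'.
  set t := \1_(cell w' a) x; set t' := \1_(cell w' (a + half i w)) x.
  have -> : L a / (vol w / 2) * t + Rt a / (vol w / 2) * t' - (L a + Rt a) / vol w * (t + t') =
     (Rt a - L a) / vol w * (t' - t).
    by rewrite invf_div; set c := (vol w)^-1; lra.
  rewrite !normrM (gtr0_norm (_ : 0 < (vol w)^-1)) ?invr_gt0//.
  apply: ler_wpM2l; first by rewrite mulr_ge0// invr_ge0 ltW.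
  rewrite ler_norml /t /t' !indicE.
  by case: (x \in _); case: (x \in _); rewrite /=; lra.
rewrite (Rintegral_sum mU) => [|a]; last exact: itgZ.
rewrite big_seq [leRHS]big_seq; apply: ler_sum => a sa.
by rewrite (RintegralZl _ mU (i1 a)) (Rintegral_indic_cell w0 sU sa) mulfVK// gt_eqF.
Qed.

(* Every open set is exhausted, within [U], by the cells it contains. *)
Lemma Rintegral_cells_eq0_open w s u (O : set E) : pos_width w -> tiles w s U ->
  itg leb U u ->
  (forall k a, a \in (refine (w, s) k).2 ->
     \int[leb]_(x in cell (refine (w, s) k).1 a) u x = 0) ->
  open O -> \int[leb]_(x in U) (u x * \1_O x) = 0.
Proof.
move=> w0 sU iu u0 oO.
pose ww k := (refine (w, s) k).1; pose ss k := (refine (w, s) k).2.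
pose inO k a := `[< cell (ww k) a `<=` O >].
pose g k x : R := \sum_(a <- seq.filter (inO k) (ss k)) \1_(cell (ww k) a) x.
have tk k := refine_tiles k w0 sU.
have ugE k x : u x * g k x = \sum_(a <- seq.filter (inO k) (ss k)) u x * \1_(cell (ww k) a) x.
  by rewrite mulr_sumr.
have iug k : itg leb U (fun x => u x * g k x).
  apply: (eq_itg mU (fun x (_ : U x) => esym (ugE k x))); apply: itg_sum => // a.
  by apply: itg_indic => //; exact: measurable_cell.
have ug0 k : \int[leb]_(x in U) (u x * g k x) = 0.
  rewrite (eq_Rintegral _ (fun x _ => ugE k x)) (Rintegral_sum mU) => [|a]; last first.
    by apply: itg_indic => //; exact: measurable_cell.
  rewrite big1_seq// => a; rewrite mem_filter => /andP[_ /andP[_ sa]].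
  rewrite Rintegral_indic//; first exact: u0.
    exact: measurable_cell.
  exact: (tiles_sub (tk k).2).
have g01 k x : 0 <= g k x <= 1.
  rewrite sumr_ge0//=; apply: (@le_trans _ _ (\1_U x)); last by rewrite indicE; case: (_ \in _).
  rewrite -(tk k).2 /g big_filter big_mkcond; apply: ler_sum => a _.
  by case: (inO k a).
have g_cvg x : U x -> g ^~ x @ \oo --> (\1_O x : R).
  move=> Ux; have [Ox|Ox] := pselect (O x); last first.
    rewrite indicE memNset//= (_ : g ^~ x = fun=> 0); first exact: cvg_cst.
    apply/funext => k; apply: big1_seq => a; rewrite mem_filter => /andP[_ /andP[/asboolP aO _]].
    by rewrite indicE memNset// => /aO.
  have [e e0 eO] := open_rVP oO Ox.
  (* The sum over all directions bounds each width, so one [K] serves them all; beyond it a cell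
     containing [x] is narrower than [e] and hence lies in [O]. *)
  have [K KP] : exists K : nat, \sum_i w ord0 i / e < K%:R.
    exists (Num.Def.archi_bound (\sum_i w ord0 i / e)); apply: archi_boundP.
    by apply: sumr_ge0 => i _; rewrite divr_ge0// ltW.
  apply: cvg_near_cst; exists K => // k /= Kk.
  have wk i : ww k ord0 i < e.
    rewrite /ww refine_width /= ltr_pdivrMr ?exprn_gt0// -ltr_pdivrMl// mulrC.
    apply: (@lt_le_trans _ _ K%:R).
      apply: le_lt_trans KP; rewrite (bigD1 i)//= lerDl.
      by apply: sumr_ge0 => j _; rewrite divr_ge0// ltW.
    rewrite -natrX ler_nat (leq_trans Kk)// ltnW// ltn_expl//.
  rewrite /g big_filter indicE mem_set//=.
  have := (tk k).2 x; rewrite [RHS]indicE mem_set// => <-.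
  rewrite big_mkcond /=; apply: eq_big_seq => a sa; case: ifPn => // /asboolP naO.
  rewrite indicE memNset// => ax; apply: naO => y ay; apply: eO => i.
  by move: (ax i) (ay i) (wk i); rewrite !mxE ltr_norml; lra.
have [] := @Rintegral_dominated _ _ _ leb U mU (fun k x => u x * g k x)
  (fun x => u x * \1_O x) (fun x => `|u x|).
- by move=> k; exact: itg_meas (iug k).
- by move=> x Ux; apply: cvgM; [exact: cvg_cst|exact: g_cvg].
- exact: itg_norm.
- move=> k x _; rewrite normrM (@ger0_norm _ (g k x)); last by case/andP: (g01 k x).
  by rewrite ler_piMr//; case/andP: (g01 k x).
move=> _ + _; under eq_fun do rewrite ug0.
by move=> h; apply/esym; exact: (cvg_unique _ (cvg_cst _) h).
Qed.

(** The sets over which [u] integrates to zero form a lambda-system containing the open sets, hence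
    all measurable sets, in particular the set where [u] is positive. *)
Lemma Rintegral_cells_eq0 w s u : pos_width w -> tiles w s U -> itg leb U u ->
  (forall k a, a \in (refine (w, s) k).2 ->
     \int[leb]_(x in cell (refine (w, s) k).1 a) u x = 0) ->
  {ae leb, forall x, U x -> u x = 0}.
Proof.
move=> w0 sU iu u0.
pose H := [set A : set E | measurable A /\ \int[leb]_(x in U) (u x * \1_A x) = 0].
have iuA A : measurable A -> itg leb U (fun x => u x * \1_A x) by move=> mA; exact: itg_indic.
have openT' : open [set: E] by exact: openT.
have HT : H setT by split=> //; apply: Rintegral_cells_eq0_open openT'.
have measH A : measurable A -> H A.
  move=> mA; have := @lambda_system_subset E open (fun A B => @openI _ A B) setT H.
  rewrite -open_generate; apply => //.
  split=> //.
  - move=> B C CB [mB B0] [mC C0]; split; first exact: measurableD.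
    rewrite (@eq_Rintegral _ _ _ _ _ (fun x => u x * \1_B x - u x * \1_C x)).
      by rewrite RintegralB ?B0 ?C0 ?subr0//; exact: iuA.
    move=> x _; rewrite -mulrBr; congr (_ * _); rewrite !indicE.
    have [Bx|Bx] := pselect (B x); last first.
      by rewrite !(memNset (A := _)) ?subr0 ?[in RHS]memNset// => [/CB|[]].
    have [Cx|Cx] := pselect (C x).
      by rewrite memNset ?(mem_set Bx) ?(mem_set Cx) ?subrr// => -[].
    by rewrite mem_set ?(mem_set Bx) ?(memNset Cx) ?subr0.
  - move=> F ndF HF; have mU' : measurable (\bigcup_i F i).
      by apply: bigcupT_measurable => i; exact: (HF i).1.
    split=> //.
    have [] := @Rintegral_dominated _ _ _ leb U mU (fun k x => u x * \1_(F k) x)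
      (fun x => u x * \1_(\bigcup_i F i) x) (fun x => `|u x|).
    + by move=> k; apply/itg_meas/iuA; exact: (HF k).1.
    + move=> x Ux; apply: cvgM; first exact: cvg_cst.
      have [[i _ Fx]|Fx] := pselect ((\bigcup_i F i) x).
        apply: cvg_near_cst; exists i => // j /= ij.
        rewrite !indicE !mem_set//; first by exists i.
        by move/subsetPset: (ndF _ _ ij); exact.
      apply: cvg_near_cst; apply: nearW => j.
      by rewrite !indicE !memNset// => Fj; apply: Fx; exists j.
    + exact: itg_norm.
    + move=> k x _; rewrite normrM indicE; case: (_ \in _); first by rewrite normr1 mulr1.
      by rewrite normr0 mulr0.
    move=> _ + _; under eq_fun do rewrite (HF _).2.
    by move=> h; apply/esym; exact: (cvg_unique _ (cvg_cst _) h).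
  - by move=> B oB; split; [exact: open_measurable|exact: Rintegral_cells_eq0_open].
have mu_ : measurable_fun U u by exact: itg_meas iu.
pose P := U `&` u @^-1` `]0, +oo[.
have mP : measurable P by apply: mu_ => //; exact: measurable_itv.
have abs0 : \int[leb]_(x in U) `|u x| = 0.
  (* The absolute value is twice the positive part minus the function, and both have integral
     zero. *)
  rewrite (@eq_Rintegral _ _ _ _ _ (fun x => 2 * (u x * \1_P x) - u x * \1_setT x)).
    rewrite RintegralB//; [|by apply: (itgZ mU); exact: iuA|exact: iuA].
    by rewrite RintegralZl ?HT.2 ?(measH _ mP).2 ?mulr0 ?subrr//; exact: iuA.
  move=> x; rewrite inE => Ux; rewrite !indicE (mem_set (I : setT x)) mulr1.
  have [u_gt0|u_le0] := ltP 0 (u x).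
    rewrite mem_set ?gtr0_norm//; first by rewrite mulr1; lra.
    by split=> //=; rewrite in_itv/= u_gt0.
  rewrite memNset ?ler0_norm//; first by rewrite mulr0 mulr0 sub0r.
  by move=> [_ /=]; rewrite in_itv/= ltNge u_le0.
have /(ae_eq_integral_abs leb mU) : measurable_fun U (EFin \o u) by exact: measurable_int iu.
case=> + _ => h; have : (\int[leb]_(x in U) `|(EFin \o u) x| = 0)%E.
  by rewrite /= -EFin_Rintegral ?abs0//; exact: itg_norm.
move=> /h; apply: filterS => x hx Ux.
by have /= := hx Ux => -[].
Qed.

(** The partition resolves [C]; this persists under refinement and is what lets averaging preserve
    the integral over [C]. *)
Definition compatible (C : set E) (p : E * seq E) :=
  forall b, b \in p.2 -> cell p.1 b `<=` C \/ cell p.1 b `&` C = set0.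

Lemma compatible_split C i p : pos_width p.1 -> compatible C p ->
  compatible C (split i p).
Proof.
move=> p0 Cp b; rewrite mem_cat => /orP[bp|/mapP[c cp ->]]; rewrite /=.
  have sub : cell (p.1 - half i p.1) b `<=` cell p.1 b by move=> x /(cellL i b x p0)[].
  have [h|h] := Cp b bp; [left; exact: subset_trans sub h|right].
  by rewrite -subset0 -h; exact: setSI.
have sub : cell (p.1 - half i p.1) (c + half i p.1) `<=` cell p.1 c.
  by move=> x /(cellR i c x p0)[].
have [h|h] := Cp c cp; [left; exact: subset_trans sub h|right].
by rewrite -subset0 -h; exact: setSI.
Qed.

Lemma compatible_cell w s a : tiles w s U -> a \in s -> compatible (cell w a) (w, s).
Proof.
move=> sU sa b /= sb; have [->|ba] := eqVneq b a; [by left|right].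
rewrite -subset0 => x [bx ax].
have := sU x; rewrite (big_rem a)//= (big_rem b)/=; last first.
  exact: rem_mem.
rewrite !indicE (mem_set ax) (mem_set bx).
have : 0 <= \sum_(c <- rem b (rem a s)) \1_(cell w c) x :> R by apply: sumr_ge0.
by case: (x \in U) => /= h /eqP; lra.
Qed.

Lemma compatible_refine C w s k : pos_width w -> tiles w s U ->
  compatible C (w, s) -> compatible C (refine (w, s) k).
Proof.
move=> w0 sU Cp; elim: k => [//|k IH].
have := refine_tiles k w0 sU; rewrite /refine iterS -/(refine (w, s) k).
elim: (enum 'I_n.+1) => [//|i ds IHd] [pw pt] /=.
suff [] : [/\ pos_width (foldr split (refine (w, s) k) ds).1,
   tiles (foldr split (refine (w, s) k) ds).1 (foldr split (refine (w, s) k) ds).2 U &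
   compatible C (foldr split (refine (w, s) k) ds)].
  by move=> q0 _ q1; exact: compatible_split.
elim: ds {IHd} => [|j ds [q0 q1 q2]] //=; split; first exact: pos_half.
  by have := tiles_split j q0 q1; rewrite -surjective_pairing.
exact: compatible_split.
Qed.

Lemma Rintegral_step_avg C w s u : measurable C -> C `<=` U ->
  pos_width w -> tiles w s U ->
  compatible C (w, s) -> itg leb U u ->
  \int[leb]_(x in C) step_avg w s u x = \int[leb]_(x in C) u x.
Proof.
move=> mC CU w0 sU Cs iu; rewrite -!(Rintegral_indic leb _ mC CU).
have i1 a : itg leb U (fun x => \1_(cell w a) x : R).
  apply: (@itg_bounded _ _ _ _ _ mU 1) => //.
  - exact: tiles_lty sU.
  - by apply: measurable_indic; exact: measurable_cell.
  - by move=> x _; rewrite indicE; case: (_ \in _); rewrite ?normr1 ?normr0.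
rewrite !(Rintegral_tiles sU); [|exact: itg_indic|by apply: itg_indic => //; exact: itg_step_avg].
apply: eq_big_seq => a sa; have aU := tiles_sub sU sa.
have [aC|aC] := Cs a sa; last first.
  rewrite (@eq_Rintegral _ _ _ _ _ (fun=> 0)); last first.
    move=> x; rewrite inE => ax; rewrite indicE memNset ?mulr0// => Cx.
    by have : (cell w a `&` C) x by []; rewrite aC.
  apply: eq_Rintegral => x; rewrite inE => ax; rewrite indicE memNset ?mulr0// => Cx.
  by have : (cell w a `&` C) x by []; rewrite aC.
rewrite (@eq_Rintegral _ _ _ _ _ (fun=> (\int[leb]_(y in cell w a) u y) / vol w)).
  rewrite Rintegral_cst; last exact: measurable_cell.
  rewrite (_ : fine _ = vol w) ?mulfVK ?gt_eqF ?vol_gt0//; last first.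
    by rewrite -[RHS]/(fine (vol w)%:E); congr fine; exact: leb_cell.
  by apply: eq_Rintegral => x; rewrite inE => ax; rewrite indicE mem_set ?mulr1//; exact: aC.
move=> x; rewrite inE => ax; rewrite indicE mem_set; last exact: aC.
rewrite mulr1 /step_avg (big_rem a)//= indicE mem_set// mulr1 big1_seq ?addr0// => b /andP[_ sb].
have : \sum_(c <- rem a s) \1_(cell w c) x <= 0 :> R.
  have := sU x; rewrite (big_rem a)//= indicE mem_set//= indicE mem_set//=; last exact: aU.
  by lra.
move=> h; have : \1_(cell w b) x <= 0 :> R.
  by apply: le_trans h; rewrite (big_rem b)//= lerDl; apply: sumr_ge0.
by rewrite indicE; case: (_ \in _) => /=; rewrite ?mulr0// => /le_gtF; rewrite ltr01.
Qed.

(** A martingale argument. Round [k] of the refinement moves the averages by at most (n+1) l V / 2^k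
    in L^1, so they converge at a geometric rate, which gives the factor 2. The limit is [u] because
    both have the same integral over every cell of every level. *)
Lemma step_avg_dist w s u (V l : R) : pos_width w -> tiles w s U -> itg leb U u ->
  (forall i, w ord0 i <= l) -> 0 <= V ->
  (forall i w' s', pos_width w' -> tiles w' s' U ->
    \sum_(a <- s') `|\int[leb]_(x in cell (w' - half i w') (a + half i w')) u x -
                  \int[leb]_(x in cell (w' - half i w') a) u x| <= w' ord0 i * V) ->
  \int[leb]_(x in U) `|u x - step_avg w s u x| <= 2 * (n.+1%:R * l * V).
Proof.
move=> w0 sU iu wl V0 HV; pose p k := refine (w, s) k.
have pk k : pos_width (p k).1 /\ tiles (p k).1 (p k).2 U by exact: refine_tiles.
pose F k := step_avg (p k).1 (p k).2 u.
have iF k : itg leb U (F k) by have [? ?] := pk k; exact: itg_step_avg.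
have FF k : \int[leb]_(x in U) `|F k.+1 x - F k x| <= n.+1%:R * l * V / 2 ^+ k.
  have [q0 qU] := pk k.
  have wk i : (p k).1 ord0 i <= l / 2 ^+ k.
    by rewrite /p refine_width ler_pM2r ?invr_gt0 ?exprn_gt0//; exact: wl.
  rewrite /F /p /refine iterS -/(refine (w, s) k) -/(p k).
  (* The bound is rewritten as one equal share per direction, in the form needed for an induction on
     the list of directions. *)
  have -> : n.+1%:R * l * V / 2 ^+ k = (size (enum 'I_n.+1))%:R * (l / 2 ^+ k * V).
    by rewrite size_enum_ord; set t := (2 ^+ k)^-1; lra.
  suff : let q := foldr split (p k) (enum 'I_n.+1) in
    [/\ pos_width q.1, tiles q.1 q.2 U, forall i, q.1 ord0 i <= l / 2 ^+ k &
     \int[leb]_(x in U) `|step_avg q.1 q.2 u x - step_avg (p k).1 (p k).2 u x| <=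
     (size (enum 'I_n.+1))%:R * (l / 2 ^+ k * V)] by move=> /= [].
  elim: (enum 'I_n.+1) => [|i ds] /=.
    split=> //; rewrite mul0r (@eq_Rintegral _ _ _ _ _ (fun=> 0)) ?Rintegral_cst ?mul0r// => x _.
    by rewrite subrr normr0.
  move: (foldr split (p k) ds) => -[w' s'] /= [w'0 s'U w'l IH]; split.
  - exact: pos_half.
  - exact: (tiles_split i w'0 s'U).
  - by move=> j; rewrite sub_half_coord; case: eqP => // _;
      have := w'0 i; have := w'l i; lra.
  have i1 : itg leb U (step_avg (split i (w', s')).1 (split i (w', s')).2 u).
    by apply: itg_step_avg; [exact: pos_half|exact: (tiles_split i w'0 s'U)].
  have i2 : itg leb U (step_avg w' s' u) by exact: itg_step_avg.
  apply: (@le_trans _ _ (\int[leb]_(x in U)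
     (`|step_avg (split i (w', s')).1 (split i (w', s')).2 u x - step_avg w' s' u x| +
      `|step_avg w' s' u x - step_avg (p k).1 (p k).2 u x|))).
    apply: le_Rintegral => //.
    - by apply: itg_norm; apply: itgB => //; exact: (iF k).
    - by apply: (itgD mU); apply: itg_norm; apply: itgB => //; exact: iF.
    - by move=> x _; exact: ler_distD.
  rewrite RintegralD//; [|by apply: itg_norm; apply: itgB => //; exact: iF..].
  rewrite -natr1 mulrDl mul1r addrC; apply: lerD => //.
  apply: (le_trans (step_avg_split i w'0 s'U iu)); apply: (le_trans (HV i w' s' w'0 s'U)).
  by apply: ler_wpM2r.
have [f [fi fcv fF]] := fast_cauchy_lim mU iF FF.
suff uf : {ae leb, forall x, U x -> u x - f x = 0}.
  apply: (@le_trans _ _ (\int[leb]_(x in U) `|f x - F 0%N x|)); last first.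
    by have := fF 0%N; rewrite expr0 divr1 mulrA.
  rewrite le_eqVlt; apply/orP; left; apply/eqP; apply: Rintegral_ae_eq => //.
  - by apply: itg_norm; apply: itgB => //; exact: (iF 0%N).
  - by apply: itg_norm; apply: itgB.
  by apply: filterS uf => x h Ux; have /eqP := h Ux; rewrite subr_eq0 => /eqP ->.
apply: (@Rintegral_cells_eq0 w s) => //; first exact: itgB.
move=> k a ka; have [q0 qU] := pk k; have aU := tiles_sub qU ka.
have mC : measurable (cell (p k).1 a) by exact: measurable_cell.
have iC g : itg leb U g -> itg leb (cell (p k).1 a) g by exact: itgS.
have FC (j : nat) : (k <= j)%N ->
    \int[leb]_(x in cell (p k).1 a) F j x = \int[leb]_(x in cell (p k).1 a) u x.
  move=> kj; have [r0 rU] := pk j; apply: Rintegral_step_avg => //.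
  have := compatible_cell qU ka; rewrite -surjective_pairing /p -(subnK kj).
  rewrite (_ : refine _ (j - k + k) = refine (refine (w, s) k) (j - k)); last first.
    by rewrite /refine iterD.
  rewrite -surjective_pairing; have := qU; have := q0; rewrite /p.
  by case: (refine (w, s) k) => w' s' /= *; apply: (@compatible_refine _ _ _ (j - k)).
(* From level [k] on, [u] may be replaced over this cell by the average at level [j], which is
   geometrically close to [f] in L^1. *)
apply/eqP; rewrite -normr_le0; apply: (@geometric_bound_le0 _ _ (2 * (n.+1%:R * l * V)) k).
move=> j kj; rewrite RintegralB//; [|exact: iC..].
rewrite -(FC j kj) -RintegralB//; [|by apply: iC; exact: (iF j)|exact: iC].
apply: le_trans (fF j); apply: (le_trans (le_normr_Rintegral mC _)).
  by apply: (itgB mC); apply: iC => //; exact: (iF j).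
rewrite -(Rintegral_indic leb _ mC aU); apply: le_Rintegral => //.
- by apply: itg_indic => //; apply: itg_norm; apply: (itgB mU) => //; exact: (iF j).
- by apply: itg_norm; apply: (itgB mU) => //; exact: (iF j).
move=> x _; rewrite distrC indicE; case: (_ \in _); rewrite ?mulr1// mulr0.
exact: normr_ge0.
Qed.
End on_a_tiled_set.

End tilings.

(** * Smooth bump functions *)

Section flat_functions.
Context {R : realType}.
Implicit Types (P : {poly R}) (x t : R).

(** Raise t/(k+1) <= exp(t/(k+1)) to the power k+1. *)
Lemma exprn_mul_expRN k t : 0 < t -> t ^+ k.+1 * expR (- t) <= k.+1%:R ^+ k.+1.
Proof.
move=> t0; rewrite expRN ler_pdivrMr ?expR_gt0//.
have -> : expR t = expR (t / k.+1%:R) ^+ k.+1 by rewrite -expRM_natl mulrC divfK.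
have h : t <= k.+1%:R * expR (t / k.+1%:R).
  rewrite mulrC -ler_pdivrMr//.
  by apply: le_trans (expR_ge1Dx _); rewrite lerDr.
rewrite -exprMn lerXn2r// nnegrE; first exact: ltW.
by rewrite mulr_ge0// expR_ge0.
Qed.

Lemma poly_mul_expRN P : exists C, forall t, 0 < t -> `|P.[t]| * t * expR (- t) <= C.
Proof.
exists (\sum_(i < size P) `|P`_i| * i.+1%:R ^+ i.+1) => t t0.
apply: (@le_trans _ _ (\sum_(i < size P) `|P`_i| * (t ^+ i.+1 * expR (- t)))); last first.
  by apply: ler_sum => i _; apply: ler_wpM2l => //; exact: exprn_mul_expRN.
rewrite (eq_bigr (fun i : 'I_(size P) => (`|P`_i| * t ^+ i) * (t * expR (- t)))); last first.
  by move=> i _; rewrite exprSr !mulrA.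
have te0 : 0 <= t * expR (- t) by rewrite mulr_ge0 ?expR_ge0// ltW.
rewrite -mulr_suml -mulrA ler_wpM2r//.
rewrite horner_coef; apply: (le_trans (ler_norm_sum _ _ _)); apply: ler_sum => i _.
by rewrite normrM normrX (gtr0_norm t0).
Qed.

(** The polynomial factor makes the family closed under differentiation, with P replaced by X^2 (P -
    P'); smoothness of all members then follows by one induction on the order, for all [P] at
    once. *)
Definition flat P x : R := if 0 < x then P.[x^-1] * expR (- x^-1) else 0.

Lemma is_derive_flat P x :
  is_derive x 1 (flat P) (flat ('X^2 * (P - P^`())) x).
Proof.
have [x0|x0|x0] := ltgtP 0 x; last rewrite -x0.
- rewrite /flat x0.
  apply: (@near_eq_is_derive _ _ _ (fun y : R => P.[y^-1] * expR (- y^-1))).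
    by near=> y; rewrite ifT//; near: y; exact: lt_nbhsr.
  have dV : is_derive x 1 (fun y : R => y^-1) (- x ^- 2).
    have := @is_deriveV _ id x 1 1; rewrite gt_eqF// => /(_ isT).
    by rewrite /GRing.scale/= mulr1; apply; exact: is_derive_id.
  have dP : is_derive x 1 (fun y : R => P.[y^-1]) (P^`().[x^-1] * - x ^- 2).
    exact: (@is_derive1_comp _ (horner P) (fun y : R => y^-1)).
  have dE : is_derive x 1 (fun y : R => expR (- y^-1)) (expR (- x^-1) * x ^- 2).
    apply: (@is_derive1_comp _ expR (fun y : R => - y^-1)).
    by rewrite -[x ^- 2]opprK; exact: is_deriveN.
  apply: (is_derive_eq (is_deriveM dP dE)).
  rewrite !hornerE -exprVn /GRing.scale/=; set t := x^-1; set e := expR _.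
  lra.
- rewrite /flat (le_gtF (ltW x0)).
  apply: (near_eq_is_derive _ (is_derive_cst (0 : R) x 1)).
  near=> y; rewrite ifF//; apply: le_gtF; apply: ltW; near: y; exact: lt_nbhsl.
rewrite /flat ltxx.
(* The additional factor X yields |flat P h| <= C h^2, so that the difference quotient at 0 tends to
   0. *)
have [C hC] := poly_mul_expRN ('X * P).
have h0 : h^-1 *: ((flat P \o shift 0) (h *: 1) - flat P 0) @[h --> (0:R)^'] --> (0 : R).
  have flat_le h : `|flat P h| <= `|C| * h ^+ 2.
    rewrite /flat; case: ifPn => h_gt0; last by rewrite normr0 mulr_ge0// sqr_ge0.
    have := hC h^-1; rewrite invr_gt0 => /(_ h_gt0).
    rewrite hornerM hornerX !normrM (gtr0_norm (_ : 0 < h^-1)) ?invr_gt0//.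
    rewrite (gtr0_norm (expR_gt0 _)) => hh.
    have -> : `|P.[h^-1]| * expR (- h^-1) =
        h^-1 * `|P.[h^-1]| * h^-1 * expR (- h^-1) * h ^+ 2.
      rewrite expr2 mulrACA -[LHS]mulr1; set p := `|_|; set e := expR _.
      have hh1 : h^-1 * h = 1 by rewrite mulVf// gt_eqF.
      transitivity ((h^-1 * h) * (h^-1 * h) * (p * e)); first by rewrite hh1 !mul1r mulr1.
      lra.
    by rewrite ler_wpM2r ?sqr_ge0// (le_trans hh)// ler_norm.
  apply/cvgr0Pnorm_le => e e0; near=> h.
  have hn0 : h != 0 by near: h; exact: nbhs_dnbhs_neq.
  rewrite /= /GRing.scale/= addr0 mulr1 [X in _ - X](_ : _ = 0) ?subr0; last by rewrite /flat ltxx.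
  rewrite normrM normfV ler_pdivrMl ?normr_gt0//; apply: (le_trans (flat_le h)).
  rewrite -real_normK ?num_real// expr2 mulrCA ler_pM2l ?normr_gt0//.
  have : `|h| <= e / (`|C| + 1).
    near: h; apply: dnbhs0_le; rewrite divr_gt0// ltr_wpDl//.
  rewrite ler_pdivlMr ?ltr_wpDl//; apply: le_trans.
  by rewrite mulrC ler_wpM2l// lerDl.
by apply: DeriveDef; [apply/cvg_ex; exists 0|apply: cvg_lim].
Unshelve. all: by end_near. Qed.

Lemma flat1_bounds x : 0 <= flat 1 x <= 1.
Proof.
rewrite /flat; case: ifPn => x0; last by rewrite lexx ler01.
by rewrite hornerC mul1r expR_ge0 expR_le1 oppr_le0 invr_ge0 ltW.
Qed.

Lemma flat1_ge x t : 0 < t -> t <= x -> 1 - t^-1 <= flat 1 x.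
Proof.
move=> t0 tx; have x0 := lt_le_trans t0 tx.
rewrite /flat x0 hornerC mul1r; apply: le_trans (expR_ge1Dx _).
by rewrite lerD2l lerN2 lef_pV2.
Qed.

(* A bump with support [a + 1/j, b + 1/j]: the shift by 1/j makes the pointwise
   limit the indicator function of the half-open interval, so that bumps on
   adjacent cells have disjoint supports. *)
Definition bump (a b : R) (j : nat) (t : R) : R :=
  flat 1 (j.+1%:R ^+ 2 * (t - a - j.+1%:R^-1)) *
  flat 1 (j.+1%:R ^+ 2 * (b + j.+1%:R^-1 - t)).

Lemma bump_bounds a b j t : 0 <= bump a b j t <= 1.
Proof.
rewrite /bump; have /andP[h1 h2] := flat1_bounds (j.+1%:R ^+ 2 * (t - a - j.+1%:R^-1)).
have /andP[h3 h4] := flat1_bounds (j.+1%:R ^+ 2 * (b + j.+1%:R^-1 - t)).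
by rewrite mulr_ge0//= mulr_ile1.
Qed.

Lemma bump_neq0 a b j t : bump a b j t != 0 ->
  a + j.+1%:R^-1 < t < b + j.+1%:R^-1.
Proof.
rewrite /bump mulf_eq0 negb_or /flat => /andP[].
have j0 : (0 : R) < j.+1%:R ^+ 2 by rewrite exprn_gt0.
case: ifPn; last by rewrite eqxx.
rewrite pmulr_rgt0// => h1 _; case: ifPn; last by rewrite eqxx.
by rewrite pmulr_rgt0// => h2 _; move: h1 h2; set d := j.+1%:R^-1; lra.
Qed.

Lemma bump_cvg a b t : bump a b ^~ t @ \oo --> ((a < t <= b)%R%:R : R).
Proof.
have [tab|tab] := boolP (a < t <= b)%R; last first.
  have : \forall j \near \oo, bump a b j t = 0.
    move: tab; rewrite negb_and -!real_ltNge ?num_real// -real_leNgt ?num_real//.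
    move=> /orP[ta|bt].
      near=> j; apply: contrapT => /eqP /bump_neq0 /andP[+ _]; apply/negP.
      by rewrite -leNgt (le_trans ta)// lerDl invr_ge0.
    have tb0 : 0 < t - b by rewrite subr_gt0.
    near=> j; apply: contrapT => /eqP /bump_neq0 /andP[_]; apply/negP.
    rewrite -leNgt -lerBrDl; apply: ltW; near: j; exact: near_infty_natSinv_lt (PosNum tb0).
  by move=> h; apply: cvg_near_cst.
move: tab => /andP[ta tb].
have ta0 : 0 < (t - a) / 2 by rewrite divr_gt0// subr_gt0.
have lim1 : (fun j : nat => (1 - j.+1%:R^-1) ^+ 2 : R) @ \oo --> (1 : R).
  have l1 : (fun j : nat => 1 - j.+1%:R^-1 : R) @ \oo --> (1 : R).
    by rewrite -[X in _ --> X]subr0; apply: cvgB; [exact: cvg_cst|exact: cvg_harmonic].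
  by rewrite -[X in _ --> X]mulr1; under eq_fun do rewrite expr2; exact: cvgM.
rewrite [X in _ --> X](_ : _ = 1)//;  apply: (@squeeze_cvgr _ _ _ _ _ (fun=> 1) _ _ _ lim1); last exact: cvg_cst.
near=> j; have /andP[_ ->] := bump_bounds a b j t; rewrite andbT /bump.
have j0 : (0 : R) < j.+1%:R by [].
have jv : j.+1%:R * j.+1%:R^-1 = 1 :> R by rewrite divff.
have jv0 : 0 <= (1 - j.+1%:R^-1 : R) by rewrite subr_ge0 invf_le1// ler1n.
(* For large [j] the point is at distance at least 1/(j+1) from both ends of the support. The scale
   (j+1)^2 turns this into an argument of at least j+1, where [flat 1] is at least 1 - 1/(j+1). *)
rewrite expr2; apply: ler_pM => //; apply: flat1_ge => //.
  have : j.+1%:R^-1 < (t - a) / 2 by near: j; exact: near_infty_natSinv_lt (PosNum ta0).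
  rewrite expr2 -mulrA -[leLHS]mulr1 ler_pM2l// => h.
  apply: (@le_trans _ _ (j.+1%:R * j.+1%:R^-1)); first by rewrite jv.
  rewrite ler_pM2l//; move: h; set d := _^-1; lra.
rewrite expr2 -mulrA -[leLHS]mulr1 ler_pM2l//.
apply: (@le_trans _ _ (j.+1%:R * j.+1%:R^-1)); first by rewrite jv.
rewrite ler_pM2l//.
by move: tb; set d := _^-1; lra.
Unshelve. all: by end_near. Qed.

End flat_functions.

(** * Differentiable functions of several variables and the fundamental lemma of the calculus of
    variations *)

Section Ck_calculus.
Context {R : realType} {n : nat}.
Local Notation E := 'rV[R]_n.+1.
Implicit Types (f g : E -> R) (x v : E).
Local Notation dir i := (delta_mx ord0 i : E).
Local Notation leb := (@leb_rV R n.+1).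

(** Brings the one-variable rules, above all the chain rule, to directional derivatives. *)
Lemma is_derive_lineP f x v (df : R) :
  is_derive x v f df <-> is_derive (0 : R) 1 (fun h : R => f (h *: v + x)) df.
Proof.
have E12 : (fun h : R => h^-1 *: ((f \o shift x) (h *: v) - f x)) =
    (fun h : R => h^-1 *: (((fun h => f (h *: v + x)) \o shift 0) (h *: 1) - f (0 *: v + x))).
  by apply/funext => h /=; rewrite addr0 scale0r add0r [_%:A]mulr1.
split=> -[h1 h2]; split.
- by rewrite /derivable -E12.
- by rewrite /derive -E12.
- by move: h1; rewrite /derivable -E12.
- by move: h2; rewrite /derive -E12.
Qed.

Lemma is_derive_affine (c d t : R) : is_derive t 1 (fun t => c * t + d) c.
Proof.
apply: (is_derive_eq (is_deriveD (is_deriveM (is_derive_cst c t 1) (is_derive_id t 1)) (is_derive_cst d t 1))).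
by rewrite /GRing.scale/= mulr0 !addr0 mulr1.
Qed.

Lemma is_derive_coord (psi : R -> R) (d : R) j x i :
  is_derive (x ord0 j) 1 psi d ->
  is_derive x (dir i) (fun v => psi (v ord0 j)) ((j == i)%:R * d).
Proof.
move=> dpsi; apply/is_derive_lineP.
rewrite (_ : (fun h : R => _) = psi \o (fun h : R => (j == i)%:R * h + x ord0 j)); last first.
  by apply/funext => h /=; rewrite !mxE eqxx /= eq_sym mulrC.
rewrite mulrC; apply: is_derive1_comp; first by rewrite mulr0 add0r.
exact: is_derive_affine.
Qed.

Lemma derive_partial f x i (d : R) : is_derive x (dir i) f d ->
  derivable f x (dir i) /\ partial i f x = d.
Proof. by case. Qed.

Lemma Ck_continuous k f : Ck k f -> continuous f.
Proof. by case: k => [//|k] []. Qed.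

Lemma CkW k f : Ck k.+1 f -> Ck k f.
Proof.
elim: k f => [|k IH] f [cf df]; first exact: cf.
by split=> // i; have [h1 h2] := df i; split=> //; exact: IH.
Qed.

Lemma Ck_cst k (c : R) : Ck k (fun _ : E => c).
Proof.
elim: k c => [|k IH] c; first exact: cst_continuous.
split; first exact: cst_continuous.
move=> i; split=> [x|]; first exact: (derivable_cst c x).
rewrite (_ : partial i _ = fun=> 0); first exact: IH.
by apply/funext => x; rewrite /partial; exact: (derive_cst c x).
Qed.

Lemma CkD k f g : Ck k f -> Ck k g -> Ck k (fun x => f x + g x).
Proof.
elim: k f g => [|k IH] f g.
  by move=> /= cf cg x; apply: continuousD; [exact: cf|exact: cg].
move=> [cf df] [cg dg]; split.
  by move=> x; apply: continuousD; [exact: cf|exact: cg].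
move=> i; have [f1 f2] := df i; have [g1 g2] := dg i; split=> [x|].
  exact: derivableD.
rewrite (_ : partial i _ = fun x => partial i f x + partial i g x); first exact: IH.
by apply/funext => x; rewrite /partial; exact: deriveD.
Qed.

Lemma partialM f g i x : derivable f x (dir i) -> derivable g x (dir i) ->
  partial i (fun x => f x * g x) x = f x * partial i g x + g x * partial i f x.
Proof. by move=> df dg; rewrite /partial; exact: deriveM. Qed.

Lemma CkM k f g : Ck k f -> Ck k g -> Ck k (fun x => f x * g x).
Proof.
elim: k f g => [|k IH] f g.
  by move=> /= cf cg x; apply: continuousM; [exact: cf|exact: cg].
move=> hf hg; have := hf; have := hg; move=> [cg dg] [cf df]; split.
  by move=> x; apply: continuousM; [exact: cf|exact: cg].
move=> i; have [f1 f2] := df i; have [g1 g2] := dg i; split=> [x|].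
  exact: derivableM.
rewrite (_ : partial i _ = fun x => f x * partial i g x + g x * partial i f x).
  by apply: CkD; apply: IH => //; exact: CkW.
by apply/funext => x; exact: partialM.
Qed.

Lemma CkZ k (c : R) f : Ck k f -> Ck k (fun x => c * f x).
Proof. by apply: CkM; exact: Ck_cst. Qed.

Lemma Ck_prod k (I : Type) (s : seq I) (F : I -> E -> R) :
  (forall i, Ck k (F i)) -> Ck k (fun x => \prod_(i <- s) F i x).
Proof.
move=> hF; elim: s => [|i s IH].
  rewrite (_ : (fun x => _) = fun=> 1); first exact: Ck_cst.
  by apply/funext => x; rewrite big_nil.
rewrite (_ : (fun x => _) = fun x => F i x * \prod_(j <- s) F j x); first exact: CkM.
by apply/funext => x; rewrite big_cons.
Qed.

Lemma is_derive_affine_flat P (c d : R) j x i :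
  is_derive x (dir i) (fun v => flat P (c * v ord0 j + d))
    ((j == i)%:R * (c * flat ('X^2 * (P - P^`())) (c * x ord0 j + d))).
Proof.
apply: (@is_derive_coord (fun t => flat P (c * t + d))).
rewrite mulrC; apply: (@is_derive1_comp _ (flat P) (fun t : R => c * t + d)).
  exact: is_derive_flat.
exact: is_derive_affine.
Qed.

Lemma continuous_flat_coord P (c d : R) j :
  continuous (fun v : E => flat P (c * v ord0 j + d)).
Proof.
move=> v; apply: (continuous_comp (f := fun v : E => c * v ord0 j + d) (g := flat P)).
  apply: continuousD; last exact: cst_continuous.
  by apply: continuousM; [exact: cst_continuous|exact: coord_continuous].
by apply/differentiable_continuous/derivable1_diffP; have [] := is_derive_flat P (c * v ord0 j + d).
Qed.

Lemma Ck_flat k P (c d : R) j : Ck k (fun v => flat P (c * v ord0 j + d)).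
Proof.
elim: k P => [|k IH] P; first exact: continuous_flat_coord.
split; first exact: continuous_flat_coord.
move=> i; split=> [x|].
  by have [] := derive_partial (is_derive_affine_flat P c d j x i).
rewrite (_ : partial i _ = fun x => ((j == i)%:R * c) * flat ('X^2 * (P - P^`())) (c * x ord0 j + d)).
  exact: CkZ.
apply/funext => x; rewrite (derive_partial (is_derive_affine_flat P c d j x i)).2.
by rewrite mulrA.
Qed.

Lemma Ck_bump k (a b : R) (m : nat) i : Ck k (fun v => bump a b m (v ord0 i)).
Proof.
rewrite /bump (_ : (fun v : E => _) = fun v : E =>
  flat 1 (m.+1%:R ^+ 2 * v ord0 i + (m.+1%:R ^+ 2 * (- a - m.+1%:R^-1))) *
  flat 1 (- m.+1%:R ^+ 2 * v ord0 i + (m.+1%:R ^+ 2 * (b + m.+1%:R^-1)))).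
  by apply: CkM; exact: Ck_flat.
by apply/funext => v; congr (flat 1 _ * flat 1 _);
   set M := m.+1%:R ^+ 2; set d := _^-1; lra.
Qed.

Definition cell_bump (w a : E) (m : nat) v : R :=
  \prod_(i < n.+1) bump (a ord0 i) (a ord0 i + w ord0 i) m (v ord0 i).

Lemma Ck_cell_bump k (w a : E) (m : nat) : Ck k (cell_bump w a m).
Proof. by apply: Ck_prod => i; exact: Ck_bump. Qed.

Lemma cell_bump_bounds (w a : E) (m : nat) v : 0 <= cell_bump w a m v <= 1.
Proof.
rewrite /cell_bump; apply/andP; split.
  by apply: prodr_ge0 => i _; case/andP: (bump_bounds (a ord0 i) (a ord0 i + w ord0 i) m (v ord0 i)).
by apply: prodr_ile1 => i _; exact: bump_bounds.
Qed.

Lemma cell_bump_neq0 (w a : E) (m : nat) v : cell_bump w a m v != 0 ->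
  forall i, a ord0 i + m.+1%:R^-1 < v ord0 i < a ord0 i + w ord0 i + m.+1%:R^-1.
Proof.
move=> /prodf_neq0 h i; exact: bump_neq0 (h i isT).
Qed.

Lemma cvg_prodr (T I : Type) (F : set_system T) (FF : Filter F) (s : seq I)
  (f : I -> T -> R) (l : I -> R) : (forall i, f i x @[x --> F] --> l i) ->
  (\prod_(i <- s) f i x) @[x --> F] --> \prod_(i <- s) l i.
Proof.
move=> fl; elim: s => [|i s IH].
  by rewrite big_nil; under eq_fun do rewrite big_nil; exact: cvg_cst.
by rewrite big_cons; under eq_fun do rewrite big_cons; exact: cvgM.
Qed.

Lemma cell_bump_cvg (w a : E) v :
  cell_bump w a ^~ v @ \oo --> (\1_(cell w a) v : R).
Proof.
have -> : \1_(cell w a) v = \prod_(i < n.+1) (a ord0 i < v ord0 i <= a ord0 i + w ord0 i)%R%:R :> R.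
  rewrite indicE; have [h|h] := pselect (cell w a v).
    rewrite mem_set// big1// => i _; by move: (h i); rewrite mxE => ->.
  rewrite memNset//; have /existsNP[i hi] := h.
  by rewrite (bigD1 i)//=; move: hi; rewrite mxE => /negP/negbTE ->; rewrite mul0r.
by apply: cvg_prodr => i; exact: bump_cvg.
Qed.

Lemma tsupport_sub (Z : nmodType) (f : E -> Z) (C : set E) : closed C ->
  (forall x, f x != 0 -> C x) -> tsupport f `<=` C.
Proof. by move=> cC fC; rewrite (closure_id C).1//; exact: closure_subset. Qed.

Lemma compact_closed_box (a b : E) :
  compact [set v : E | forall i, a ord0 i <= v ord0 i <= b ord0 i].
Proof.
have := @rV_compact R n.+1 (fun i => `[a ord0 i, b ord0 i]%classic).
rewrite (_ : [set v : E | forall i, `[a ord0 i, b ord0 i]%classic (v ord0 i)] =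
  [set v : E | forall i, a ord0 i <= v ord0 i <= b ord0 i]); last first.
  by apply/seteqP; split=> v h i; move: (h i); rewrite /= in_itv.
by apply => i; exact: segment_compact.
Qed.

(** The closed [d]-neighbourhood of [U] in the sup norm lies in [Omega]. This is the room required
    by bumps, whose supports stick out of their cells. *)
Definition margin (Omega U : set E) (d : R) :=
  forall v v', U v -> (forall i, `|v' ord0 i - v ord0 i| <= d) -> Omega v'.

Lemma compact_tsupport_sub (Z : nmodType) (f : E -> Z) (K : set E) : compact K ->
  (forall x, f x != 0 -> K x) -> compact (tsupport f) /\ tsupport f `<=` K.
Proof.
move=> cK fK; have sub := tsupport_sub (compact_closed (@norm_hausdorff _ _) cK) fK.
split=> //; apply: (subclosed_compact _ cK sub); exact: closed_closure.
Qed.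

Lemma cell_margin_support (Omega : set E) (w a : E) (d : R) (m : nat) v :
  pos_width w -> margin Omega (cell w a) d -> m.+1%:R^-1 <= d ->
  (forall i, a ord0 i + m.+1%:R^-1 <= v ord0 i <= a ord0 i + w ord0 i + m.+1%:R^-1) ->
  Omega v.
Proof.
move=> w0 md mdl hv.
have m0 : 0 < (m.+1%:R^-1 : R) by rewrite invr_gt0.
(* Cutting each coordinate at the upper face gives a point of the cell, at distance at most 1/(m+1)
   from [v]. *)
apply: (md (\row_i Num.min (v ord0 i) (a ord0 i + w ord0 i))) => i; rewrite !mxE.
  rewrite lt_min ge_min lexx orbT andbT; apply/andP; split; last by rewrite ltrDl.
  by apply: lt_le_trans (andP (hv i)).1; rewrite ltrDl.
have /andP[_ h] := hv i; have [h1|h1] := leP (v ord0 i) (a ord0 i + w ord0 i).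
  by rewrite subrr normr0 (le_trans (ltW m0)).
by rewrite gtr0_norm ?subr_gt0// (le_trans _ mdl)// lerBlDl.
Qed.

Lemma Coo0_cell_bump (Omega : set E) (w a : E) (d : R) (m : nat) :
  pos_width w -> margin Omega (cell w a) d -> m.+1%:R^-1 <= d ->
  Coo0 Omega (cell_bump w a m).
Proof.
move=> w0 md mdl.
have [|c1 c2] := @compact_tsupport_sub _ (cell_bump w a m) _ (@compact_closed_box
    (a + rV_const m.+1%:R^-1) (a + w + rV_const m.+1%:R^-1)).
  by move=> v /cell_bump_neq0 h i; move: (h i); rewrite !mxE => /andP[/ltW -> /ltW ->].
split=> [k|//|]; first exact: Ck_cell_bump.
apply: (subset_trans c2) => v hv; apply: (cell_margin_support w0 md mdl) => i.
by move: (hv i); rewrite !mxE.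
Qed.

Lemma Rintegral_cell_bump (Omega : set E) (u : E -> R) (w a : E) :
  measurable Omega -> itg leb Omega u -> cell w a `<=` Omega ->
  (forall m, itg leb Omega (fun x => u x * cell_bump w a m x)) /\
  \int[leb]_(x in Omega) (u x * cell_bump w a m x) @[m --> \oo] -->
  \int[leb]_(x in cell w a) u x.
Proof.
move=> mO iu aO; rewrite -(Rintegral_indic leb _ (measurable_cell w a) aO).
have mu m : measurable_fun Omega (fun x => u x * cell_bump w a m x).
  apply: measurable_funM; first exact: itg_meas iu.
  by apply: measurable_continuous => //; exact: (Ck_continuous (Ck_cell_bump 0 w a m)).
have le_u m x : Omega x -> `|u x * cell_bump w a m x| <= `|u x|.
  move=> _; have /andP[h0 h1] := cell_bump_bounds w a m x.
  by rewrite normrM (ger0_norm h0) ler_piMr.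
split=> [m|]; first exact: itg_le (le_u m) (itg_norm _).
have [] := @Rintegral_dominated _ _ _ leb Omega mO (fun m x => u x * cell_bump w a m x)
  (fun x => u x * \1_(cell w a) x) (fun x => `|u x|) => //.
- by move=> x _; apply: cvgM; [exact: cvg_cst|exact: cell_bump_cvg].
- exact: itg_norm.
Qed.

Lemma margin_sub (Omega U : set E) (d : R) : 0 <= d -> margin Omega U d -> U `<=` Omega.
Proof. by move=> d0 md x Ux; apply: (md x) => // i; rewrite subrr normr0. Qed.

Lemma Coo0_cells_eq0 (Omega : set E) (u : E -> R) (w a : E) (d : R) :
  open Omega -> itg leb Omega u ->
  (forall phi, Coo0 Omega phi -> \int[leb]_(x in Omega) (u x * phi x) = 0) ->
  pos_width w -> 0 < d -> margin Omega (cell w a) d ->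
  \int[leb]_(x in cell w a) u x = 0.
Proof.
move=> oO iu u0 w0 d0 md; have mO := open_measurable oO.
have [_ h] := Rintegral_cell_bump mO iu (margin_sub (ltW d0) md).
suff h0 : \int[leb]_(x in Omega) (u x * cell_bump w a m x) @[m --> \oo] --> (0 : R).
  exact: (cvg_unique _ h h0).
apply: cvg_near_cst; near=> m; apply: u0; apply: (Coo0_cell_bump w0 md); apply: ltW.
near: m; exact: near_infty_natSinv_lt (PosNum d0).
Unshelve. all: by end_near. Qed.

Lemma tiles_filter (w : E) (s : seq E) (U : set E) (P : pred E) : tiles w s U ->
  tiles w (seq.filter P s) (\big[setU/set0]_(a <- seq.filter P s) cell w a).
Proof.
move=> sU x; have le1 : \sum_(a <- seq.filter P s) \1_(cell w a) x <= 1 :> R.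
  apply: (@le_trans _ _ (\1_U x)); last by rewrite indicE; case: (_ \in _).
  by rewrite -sU big_filter big_mkcond; apply: ler_sum => a _; case: (P a).
rewrite [RHS]indicE -bigcup_seq; set V := \bigcup_(_ in _) _.
have [Vx|Vx] := pselect (V x).
  apply/eqP; rewrite eq_le mem_set//= le1/=; have [a /= sa ax] := Vx.
  by rewrite (big_rem a)//= indicE mem_set//= lerDl; apply: sumr_ge0.
rewrite memNset// big1_seq// => a /andP[_ sa]; rewrite indicE memNset// => ax.
by apply: Vx; exists a.
Qed.

Lemma measurable_cells (w : E) (s : seq E) :
  measurable (\big[setU/set0]_(a <- s) cell w a).
Proof.
elim/big_rec: _ => [|a A _ mA]; first exact: measurable0.
by apply: measurableU => //; exact: measurable_cell.
Qed.

(** A large cube is refined, and at level [k] only the cells with margin 2^(-k) are kept. *)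
Lemma cell_exhaustion (Omega : set E) : open Omega -> bounded_set Omega ->
  exists (w : nat -> E) (s : nat -> seq E) (U : nat -> set E) (d : nat -> R) (L : R),
  (forall k, [/\ pos_width (w k), tiles (w k) (s k) (U k), measurable (U k),
    0 < d k & margin Omega (U k) (d k)]) /\
  [/\ 0 < L, forall k i, w k ord0 i = L / 2 ^+ k &
    forall x, Omega x -> exists K, forall k, (K <= k)%N -> U k x].
Proof.
move=> oO /bounded_sub_box[M M0 OM].
pose w0 : E := rV_const (2 * M); pose s0 : seq E := [:: rV_const (- M)].
have w00 : pos_width w0 by move=> i; rewrite mxE mulr_gt0.
have t0 : tiles w0 s0 (cell w0 (rV_const (- M))) by move=> x; rewrite big_seq1.
pose p k := refine (w0, s0) k.
have pk k : pos_width (p k).1 /\ tiles (p k).1 (p k).2 (cell w0 (rV_const (- M))).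
  exact: refine_tiles.
have d0 k : (0 : R) < 2^-1 ^+ k by rewrite exprn_gt0.
pose P k a := `[< margin Omega (cell (p k).1 a) (2^-1 ^+ k) >].
pose s k := seq.filter (P k) (p k).2.
exists (fun k => (p k).1), s, (fun k => \big[setU/set0]_(a <- s k) cell (p k).1 a),
  (fun k => 2^-1 ^+ k), (2 * M); split.
  move=> k; split=> //; first exact: (pk k).1.
  - exact: tiles_filter (pk k).2.
  - exact: measurable_cells.
  - move=> v v'; rewrite -bigcup_seq => -[a /= + av].
    by rewrite mem_filter => /andP[/asboolP h _]; exact: h av.
split; first by rewrite mulr_gt0.
  by move=> k i; rewrite refine_width mxE.
move=> x Ox; have [e e0 eO] := open_rVP oO Ox.
(* The width 2M / 2^k of a cell plus its required margin 1 / 2^k: once this is below [e], the cell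
   containing [x] has been kept. *)
have : (fun k => (2 * M + 1) * 2^-1 ^+ k) @ \oo --> (0 : R).
  by have := @cvg_geometric R (2 * M + 1) 2^-1; apply; rewrite ger0_norm ?invf_lt1 ?ltr1n.
move=> /cvgr0Pnorm_lt/(_ _ e0)[K _ hK]; exists K => k Kk.
have xQ : cell w0 (rV_const (- M)) x.
  by move=> i; move: (OM x Ox i); rewrite !mxE; lra.
have [a sa ax] := tiles_ex (pk k).2 xQ.
rewrite -bigcup_seq; exists a => //=; rewrite mem_filter sa andbT.
apply/asboolP => v v' av vv'; apply: eO => i.
have := hK k Kk; rewrite ger0_norm; last by rewrite mulr_ge0 ?ltW// ltr_wpDl// mulr_ge0// ltW.
move: (vv' i) (ax i) (av i); rewrite !mxE refine_width /= mxE -exprVn.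
by set t := 2^-1 ^+ k; rewrite ler_norml ltr_norml => /andP[? ?] /andP[? ?] /andP[? ?] ?; lra.
Qed.

(** Bumps are admissible test functions that approximate the indicator of any cell with a margin, so
    [u] integrates to zero over all cells refining each member of the exhaustion. *)
Lemma du_bois_reymond (Omega : set E) (u : E -> R) : open Omega -> bounded_set Omega ->
  itg leb Omega u ->
  (forall phi, Coo0 Omega phi -> \int[leb]_(x in Omega) (u x * phi x) = 0) ->
  {ae leb, forall x, Omega x -> u x = 0}.
Proof.
move=> oO bO iu u0.
have [w [s [U [d [L [hU [_ _ exU]]]]]]] := cell_exhaustion oO bO.
have mO := open_measurable oO.
have ae_k k : {ae leb, forall x, U k x -> u x = 0}.
  have [w0 sU mU d0 md] := hU k.
  have UO := margin_sub (ltW d0) md.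
  apply: (Rintegral_cells_eq0 mU w0 sU); first exact: itgS iu.
  move=> j a ja; have [w1 sU1] := refine_tiles j w0 sU.
  apply: (Coo0_cells_eq0 oO iu u0 w1 d0) => v v' av; apply: md.
  exact: tiles_sub sU1 ja _ av.
have : {ae leb, forall x k, U k x -> u x = 0} by apply/ae_foralln.
apply: filterS => x h Ox; have [K hK] := exU x Ox.
exact: (h K (hK K (leqnn K))).
Qed.

End Ck_calculus.

(** * Weak gradients *)

Section integration_by_parts.
Context {R : realType} {n : nat}.
Local Notation E := 'rV[R]_n.+1.
Local Notation leb := (@leb_rV R n.+1).
Local Notation dir i := (delta_mx ord0 i : E).
Implicit Types (f g phi psi : E -> R) (Omega : set E).

Lemma bounded_of_compact_support f (K : set E) : continuous f -> compact K ->
  (forall x, f x != 0 -> K x) -> exists2 C, 0 <= C & forall x, `|f x| <= C.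
Proof.
move=> cf cK fK; have cfK : {within K, continuous f} by exact: continuous_subspaceT.
have [M [_ hM]] := compact_bounded (continuous_compact cfK cK).
exists (Num.max M 0 + 1); first by rewrite addr_ge0// le_max lexx orbT.
move=> x; have [fx|/fK Kx] := eqVneq (f x) 0.
  by rewrite fx normr0 addr_ge0// le_max lexx orbT.
by apply: (hM (Num.max M 0 + 1)); [rewrite ltr_pwDr// le_max lexx|exists x].
Qed.

Lemma tsupportP f x : f x != 0 -> tsupport f x.
Proof. by move=> fx; exact: subset_closure. Qed.

Lemma partial_out_tsupport f i x : ~ tsupport f x -> partial i f x = 0.
Proof.
move=> fx; rewrite /partial -(derive_cst (0 : R) x (dir i)).
apply: near_eq_derive; have : open (~` tsupport f).
  by rewrite openC; exact: closed_closure.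
move=> op; have : nbhs x (~` tsupport f) by exact: open_nbhs_nbhs.
apply: filterS => y fy.
by apply: contrapT => /eqP /tsupportP.
Qed.

Lemma partial_tsupport f i x : partial i f x != 0 -> tsupport f x.
Proof. by apply: contra_neqP => /partial_out_tsupport. Qed.

Lemma derivable_line g i x t : derivable g (x + t *: dir i) (dir i) ->
  is_derive t 1 (fun t => g (x + t *: dir i)) (partial i g (x + t *: dir i)).
Proof.
move=> /derivableP /is_derive_lineP dg.
rewrite (_ : (fun s => _) =
   (fun h => g (h *: dir i + (x + t *: dir i))) \o (fun s => 1 * s + - t)); last first.
  apply/funext => s /=; congr g; rewrite mul1r scalerBl addrCA; congr (_ + _).
  by rewrite subrK.
rewrite -[partial _ _ _]mulr1; apply: is_derive1_comp; last exact: is_derive_affine.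
by rewrite mul1r subrr.
Qed.

Lemma difference_quotient_le g i x (h C : R) : 0 < h ->
  (forall y, derivable g y (dir i)) -> (forall y, `|partial i g y| <= C) ->
  `|h^-1 * (g (x + h *: dir i) - g x)| <= C.
Proof.
move=> h0 dg gC; have [|c _ ] := @MVT R (fun t => g (x + t *: dir i))
  (fun t => partial i g (x + t *: dir i)) 0 h h0 (fun t _ => derivable_line (dg _)).
  apply/continuous_subspaceT => t; apply/differentiable_continuous/derivable1_diffP.
  by have [] := derivable_line (dg (x + t *: dir i)).
rewrite scale0r addr0 subr0 => ->.
by rewrite mulrCA mulVf ?gt_eqF// mulr1.
Qed.

(** Difference quotients integrate to zero by translation invariance, and the mean value theorem
    provides the domination for passing to the limit; no iterated integral occurs. *)
Lemma Rintegral_partial_eq0 g i : Ck 1 g -> compact (tsupport g) ->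
  \int[leb]_x partial i g x = 0.
Proof.
move=> [cg dg] kg; have [dgi cgi] := dg i.
have [C0 C00 gC0] := bounded_of_compact_support cg kg (@tsupportP g).
have [C C0' gC] := bounded_of_compact_support cgi kg (@partial_tsupport g i).
have [M M0 gM] := bounded_sub_box (compact_bounded kg).
(* The support enlarged by 1: the increments are at most 1, so outside [B] both values in a
   difference quotient vanish. The factor C0 + C below dominates [g] as well as its quotients. *)
pose B := box (rV_const (- (M + 1))) (rV_const (M + 1)) : set E.
have mB : measurable B by exact: measurable_box.
have Bdom : itg leb setT (fun x => (C0 + C) * \1_B x).
  apply: itgZ => //; have : itg leb B (fun=> 1 : R).
    apply: (@itg_bounded _ _ _ _ _ mB 1); [exact: leb_box_fin|exact: measurable_cst|].
    by move=> x _; rewrite normr1.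
  move=> /(integrable_mkcond _ mB); apply: eq_integrable => // x _.
  by rewrite /= patchE indicE; case: (_ \in _).
have ig : itg leb setT g.
  apply: itg_le Bdom => //; first exact: measurable_continuous.
  move=> x _; have [->|/tsupportP /gM gx] := eqVneq (g x) 0.
    by rewrite normr0 mulr_ge0// addr_ge0.
  rewrite indicE mem_set ?mulr1; first by rewrite (le_trans (gC0 x))// lerDl.
  by move=> j; move: (gx j); rewrite !mxE; lra.
pose h (m : nat) : R := m.+1%:R^-1.
have h0 m : 0 < h m by rewrite invr_gt0.
pose F m x := (h m)^-1 * (g (x + h m *: dir i) - g x).
have [igt gt] : (forall m, itg leb setT (fun x => g (x + h m *: dir i))) /\
    (forall m, \int[leb]_x g (x + h m *: dir i) = \int[leb]_x g x).
  by split=> m; have [] := Rintegral_translate (h m *: dir i) ig.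
have F0 m : \int[leb]_x F m x = 0.
  rewrite RintegralZl//; last by apply: itgB => //; exact: igt.
  by rewrite RintegralB// ?gt ?subrr ?mulr0//; exact: igt.
have [] := @Rintegral_dominated _ _ _ leb setT measurableT F (partial i g)
  (fun x => (C0 + C) * \1_B x).
- by move=> m; apply: itg_meas; apply: itgZ => //; apply: itgB => //; exact: igt.
- move=> x _; have : (h^-1 *: ((g \o shift x) (h *: dir i) - g x)) @[h --> (0 : R)^'] --> partial i g x.
    exact: dgi.
  move=> /cvgr_dnbhsP/(_ h) H.
  rewrite (_ : F ^~ x = fun m => (h m)^-1 *: ((g \o shift x) (h m *: dir i) - g x)).
    by apply: H; split=> [m|]; [exact: lt0r_neq0|exact: cvg_harmonic].
  by apply/funext => m; rewrite /F /= [x + _]addrC.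
- exact: Bdom.
- move=> m x _; have [Bx|Bx] := pselect (B x).
    rewrite indicE mem_set// mulr1 (le_trans (difference_quotient_le _ _ _ gC))//.
    by rewrite lerDr.
  have hm1 : h m <= 1 by rewrite invf_le1// ler1n.
  have z (y : E) : (forall j, `|y ord0 j - x ord0 j| <= 1) -> g y = 0.
    move=> yx; apply: contrapT => /eqP /tsupportP /gM gy; apply: Bx => j.
    by move: (gy j) (yx j); rewrite !mxE ler_norml; lra.
  rewrite /F !z ?subrr ?mulr0 ?normr0 ?mulr_ge0 ?addr_ge0//.
    by move=> j; rewrite subrr normr0.
  move=> j; rewrite !mxE eqxx /= [_ + _ * _]addrC addrK normrM (gtr0_norm (h0 m)).
  by case: (j == i); rewrite ?normr1 ?normr0 ?mulr1 ?mulr0.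
move=> _ + _; under eq_fun do rewrite F0.
by move=> H; apply/esym; exact: (cvg_unique _ (cvg_cst _) H).
Qed.

Lemma tsupport_closed f : closed (tsupport f).
Proof. exact: closed_closure. Qed.

Lemma tsupportM f g : tsupport (fun x => f x * g x) `<=` tsupport g.
Proof.
apply: tsupport_sub (@tsupport_closed g) _ => x.
by rewrite mulf_eq0 negb_or => /andP[_ /tsupportP].
Qed.

Lemma itg_bounded_continuous Omega f (C : R) : measurable Omega ->
  (leb Omega < +oo)%E -> continuous f -> (forall x, `|f x| <= C) -> itg leb Omega f.
Proof.
move=> mO Oo cf fC; apply: (@itg_bounded _ _ _ _ _ mO C) => //.
exact: measurable_continuous.
Qed.

(** The support of [psi] is a compact part of [Omega], so the product extends by zero and its
    partial derivative integrates to zero over the whole space, whatever [f] does near the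
    boundary. *)
Lemma integration_by_parts Omega f psi i : open Omega -> bounded_set Omega ->
  Ck 1 f -> Coo0 Omega psi ->
  \int[leb]_(x in Omega) (f x * partial i psi x) =
  - \int[leb]_(x in Omega) (partial i f x * psi x).
Proof.
move=> oO bO f1 [psik kpsi psiO]; have mO := open_measurable oO.
have psi1 := psik 1%N.
have Oo : (leb Omega < +oo)%E by exact: leb_bounded_fin.
have [cf df] := f1; have [cpsi dpsi] := psi1.
have [C C0 fC] : exists2 C, 0 <= C & forall x, `|f x * partial i psi x| <= C.
  apply: (bounded_of_compact_support _ kpsi).
    by move=> x; apply: continuousM; [exact: cf|exact: (dpsi i).2].
  by move=> x; rewrite mulf_eq0 negb_or => /andP[_ /partial_tsupport].
have [C' C'0 fC'] : exists2 C, 0 <= C & forall x, `|partial i f x * psi x| <= C.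
  apply: (bounded_of_compact_support _ kpsi).
    by move=> x; apply: continuousM; [exact: (df i).2|exact: cpsi].
  by move=> x; rewrite mulf_eq0 negb_or => /andP[_ /tsupportP].
have i1 : itg leb Omega (fun x => f x * partial i psi x).
  apply: itg_bounded_continuous fC => // x.
  by apply: continuousM; [exact: cf|exact: (dpsi i).2].
have i2 : itg leb Omega (fun x => partial i f x * psi x).
  apply: itg_bounded_continuous fC' => // x.
  by apply: continuousM; [exact: (df i).2|exact: cpsi].
have gE x : partial i (fun x => f x * psi x) x = f x * partial i psi x + partial i f x * psi x.
  by rewrite partialM ?[psi x * _]mulrC//; [exact: (df i).1|exact: (dpsi i).1].
apply/eqP; rewrite -addr_eq0 -RintegralD//; apply/eqP.
rewrite (@eq_Rintegral _ _ _ _ _ (partial i (fun x => f x * psi x))); last by move=> x _; rewrite gE.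
rewrite -[RHS](@Rintegral_partial_eq0 (fun x => f x * psi x) i).
- rewrite -(Rintegral_indic leb _ mO (@subsetT _ Omega)); apply: eq_Rintegral => x _.
  rewrite indicE; have [Ox|Ox] := pselect (Omega x); first by rewrite mem_set ?mulr1.
  rewrite memNset// mulr0 partial_out_tsupport// => /tsupportM /psiO; exact: Ox.
- exact: CkM.
- apply: (subclosed_compact (@tsupport_closed _) kpsi); exact: tsupportM.
Qed.

End integration_by_parts.

(** * Uniqueness of weak gradients, and classical gradients as weak gradients *)

Section weak_gradient.
Context {R : realType} {n : nat}.
Local Notation E := 'rV[R]_n.+1.
Local Notation leb := (@leb_rV R n.+1).
Context (Omega : set E) (oO : open Omega) (bO : bounded_set Omega).
Implicit Types (y phi psi : E -> R) (g : E -> E).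

Let mO : measurable Omega := open_measurable oO.

Let Ofin : (leb Omega < +oo)%E := leb_bounded_fin mO bO.

Lemma Coo0_bounds A phi : Coo0 A phi ->
  exists2 C, 0 <= C & forall x, `|phi x| <= C /\ forall i, `|partial i phi x| <= C.
Proof.
move=> [phik kphi _]; have [cphi dphi] := phik 1%N.
have [C C0 hC] := bounded_of_compact_support cphi kphi (@tsupportP _ _ phi).
have hi i : exists C', 0 <= C' /\ forall x, `|partial i phi x| <= C'.
  have [C' C'0 h] := bounded_of_compact_support (dphi i).2 kphi (@partial_tsupport _ _ phi i).
  by exists C'.
have [c hc] := choice hi.
have s0 : 0 <= \sum_i c i by apply: sumr_ge0 => i _; exact: (hc i).1.
exists (C + \sum_i c i); first by rewrite addr_ge0.
move=> x; split=> [|i]; first by rewrite (le_trans (hC x))// lerDl.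
apply: (le_trans ((hc i).2 x)); rewrite (bigD1 i)//= addrCA lerDl addr_ge0//.
by apply: sumr_ge0 => j _; exact: (hc j).1.
Qed.

Lemma Coo0_continuous A phi : Coo0 A phi ->
  continuous phi /\ forall i, continuous (partial i phi).
Proof. by move=> [/(_ 1%N)[c d] _ _]; split=> // i; exact: (d i).2. Qed.

Lemma itg_test_mul A phi (u : E -> R) : itg leb Omega u -> Coo0 A phi ->
  itg leb Omega (fun x => u x * phi x) /\
  forall i, itg leb Omega (fun x => u x * partial i phi x).
Proof.
move=> iu hphi; have [C C0 hC] := Coo0_bounds hphi.
have [c1 c2] := Coo0_continuous hphi.
have gen f : continuous f -> (forall x, `|f x| <= C) -> itg leb Omega (fun x => u x * f x).
  move=> cf fC; apply: (itg_le mO (g := fun x => C * `|u x|)).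
  - by apply: measurable_funM; [exact: itg_meas iu|exact: measurable_continuous].
  - by move=> x _; rewrite normrM mulrC ler_wpM2r.
  - by apply: itgZ => //; exact: itg_norm.
by split=> [|i]; apply: gen => // x; [exact: (hC x).1|exact: (hC x).2].
Qed.

Definition weak_grad_spec y g :=
  (forall i, itg leb Omega (fun x => g x ord0 i)) /\
  forall phi, Coo0 Omega phi -> forall i,
    \int[leb]_(x in Omega) (y x * partial i phi x) =
    - \int[leb]_(x in Omega) (g x ord0 i * phi x).

Lemma is_weak_gradP y g : itg leb Omega y ->
  is_weak_grad Omega y g <-> weak_grad_spec y g.
Proof.
move=> iy; have eqv (a b : E -> R) : itg leb Omega a -> itg leb Omega b ->
    ((\int[leb]_(x in Omega) (a x)%:E = - \int[leb]_(x in Omega) (b x)%:E)%E <->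
     \int[leb]_(x in Omega) a x = - \int[leb]_(x in Omega) b x).
  move=> ia ib; rewrite -!EFin_Rintegral//; split=> [[]//|->//].
split=> -[h1 h2]; split=> // phi hphi i.
  apply/(eqv _ _ ((itg_test_mul iy hphi).2 i) (itg_test_mul (h1 i) hphi).1).
  exact: h2.
by apply/(eqv _ _ ((itg_test_mul iy hphi).2 i) (itg_test_mul (h1 i) hphi).1); exact: h2.
Qed.

Lemma weak_grad_unique y g g' : weak_grad_spec y g -> weak_grad_spec y g' ->
  {ae leb, forall x, Omega x -> g x = g' x}.
Proof.
move=> [ig hg] [ig' hg'].
have h i : {ae leb, forall x, Omega x -> g x ord0 i - g' x ord0 i = 0}.
  apply: (du_bois_reymond oO bO); first exact: itgB.
  move=> phi hphi; rewrite (@eq_Rintegral _ _ _ _ _ (fun x => g x ord0 i * phi x - g' x ord0 i * phi x)).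
    rewrite RintegralB//; [|exact: (itg_test_mul (ig i) hphi).1|exact: (itg_test_mul (ig' i) hphi).1].
    by apply/eqP; rewrite subr_eq0 -eqr_opp -hg// hg'.
  by move=> x _; rewrite mulrBl.
(* The finitely many coordinates are indexed by all natural numbers through [inord], so that the
   countable intersection of full sets applies. *)
have : {ae leb, forall x (k : nat), Omega x ->
    g x ord0 (inord k) - g' x ord0 (inord k) = 0}.
  by apply/ae_foralln => k; exact: h.
apply: filterS => x hx Ox; apply/rowP => i; apply/eqP.
by have := hx i Ox; rewrite inord_val => /eqP; rewrite subr_eq0.
Qed.

Lemma weak_grad_test A phi : Coo0 A phi ->
  itg leb Omega phi /\ weak_grad_spec phi (grad phi).
Proof.
move=> hphi; have [C C0 hC] := Coo0_bounds hphi.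
have [c1 c2] := Coo0_continuous hphi.
split; first by apply: itg_bounded_continuous => // x; exact: (hC x).1.
split=> [i|psi hpsi i].
  apply: (@eq_itg _ _ _ leb Omega mO (partial i phi)); first by move=> x _; rewrite mxE.
  by apply: itg_bounded_continuous => // x; exact: (hC x).2.
rewrite (integration_by_parts i oO bO _ hpsi); last by case: hphi.
by congr (- _); apply: eq_Rintegral => x _; rewrite mxE.
Qed.

End weak_gradient.

(** * Functions of bounded variation *)

Section bounded_variation.
Context {R : realType} {n : nat}.
Local Notation E := 'rV[R]_n.+1.
Local Notation leb := (@leb_rV R n.+1).
Local Notation dir i := (delta_mx ord0 i : E).
Implicit Types (rho : E -> R) (Omega U : set E) (w a v : E) (s : seq E).

Lemma continuous_bump (a b : R) (m : nat) : continuous (bump a b m).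
Proof.
have cflat (c d : R) : continuous (fun t => flat 1 (c * t + d)).
  move=> t; apply/differentiable_continuous/derivable1_diffP.
  by have [] := @is_derive1_comp _ (flat 1) (fun t : R => c * t + d) t _ _
    (is_derive_flat 1 (c * t + d)) (is_derive_affine c d t).
rewrite (_ : bump a b m = fun t : R =>
  flat 1 (m.+1%:R ^+ 2 * t + (m.+1%:R ^+ 2 * (- a - m.+1%:R^-1))) *
  flat 1 (- m.+1%:R ^+ 2 * t + (m.+1%:R ^+ 2 * (b + m.+1%:R^-1)))).
  by move=> t; apply: cvgM; exact: cflat.
by apply/funext => t; congr (flat 1 _ * flat 1 _);
   set M := m.+1%:R ^+ 2; set d := _^-1; lra.
Qed.

(** The fields that test the variation need only be C^1, so the primitive of a continuous bump is
    regular enough. *)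
Lemma bump_primitive (a b : R) (m : nat) :
  exists F : R -> R, forall t : R, is_derive t 1 F (bump a b m t).
Proof.
pose mu := @lebesgue_measure R.
have mb : measurable_fun setT (bump a b m) by exact: continuous_measurable_fun (@continuous_bump a b m).
pose B := `[a, b + 1]%classic : set R.
have bB (t : R) : bump a b m t != 0 -> B t.
  move=> /bump_neq0; have m0 : 0 < (m.+1%:R^-1 : R) by rewrite invr_gt0.
  have m1 : m.+1%:R^-1 <= 1 :> R by rewrite invf_le1// ler1n.
  by rewrite /B /= in_itv/=; move: m0 m1; set d := _^-1; lra.
have ib : mu.-integrable setT (EFin \o bump a b m).
  apply: (@itg_le _ _ _ mu setT measurableT _ (\1_B)) => //.
    move=> t _; have [->|/bB Bt] := eqVneq (bump a b m t) 0; first by rewrite normr0.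
    have /andP[h3 h4] := bump_bounds a b m t.
    by rewrite ger0_norm// indicE mem_set.
  have h : measurable B by exact: measurable_itv.
  rewrite /itg; have := @integrable_indic_itv R a (b + 1) true false.
  by [].
pose F (x : R) := \int[mu]_(t in [set` `]-oo, x]]) bump a b m t.
exists F => t; have [] := @continuous_FTC1 R (bump a b m) -oo%O t (t + 1) _ _ _ _.
- by rewrite ltrDl.
- by apply: integrableS ib.
- by rewrite ltNyr.
- exact: continuous_bump.
by move=> dF F'; split; [exact: dF|rewrite -derive1E F'].
Qed.

Lemma enorm_dir (c : R) i : enorm (c *: dir i) = `|c|.
Proof.
rewrite /enorm /dotv (bigD1 i)//= big1 => [|j ji]; last by rewrite !mxE eqxx (negbTE ji) !mulr0.
by rewrite !mxE !eqxx mulr1 addr0 -expr2 sqrtr_sqr.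
Qed.

Lemma Ck1_coord (psi dpsi : R -> R) i : (forall t : R, is_derive t 1 psi (dpsi t)) ->
  continuous dpsi -> Ck 1 (fun v : E => psi (v ord0 i)).
Proof.
move=> hpsi cdpsi; split.
  move=> v; apply: (continuous_comp (f := fun v : E => v ord0 i) (g := psi)).
    exact: coord_continuous.
  by apply/differentiable_continuous/derivable1_diffP; have [] := hpsi (v ord0 i).
move=> j; have h v := derive_partial (@is_derive_coord R n psi _ i v j (hpsi (v ord0 i))).
split=> [v|]; first exact: (h v).1.
rewrite (_ : partial j _ = fun v => (i == j)%:R * dpsi (v ord0 i)); last first.
  by apply/funext => v; exact: (h v).2.
apply: (@CkZ R n 0 _ (fun v => dpsi (v ord0 i))) => v.
apply: (continuous_comp (f := fun v : E => v ord0 i) (g := dpsi)); first exact: coord_continuous.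
exact: cdpsi.
Qed.

Lemma bump_shift (a b c : R) (m : nat) t : bump (a + c) (b + c) m t = bump a b m (t - c).
Proof. by congr (flat 1 (_ * _) * flat 1 (_ * _)); set d := _^-1; lra. Qed.

(* The fields testing the difference of the means over the two halves of a cell
   are multiples of such primitives. *)
Lemma cell_potential w a i (m : nat) : pos_width w ->
  exists G : E -> R, [/\ Ck 1 G,
    forall v, partial i G v = cell_bump (w - half i w) a m v -
                            cell_bump (w - half i w) (a + half i w) m v,
    forall v, G v != 0 -> forall j,
      a ord0 j + m.+1%:R^-1 < v ord0 j < a ord0 j + w ord0 j + m.+1%:R^-1 &
    forall v, `|G v| <= w ord0 i].
Proof.
move=> w0; pose h := w ord0 i / 2; have h0 : 0 < h by rewrite divr_gt0.
pose chi := bump (a ord0 i) (a ord0 i + h) m.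
have [F dF] := bump_primitive (a ord0 i) (a ord0 i + h) m.
have cF : continuous F.
  by move=> t; apply/differentiable_continuous/derivable1_diffP; have [] := dF t.
(* Its derivative is the bump of the lower half minus its translate, the bump of the upper half. The
   two have the same mass, so [T] vanishes beyond both, and it is bounded by [h] because bumps are
   at most 1. *)
pose T t := F t - F (t - h).
have dT (t : R) : is_derive t 1 T (chi t - chi (t - h)).
  have dFh : is_derive t 1 (fun t : R => F (t - h)) (chi (t - h)).
    rewrite (_ : (fun t => _) = F \o (fun t => 1 * t + - h)); last first.
      by apply/funext => z /=; rewrite mul1r.
    rewrite -[chi _]mulr1; apply: (@is_derive1_comp _ F); last exact: is_derive_affine.
    by rewrite mul1r; exact: dF.
  exact: (is_deriveB (dF t) dFh).
have mvt x y : x <= y -> exists2 c, c \in `[x, y]%R & F y - F x = chi c * (y - x).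
  move=> xy; apply: (MVT_segment xy).
  exact: continuous_subspaceT.
have Fle x y : x <= y -> 0 <= F y - F x <= y - x.
  move=> xy; have [c _ ->] := mvt x y xy.
  have /andP[c0 c1] := bump_bounds (a ord0 i) (a ord0 i + h) m c.
  by rewrite mulr_ge0 ?subr_ge0//= ler_piMl ?subr_ge0.
have Tle t : 0 <= T t <= h.
  by have := Fle (t - h) t; rewrite gerBl opprB addrCA subrr addr0; apply; exact: ltW.
have T0 t : T t != 0 -> a ord0 i + m.+1%:R^-1 < t < a ord0 i + w ord0 i + m.+1%:R^-1.
  move=> Tt; have [|c] := mvt (t - h) t; first by rewrite gerBl ltW.
  rewrite -/(T t) in_itv/= => /andP[c1 c2] TE; move: Tt; rewrite TE mulf_eq0 negb_or => /andP[+ _].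
  by move=> /bump_neq0; move: c1 c2 h0; rewrite /h; set d := m.+1%:R^-1; lra.
(* The cut-off in the other directions does not depend on the i-th coordinate and passes through the
   i-th partial derivative. *)
pose P v := \prod_(j < n.+1 | j != i) bump (a ord0 j) (a ord0 j + w ord0 j) m (v ord0 j).
have P01 v : 0 <= P v <= 1.
  apply/andP; split.
    by apply: prodr_ge0 => j _; case/andP: (bump_bounds (a ord0 j) (a ord0 j + w ord0 j) m (v ord0 j)).
  by apply: prodr_ile1 => j _; exact: bump_bounds.
have CP : Ck 1 P.
  rewrite (_ : P = fun v => \prod_(j < n.+1) (if j != i then bump (a ord0 j) (a ord0 j + w ord0 j) m (v ord0 j) else 1)).
    by apply: Ck_prod => j; case: (j != i); [exact: Ck_bump|exact: Ck_cst].
  by apply/funext => v; rewrite /P big_mkcond.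
have dP v : is_derive v (dir i) P 0.
  apply/is_derive_lineP; rewrite (_ : (fun h => _) = fun=> P v).
    exact: (is_derive_cst (P v) (0 : R) 1).
  apply/funext => t; apply: eq_bigr => j ji.
  by rewrite !mxE eqxx (negbTE ji) mulr0 add0r.
have CT : Ck 1 (fun v : E => T (v ord0 i)).
  apply: (@Ck1_coord T (fun t => chi t - chi (t - h))) => // t.
  apply: continuousB; first exact: continuous_bump.
  apply: (continuous_comp (f := fun t => t - h) (g := chi)); last exact: continuous_bump.
  by apply: continuousB; [exact: cvg_id|exact: cst_continuous].
exists (fun v => P v * T (v ord0 i)); split.
- exact: CkM.
- move=> v; have [_ dTv] := derive_partial (@is_derive_coord R n T _ i v i (dT (v ord0 i))).
  rewrite partialM ?dTv; last 2 first.
  + by have [] := dP v.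
  + by have [_ /(_ i)[]] := CT.
  rewrite (derive_partial (dP v)).2 mulr0 addr0 eqxx mul1r mulrBr; congr (_ - _).
    rewrite /cell_bump [RHS](bigD1 i)//= mulrC; congr (_ * _).
      by rewrite /chi sub_half_coord eqxx.
    by apply: eq_bigr => j ji; rewrite sub_half_coord (negbTE ji).
  rewrite /cell_bump [RHS](bigD1 i)//= mulrC; congr (_ * _).
    rewrite /chi -bump_shift sub_half_coord eqxx mxE half_coord eqxx -/h.
    by congr bump; lra.
  by apply: eq_bigr => j ji; rewrite sub_half_coord (negbTE ji) mxE half_coord (negbTE ji) addr0.
- move=> v; rewrite mulf_eq0 negb_or => /andP[/prodf_neq0 Pv /T0 Tv] j.
  by have [->|ji] := eqVneq j i; [exact: Tv|exact: bump_neq0 (Pv j ji)].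
- move=> v; have /andP[p0 p1] := P01 v; have /andP[t0 t1] := Tle (v ord0 i).
  rewrite ger0_norm ?mulr_ge0//; apply: (@le_trans _ _ (T (v ord0 i))); first by rewrite ler_piMl.
  by apply: (le_trans t1); rewrite /h; have := w0 i; lra.
Qed.

Lemma Ck_sum k (I : Type) (s : seq I) (F : I -> E -> R) :
  (forall i, Ck k (F i)) -> Ck k (fun x => \sum_(i <- s) F i x).
Proof.
move=> hF; elim: s => [|i s IH].
  rewrite (_ : (fun x => _) = fun=> 0); first exact: Ck_cst.
  by apply/funext => x; rewrite big_nil.
rewrite (_ : (fun x => _) = fun x => F i x + \sum_(j <- s) F j x); first exact: CkD.
by apply/funext => x; rewrite big_cons.
Qed.

Lemma partial_cst (c : R) i x : partial i (fun _ : E => c) x = 0.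
Proof. by rewrite /partial; exact: (derive_cst c x). Qed.

Lemma Ck1_derivable (f : E -> R) i x : Ck 1 f -> derivable f x (dir i).
Proof. by move=> [_ /(_ i)[]]. Qed.

Lemma partialZ (c : R) (f : E -> R) i x : Ck 1 f ->
  partial i (fun x => c * f x) x = c * partial i f x.
Proof.
move=> cf; rewrite partialM ?partial_cst ?mulr0 ?addr0//.
exact: Ck1_derivable.
Qed.

Lemma partialD (f g : E -> R) i x : Ck 1 f -> Ck 1 g ->
  partial i (fun x => f x + g x) x = partial i f x + partial i g x.
Proof. by move=> cf cg; rewrite /partial deriveD//; exact: Ck1_derivable. Qed.

Lemma partial_sum (I : Type) (s : seq I) (F : I -> E -> R) i x :
  (forall j, Ck 1 (F j)) ->
  partial i (fun x => \sum_(j <- s) F j x) x = \sum_(j <- s) partial i (F j) x.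
Proof.
move=> hF; elim: s => [|j s IH].
  rewrite (_ : (fun x => _) = fun=> 0) ?partial_cst ?big_nil//.
  by apply/funext => z; rewrite big_nil.
rewrite (_ : (fun x => _) = fun x => F j x + \sum_(k <- s) F k x); last first.
  by apply/funext => z; rewrite big_cons.
by rewrite partialD// ?IH ?big_cons//; exact: Ck_sum.
Qed.

(** The potentials of all cells, with suitable signs and divided by the width, form the i-th
    component of one admissible field; its divergence tests the differences of the bumps of the two
    halves, and the bumps tend to indicators. *)
Lemma variation_cells Omega rho (V : R) w s U (d : R) i : open Omega ->
  itg leb Omega rho -> (div_variation Omega rho <= V%:E)%E ->
  pos_width w -> tiles w s U -> 0 < d -> margin Omega U d ->
  \sum_(a <- s) `|\int[leb]_(x in cell (w - half i w) (a + half i w)) rho x -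
                  \int[leb]_(x in cell (w - half i w) a) rho x| <= w ord0 i * V.
Proof.
move=> oO irho hV w0 sU d0 mU; have mO := open_measurable oO.
have UO := margin_sub (ltW d0) mU.
pose L a := \int[leb]_(x in cell (w - half i w) a) rho x.
pose Rt a := \int[leb]_(x in cell (w - half i w) (a + half i w)) rho x.
(* The sign turns the limit of each term of the tested integral into |L - Rt|. *)
pose c a := Num.sg (L a - Rt a).
have c1 a : `|c a| <= 1 by rewrite normr_sg; case: eqP.
have [G hG] := choice (fun p : E * nat => @cell_potential w p.1 i p.2 w0).
pose Psi m v := \sum_(a <- s) c a * G (a, m) v.
have CG a m : Ck 1 (fun v => c a * G (a, m) v) by apply: CkZ; have [] := hG (a, m).
have CPsi m : Ck 1 (Psi m) by exact: Ck_sum.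
have PsiG m v : Psi m v != 0 -> exists2 a, a \in s & G (a, m) v != 0.
  apply: contra_neqP => h; apply: big1_seq => a /andP[_ sa].
  by have [->|Gn0] := eqVneq (G (a, m) v) 0; [rewrite mulr0|case: h; exists a].
have Psi_le m v : `|Psi m v| <= w ord0 i.
  (* Moved back by the shift built into the bumps, the point lies in the cell of every potential
     that does not vanish at [v]; since cells are disjoint, there is at most one, and the sum is as
     small as a single term. *)
  pose v' := v - rV_const m.+1%:R^-1.
  apply: (@le_trans _ _ (\sum_(a <- s) w ord0 i * \1_(cell w a) v')).
    apply: (le_trans (ler_norm_sum _ _ _)); apply: ler_sum => a _.
    have [_ _ supp le_w] := hG (a, m); rewrite normrM.
    have [->|Gn0] := eqVneq (G (a, m) v) 0.
      by rewrite normr0 mulr0 mulr_ge0// ltW.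
    rewrite indicE mem_set ?mulr1.
      by apply: le_trans (le_w v); rewrite ler_piMl.
    move=> j; have := supp v Gn0 j; rewrite !mxE /=.
    by set t := m.+1%:R^-1 => /andP[? ?]; apply/andP; split; lra.
  rewrite -mulr_sumr sU indicE; have := w0 i.
  by case: (_ \in _) => /= h; rewrite ?mulr1// mulr0 ltW.
pose phi m v : E := ((w ord0 i)^-1 * Psi m v) *: dir i.
have phiE m v k : phi m v ord0 k = if k == i then (w ord0 i)^-1 * Psi m v else 0.
  by rewrite !mxE eqxx /=; case: eqP; rewrite ?mulr1 ?mulr0.
have divE m v : divergence (phi m) v = (w ord0 i)^-1 *
   \sum_(a <- s) c a * (cell_bump (w - half i w) a m v -
                        cell_bump (w - half i w) (a + half i w) m v).
  rewrite /divergence (bigD1 i)//= big1 => [|k ki]; last first.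
    rewrite (_ : (fun z => _) = fun=> 0) ?partial_cst//.
    by apply/funext => z; rewrite phiE (negbTE ki).
  rewrite addr0 (_ : (fun z => _) = fun z => (w ord0 i)^-1 * Psi m z); last first.
    by apply/funext => z; rewrite phiE eqxx.
  rewrite partialZ// partial_sum//; congr (_ * _); apply: eq_bigr => a _.
  have [CGa dG _ _] := hG (a, m).
  by rewrite partialZ// dG.
have phi_adm m : m.+1%:R^-1 <= d ->
    C10_vec Omega (phi m) /\ forall x, Omega x -> enorm (phi m x) <= 1.
  move=> md; split; last first.
    move=> x _; rewrite enorm_dir normrM normfV (gtr0_norm (w0 i)).
    by rewrite ler_pdivrMl// mulr1.
  pose K := \big[setU/set0]_(a <- s) [set v : E | forall j,
    (a + rV_const m.+1%:R^-1) ord0 j <= v ord0 j <= (a + w + rV_const m.+1%:R^-1) ord0 j].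
  have cK : compact K.
    rewrite /K; elim/big_rec: _ => [|a A _ cA]; first exact: compact0.
    by apply: compactU => //; exact: compact_closed_box.
  have suppK x : Psi m x != 0 -> K x.
    move=> /PsiG[a sa Ga]; rewrite /K -bigcup_seq; exists a => //= j.
    have [_ _ /(_ x Ga j) + _] := hG (a, m).
    by rewrite !mxE => /andP[/ltW -> /ltW ->].
  (* In [C10_vec] the values of the field are compared with zero as functions
     of the row and column indices. *)
  have suppK' x : fun_of_matrix (phi m x) != 0 -> K x.
    move=> phix; apply: suppK; apply: contra_neq phix => Psi0.
    by apply/funext => j; apply/funext => k; rewrite /phi Psi0 mulr0 scale0r mxE.
  have [h1 h2] := compact_tsupport_sub cK suppK'.
  split=> [k||]; [|exact: h1|].
    rewrite (_ : (fun x => _) = if k == i then fun x => (w ord0 i)^-1 * Psi m x else fun=> 0).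
      by case: eqP => _; [exact: CkZ|exact: Ck_cst].
    by apply/funext => z; rewrite phiE; case: eqP.
  apply: (subset_trans h2) => v; rewrite /K -bigcup_seq => -[a /= sa hv].
  apply: (cell_margin_support w0 (_ : margin Omega (cell w a) d) md) => [v1 v2 av|j].
    by apply: mU; exact: tiles_sub sU sa _ av.
  by move: (hv j); rewrite !mxE.
have subL a : a \in s -> cell (w - half i w) a `<=` Omega.
  move=> sa; apply: subset_trans UO; apply: subset_trans (tiles_sub sU sa).
  by move=> x /(cellL i a x w0)[].
have subR a : a \in s -> cell (w - half i w) (a + half i w) `<=` Omega.
  move=> sa; apply: subset_trans UO; apply: subset_trans (tiles_sub sU sa).
  by move=> x /(cellR i a x w0)[].
pose A m := (w ord0 i)^-1 * \sum_(a <- s) c a *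
   (\int[leb]_(x in Omega) (rho x * cell_bump (w - half i w) a m x) -
    \int[leb]_(x in Omega) (rho x * cell_bump (w - half i w) (a + half i w) m x)).
have A_le m : m.+1%:R^-1 <= d -> A m <= V.
  move=> md; have [h1 h2] := phi_adm m md.
  have icb a : itg leb Omega (fun x => rho x * cell_bump (w - half i w) a m x).
    apply: (itg_le mO _ _ (itg_norm irho)).
      apply: measurable_funM; first exact: itg_meas irho.
      by apply: measurable_continuous => //; exact: (Ck_continuous (Ck_cell_bump 0 _ a m)).
    move=> x _; have /andP[b0 b1] := cell_bump_bounds (w - half i w) a m x.
    by rewrite normrM (ger0_norm b0) ler_piMr.
  have idiff a : itg leb Omega (fun x => c a * (rho x * cell_bump (w - half i w) a m x -
        rho x * cell_bump (w - half i w) (a + half i w) m x)).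
    by apply: itgZ => //; apply: itgB.
  have rhodiv x : rho x * divergence (phi m) x = (w ord0 i)^-1 * \sum_(a <- s)
      c a * (rho x * cell_bump (w - half i w) a m x -
        rho x * cell_bump (w - half i w) (a + half i w) m x).
    rewrite divE mulrCA mulr_sumr; congr (_ * _); apply: eq_bigr => a _.
    by rewrite mulrCA mulrBr.
  have -> : A m = \int[leb]_(x in Omega) (rho x * divergence (phi m) x).
    rewrite (eq_Rintegral _ (fun x _ => rhodiv x)) RintegralZl//; last exact: itg_sum.
    rewrite (Rintegral_sum mO)//; congr (_ * _); apply: eq_bigr => a _.
    rewrite RintegralZl ?RintegralB//; [exact: icb|exact: icb|exact: itgB].
  rewrite -lee_fin (EFin_Rintegral mO); last first.
    apply: (eq_itg mO (fun x _ => esym (rhodiv x))).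
    by apply: itgZ => //; exact: itg_sum.
  by apply: (@le_trans _ _ (div_variation Omega rho)) => //; apply: ereal_sup_ubound; exists (phi m).
have A_cvg : A m @[m --> \oo] --> (w ord0 i)^-1 * \sum_(a <- s) `|Rt a - L a|.
  apply: cvgM; first exact: cvg_cst.
  elim: (s) subL subR => [|a s' IH] sL sR.
    by rewrite big_nil; under eq_fun do rewrite big_nil; exact: cvg_cst.
  rewrite big_cons; under eq_fun do rewrite big_cons.
  apply: cvgD; last first.
    by apply: IH => b sb; [apply: sL|apply: sR]; rewrite in_cons sb orbT.
  have -> : `|Rt a - L a| = c a * (L a - Rt a) by rewrite distrC normrEsg.
  apply: cvgM; first exact: cvg_cst.
  by apply: cvgB; apply: (Rintegral_cell_bump mO irho _).2; [apply: sL|apply: sR]; rewrite mem_head.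
rewrite mulrC -ler_pdivrMr// mulrC; apply: (cvgr_to_le A_cvg).
near=> m; apply: A_le; apply: ltW.
near: m; exact: near_infty_natSinv_lt (PosNum d0).
Unshelve. all: by end_near. Qed.

Lemma variation_step_avg Omega rho (V l : R) w s U (d : R) : open Omega ->
  itg leb Omega rho -> (div_variation Omega rho <= V%:E)%E -> 0 <= V ->
  pos_width w -> tiles w s U -> measurable U -> 0 < d -> margin Omega U d ->
  (forall i, w ord0 i <= l) ->
  \int[leb]_(x in U) `|rho x - step_avg w s rho x| <= 2 * (n.+1%:R * l * V).
Proof.
move=> oO irho hV V0 w0 sU mU d0 md wl.
have UO := margin_sub (ltW d0) md; have mO := open_measurable oO.
apply: step_avg_dist => //; first exact: (itgS mO).
by move=> i w' s' w'0 s'U; exact: (@variation_cells Omega rho V w' s' U d i).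
Qed.

End bounded_variation.

(** * Compactness of dominated families of bounded variation *)

Lemma ultrafilter_bounded_cvg {R : realType} (F : set_system nat) (u : nat -> R) (C : R) :
  UltraFilter F -> (forall k, `|u k| <= C) -> exists l : R, u k @[k --> F] --> l.
Proof.
move=> UF uC; have FF : ProperFilter F by exact: ultra_proper.
have [l cl] : exists l, cluster (u @ F) l.
  have : compact `[- C, C]%classic by exact: segment_compact.
  move=> /(_ (u @ F) _)[|l [_ cl]]; last by exists l.
  have : (u @ F) `[- C, C]%classic; last by [].
  have : F [set k | `|u k| <= C] by apply: filterE => k; exact: uC.
  by rewrite /nbhs/=; apply: filterS => k; rewrite /= in_itv/= -ler_norml.
exists l; apply/cvgrPdist_lt => e e0.
have [//|FnA] := in_ultra_setVsetC [set k | `|l - u k| < e] UF.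
have nF : (u @ F) (u @` ~` [set k | `|l - u k| < e]).
  by rewrite /nbhs/=; apply: filterS FnA => k nk; exists k.
by have [_ [[k nk <-]]] := cl _ _ nF (nbhsx_ballx l e e0).
Qed.

Section bv_compactness.
Context {R : realType} {n : nat}.
Local Notation E := 'rV[R]_n.+1.
Local Notation leb := (@leb_rV R n.+1).
Context (Omega : set E) (oO : open Omega) (bO : bounded_set Omega).

Lemma step_avg_le (U : set E) (w : E) (s : seq E) (u v : E -> R) : measurable U ->
  pos_width w -> tiles w s U -> itg leb U u -> itg leb U v ->
  \int[leb]_(x in U) `|step_avg w s u x - step_avg w s v x| <=
  \sum_(a <- s) `|\int[leb]_(x in cell w a) u x - \int[leb]_(x in cell w a) v x|.
Proof.
move=> mU w0 sU iu iv; have v0 := vol_gt0 w0.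
have i1 a : itg leb U (fun x => \1_(cell w a) x : R).
  apply: (@itg_bounded _ _ _ _ _ mU 1) => //.
  - exact: tiles_lty sU.
  - by apply: measurable_indic; exact: measurable_cell.
  - by move=> x _; rewrite indicE; case: (_ \in _); rewrite ?normr1 ?normr0.
pose c a := `|\int[leb]_(x in cell w a) u x - \int[leb]_(x in cell w a) v x|.
apply: (@le_trans _ _ (\int[leb]_(x in U) \sum_(a <- s) (c a / vol w * \1_(cell w a) x))).
  apply: le_Rintegral => //.
  - by apply: itg_norm; apply: (itgB mU); exact: itg_step_avg.
  - by apply: itg_sum => // a; apply: itgZ.
  move=> x _; rewrite /step_avg -sumrB; apply: (le_trans (ler_norm_sum _ _ _)).
  apply: ler_sum => a _; rewrite -mulrBl -mulrBl normrM normrM.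
  by rewrite (gtr0_norm (_ : 0 < (vol w)^-1)) ?invr_gt0// (@ger0_norm _ (\1__ _)).
rewrite (Rintegral_sum mU) => [|a]; last exact: itgZ.
rewrite big_seq [leRHS]big_seq; apply: ler_sum => a sa.
by rewrite (RintegralZl _ mU (i1 a)) (Rintegral_indic_cell w0 sU sa) mulfVK// gt_eqF.
Qed.

Lemma filter_forall_seq (T : eqType) (I : Type) (F : set_system I) (s : seq T)
  (P : T -> set I) : Filter F -> (forall a, a \in s -> F (P a)) ->
  F [set p | forall a, a \in s -> P a p].
Proof.
move=> FF; elim: s => [|a s IH] h; first by apply: filterE.
have h1 := h a (mem_head _ _).
have h2 : F [set p | forall b, b \in s -> P b p].
  by apply: IH => b sb; apply: h; rewrite in_cons sb orbT.
apply: filterS2 h1 h2 => p pa ps b; rewrite in_cons => /orP[/eqP -> //|]; exact: ps.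
Qed.

(* Along an ultrafilter all cell averages converge, and the averages are
   uniformly close to the functions; near the boundary the domination by [b]
   replaces the regularity of the boundary. *)
Lemma bv_ultrafilter_cauchy (F : set_system nat) (rho : nat -> E -> R) (b : E -> R) (V : R) :
  UltraFilter F ->
  (forall k, itg leb Omega (rho k)) -> itg leb Omega b ->
  (forall k, div_variation Omega (rho k) <= V%:E)%E ->
  {ae leb, forall x, Omega x -> forall k, `|rho k x| <= b x} ->
  forall e : R, 0 < e ->
    exists2 A, F A & forall p q, A p -> A q ->
      \int[leb]_(x in Omega) `|rho p x - rho q x| <= e.
Proof.
(* The bookkeeping of the error shares, stated in plain variables and later applied to integrals.
   The shares are e/8 for each of the two averagings, e/4 for the averages and 2 (e/8) for the
   boundary layer. *)
have ar1 (N a v : R) : a * (N + 1) = v / 8 -> 0 < a -> N * (2 * a) <= v / 4 by lra.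
have ar2 (u v : R) : 4 * u < v / 4 -> 2 * u <= v / 8 by lra.
have ar3 (v : R) : 0 < v -> v / 8 + v / 4 + v / 8 + 2 * (v / 8) <= v by lra.
move=> UF irho ib hV rb e e0; have FF : ProperFilter F by exact: ultra_proper.
have mO := open_measurable oO.
have [w [s [U [d [L [hU [L0 wL exU]]]]]]] := cell_exhaustion oO bO.
have UO k : U k `<=` Omega by have [_ _ _ dk mk] := hU k; exact: margin_sub (ltW dk) mk.
have V0 : 0 <= `|V| by [].
have hV' k : (div_variation Omega (rho k) <= `|V|%:E)%E.
  by apply: le_trans (hV k) _; rewrite lee_fin ler_norm.
(* The part of the dominating function outside the k-th exhausting set; its integral tends to
   zero. *)
pose T k x := b x * (1 - \1_(U k) x).
have mU k : measurable (U k) by have [] := hU k.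
have mb : measurable_fun Omega b by exact: (itg_meas ib).
have mT k : measurable_fun Omega (T k).
  by apply: measurable_funM => //; apply: measurable_funB => //; exact: measurable_indic.
have Tb k x : Omega x -> `|T k x| <= `|b x|.
  move=> _; rewrite /T indicE; case: (_ \in _); rewrite ?subrr ?mulr0 ?normr0//.
  by rewrite subr0 mulr1.
have [||||_ T0 _] := @Rintegral_dominated _ _ _ leb Omega mO T (fun=> 0) (fun x => `|b x|).
- by [].
- move=> x Ox; have [K KU] := exU x Ox; apply: cvg_near_cst.
  by near=> k; rewrite /T indicE mem_set ?subrr ?mulr0//; apply: KU; near: k; exact: nbhs_infty_ge.
- exact: itg_norm.
- by [].
have iT k : itg leb Omega (T k) by apply: itg_le (mT k) (Tb k) (itg_norm ib).
rewrite Rintegral_cst// mul0r in T0.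
(* Twice the constant of the averaging estimate, so that c / 2^k < e/4 leaves e/8 for each averaging
   error. *)
pose c := 4 * (n.+1%:R * L * `|V|).
have c0 : geometric c (2^-1 : R) @ \oo --> 0.
  by apply: cvg_geometric; rewrite ger0_norm// invf_lt1// ltr1n.
have [k [Tk ck]] : exists k, \int[leb]_(x in Omega) T k x < e / 8 /\ c / 2 ^+ k < e / 4.
  have e8 : 0 < e / 8 by rewrite divr_gt0.
  have e4 : 0 < e / 4 by rewrite divr_gt0.
  have h1 : \forall k \near \oo, \int[leb]_(x in Omega) T k x < e / 8 by exact: (cvgr_lt _ T0 _ e8).
  have h2 : \forall k \near \oo, geometric c (2^-1 : R) k < e / 4 by exact: (cvgr_lt _ c0 _ e4).
  have [k kP] := filter_ex (filterI h1 h2).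
  by exists k; move: kP => /= [? ?]; split=> //; rewrite -exprVn.
have [wk sU mUk dk mk] := hU k.
have irU p : itg leb (U k) (rho p) by exact: (itgS mO).
have cb p a : a \in s k -> `|\int[leb]_(x in cell (w k) a) rho p x| <=
    \int[leb]_(x in Omega) `|b x|.
  move=> sa; have cO : cell (w k) a `<=` Omega.
    by apply: subset_trans (UO k); exact: tiles_sub sU sa.
  rewrite -(Rintegral_indic leb _ (measurable_cell _ _) cO).
  have i1 : itg leb Omega (fun x => rho p x * \1_(cell (w k) a) x).
    by apply: itg_indic => //; exact: measurable_cell.
  apply: (le_trans (le_normr_Rintegral mO i1)).
  apply: (le_Rintegral_ae mO); [exact: itg_norm|exact: itg_norm|].
  apply: filterS rb => x rb Ox; rewrite normrM indicE.
  apply: (@le_trans _ _ `|rho p x|).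
    by case: (_ \in _); rewrite ?normr1 ?normr0 ?mulr1 ?mulr0.
  exact: le_trans (rb Ox p) (ler_norm _).
(* The successor keeps the denominator nonzero when no cell has been kept. *)
pose de := e / 8 / (size (s k)).+1%:R.
have de0 : 0 < de by rewrite /de !divr_gt0.
have ex (a : E) : exists la : R, a \in s k ->
    \int[leb]_(x in cell (w k) a) rho p x @[p --> F] --> la.
  have [sa|] := boolP (a \in s k); last by exists 0.
  have [la h] := @ultrafilter_bounded_cvg R F (fun p => \int[leb]_(x in cell (w k) a) rho p x) _ UF
     (fun p => cb p a sa).
  by exists la.
have [l hl] := choice ex.
exists [set p | forall a, a \in s k -> `|l a - \int[leb]_(x in cell (w k) a) rho p x| < de].
  by apply: filter_forall_seq => a sa; have /cvgrPdist_lt/(_ _ de0) := hl a sa.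
move=> p q Ap Aq.
have i1 : itg leb Omega (fun x => `|rho p x - rho q x|) by apply: itg_norm; exact: (itgB mO).
have i2 : itg leb Omega (fun x => `|rho p x - rho q x| * \1_(U k) x) by apply: itg_indic.
have i3 : itg leb Omega (fun x => 2 * T k x) by exact: itgZ.
have h1 : \int[leb]_(x in Omega) `|rho p x - rho q x| <=
    \int[leb]_(x in U k) `|rho p x - rho q x| + 2 * \int[leb]_(x in Omega) T k x.
  rewrite -(Rintegral_indic leb (fun x => `|rho p x - rho q x|) (mU k) (UO k)).
  rewrite -(RintegralZl _ mO (iT k)) -(RintegralD mO i2 i3).
  apply: (le_Rintegral_ae mO) => //; first exact: (itgD mO).
  apply: filterS rb => x rb Ox; have := rb Ox p; have := rb Ox q.
  have := ler_normB (rho p x) (rho q x).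
  rewrite /T indicE; case: (_ \in _); rewrite /= ?subrr ?mulr0 ?addr0 ?mulr1//.
  by rewrite subr0 mulr1; lra.
pose Ep p := step_avg (w k) (s k) (rho p).
have iE r : itg leb (U k) (Ep r) by exact: itg_step_avg.
have iN (u v : E -> R) : itg leb (U k) u -> itg leb (U k) v ->
    itg leb (U k) (fun x => `|u x - v x|) by move=> iu iv; apply: itg_norm; exact: (itgB mUk).
have h2 : \int[leb]_(x in U k) `|rho p x - rho q x| <=
    \int[leb]_(x in U k) `|rho p x - Ep p x| + \int[leb]_(x in U k) `|Ep p x - Ep q x| +
    \int[leb]_(x in U k) `|rho q x - Ep q x|.
  rewrite -(RintegralD mUk (iN _ _ (irU p) (iE p)) (iN _ _ (iE p) (iE q))).
  rewrite -(RintegralD mUk (itgD mUk (iN _ _ (irU p) (iE p)) (iN _ _ (iE p) (iE q))) (iN _ _ (irU q) (iE q))).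
  apply: le_Rintegral => //.
  - exact: iN.
  - by apply: (itgD mUk); [apply: (itgD mUk)|]; exact: iN.
  move=> x _; have := ler_distD (Ep p x) (rho p x) (rho q x).
  have := ler_distD (Ep q x) (Ep p x) (rho q x).
  by rewrite (distrC (Ep q x)); lra.
have h3 r : \int[leb]_(x in U k) `|rho r x - Ep r x| <= 2 * (n.+1%:R * (L / 2 ^+ k) * `|V|).
  apply: (@variation_step_avg _ _ Omega (rho r) `|V| _ (w k) (s k) (U k) (d k)) => //.
  by move=> i; rewrite wL.
have h4 : \int[leb]_(x in U k) `|Ep p x - Ep q x| <= e / 4.
  apply: (le_trans (step_avg_le (mU k) wk sU (irU p) (irU q))).
  apply: (@le_trans _ _ (\sum_(a <- s k) (2 * de))).
    rewrite big_seq [leRHS]big_seq; apply: ler_sum => a sa.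
    apply: (le_trans (ler_distD (l a) _ _)); rewrite distrC mulr_natl mulr2n.
    by apply: lerD; apply: ltW; [exact: Ap|exact: Aq].
  rewrite big_const_seq count_predT iter_addr_0 -[_ *+ size _]mulr_natl.
  by apply: ar1 => //; rewrite natr1 /de mulfVK.
have h3e r : \int[leb]_(x in U k) `|rho r x - Ep r x| <= e / 8.
  apply: (le_trans (h3 r)).
  have hc : c / 2 ^+ k = 4 * (n.+1%:R * (L / 2 ^+ k) * `|V|).
    by rewrite /c -!mulrA; congr (4 * (_ * (_ * _))); rewrite mulrC.
  by apply: ar2; rewrite -hc.
apply: le_trans (ar3 _ e0); apply: (le_trans h1); apply: lerD; last by rewrite ler_pM2l// ltW.
by apply: (le_trans h2); apply: lerD => //; exact: lerD.
Unshelve. all: by end_near. Qed.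

(** Members A_i of the ultrafilter on which the functions are 2^(-i)-close in L^1 are intersected:
    the index [j p] is taken in A_0, ..., A_p, so [j p] and [j p.+1] share A_p and the chosen
    functions form a fast Cauchy sequence. *)
Theorem bv_compact (rho : nat -> E -> R) (b : E -> R) (V : R) :
  (forall k, itg leb Omega (rho k)) -> itg leb Omega b ->
  (forall k, div_variation Omega (rho k) <= V%:E)%E ->
  {ae leb, forall x, Omega x -> forall k, `|rho k x| <= b x} ->
  exists (j : nat -> nat) (r : E -> R), [/\ forall p, (p <= j p)%N, itg leb Omega r &
    {ae leb, forall x, Omega x -> (fun p => rho (j p) x) @ \oo --> r x}].
Proof.
move=> irho ib hV rb; have mO := open_measurable oO.
have [F [UF Foo]] := @ultraFilterLemma nat \oo _.
have FF : ProperFilter F by exact: ultra_proper.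
have e0 i : (0 : R) < 1 / 2 ^+ i by rewrite divr_gt0 ?exprn_gt0.
have [A hA] := choice (fun i => let: ex_intro2 A FA h := bv_ultrafilter_cauchy UF irho ib hV rb (e0 i) in
  ex_intro (fun A => F A /\ forall p q, A p -> A q ->
      \int[leb]_(x in Omega) `|rho p x - rho q x| <= 1 / 2 ^+ i) A (conj FA h)).
(* The ultrafilter refines the neighbourhoods of infinity, so the index can be taken beyond [p].
   Monotonicity of [j] is not claimed. *)
have ex p : exists q, (p <= q)%N /\ forall i, (i <= p)%N -> A i q.
  have h1 : F [set q | forall i, i \in iota 0 p.+1 -> A i q].
    by apply: filter_forall_seq => i _; exact: (hA i).1.
  have h2 : F [set q | (p <= q)%N] by apply: Foo; exact: nbhs_infty_ge.
  have [q [Aq pq]] := filter_ex (filterI h1 h2); exists q; split=> // i ip.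
  by apply: Aq; rewrite mem_iota add0n ltnS.
have [j hj] := choice ex.
have [r [ir rr _]] := @fast_cauchy_lim _ _ R leb Omega mO (fun p => rho (j p)) 1
  (fun p => irho (j p)) (fun p => (hA p).2 _ _ ((hj p.+1).2 p (leqnSn p)) ((hj p).2 p (leqnn p))).
by exists j, r; split=> // p; have [] := hj p.
Qed.

End bv_compactness.

(** * Weak compactness by midpoint hulls *)

Lemma cvg_sqr (R : realType) (u : nat -> R) (l : R) : u @ \oo --> l ->
  u q ^+ 2 @[q --> \oo] --> l ^+ 2.
Proof. by move=> ul; rewrite expr2; under eq_cvg do rewrite expr2; exact: cvgM. Qed.

Section almost_everywhere_limits.
Context d (T : measurableType d) (R : realType) (mu : {measure set T -> \bar R}).
Context (D : set T) (mD : measurable D).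
Implicit Types (f g : T -> R).

Lemma Rintegral_fatou_ae (F : (T -> R)^nat) f c :
  (forall n, itg mu D (F n)) -> (forall n x, D x -> 0 <= F n x) ->
  measurable_fun D f ->
  {ae mu, forall x, D x -> F ^~ x @ \oo --> f x} ->
  (forall n, \int[mu]_(x in D) F n x <= c) ->
  itg mu D f /\ \int[mu]_(x in D) f x <= c.
Proof.
move=> iF F0 mf [N [mN N0 sub]] Fc.
have mDN : measurable (D `\` N) by exact: measurableD.
have [i1 h1] : itg mu (D `\` N) f /\ \int[mu]_(x in D `\` N) f x <= c.
  apply: (@Rintegral_fatou _ _ _ _ _ mDN F).
  - by move=> n; apply: (itgS mD) => //; exact: subDsetl.
  - by move=> n x [Dx _]; exact: F0.
  - by move=> x [Dx Nx]; apply: contrapT => h; apply: Nx; apply: sub => /(_ Dx).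
  - by move=> n; rewrite Rintegral_negligible.
have fi : itg mu D f by apply/(negligible_integrable mN mD _ N0) => //; exact/measurable_EFinP.
by split=> //; rewrite -(Rintegral_negligible mD mN N0).
Qed.

Lemma itg_square_itg f : (mu D < +oo)%E -> square_itg mu D f -> itg mu D f.
Proof.
move=> Doo [mf if2]; have i1 : itg mu D (fun=> 1).
  by apply: (itg_bounded mD (M := 1)) => // x _; rewrite normr1.
apply: (itg_le mD mf _ (itgD mD i1 if2)) => x _.
by rewrite -(real_normK (num_real (f x))); have := normr_ge0 (f x); nra.
Qed.

Lemma square_itg_cst (k : R) : (mu D < +oo)%E -> square_itg mu D (fun=> k).
Proof. by move=> Doo; split=> //; apply: (itg_bounded mD (M := `|k ^+ 2|)). Qed.

Lemma Rintegral_sqrD f g : square_itg mu D f -> square_itg mu D g ->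
  \int[mu]_(x in D) (f x + g x) ^+ 2 <=
  2 * \int[mu]_(x in D) f x ^+ 2 + 2 * \int[mu]_(x in D) g x ^+ 2.
Proof.
move=> hf hg; have [_ hfg] := square_itgD mD hf hg; move: hf hg => [_ hf] [_ hg].
rewrite -!(RintegralZl _ mD)// -(RintegralD mD (itgZ mD 2 hf) (itgZ mD 2 hg)).
apply: le_Rintegral => //; first by apply: (itgD mD); exact: itgZ.
by move=> x _; have := sqr_ge0 (f x - g x); nra.
Qed.

(** On a set of finite measure L^2 increments control L^1 increments, so an almost everywhere limit
    exists by the L^1 result; Fatou's lemma then restores the L^2 rate. *)
Lemma square_fast_cauchy_lim (F : (T -> R)^nat) : (mu D < +oo)%E ->
  (forall n, square_itg mu D (F n)) ->
  (forall n, \int[mu]_(x in D) (F n.+1 x - F n x) ^+ 2 <= 1 / 16 ^+ n) ->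
  exists f, [/\ square_itg mu D f,
    {ae mu, forall x, D x -> F ^~ x @ \oo --> f x} &
    forall n, \int[mu]_(x in D) (f x - F n x) ^+ 2 <= 4 / 16 ^+ n].
Proof.
move=> Doo iF Fc.
have iB n m : square_itg mu D (fun x => F n x - F m x) by exact: square_itgB.
have s1 := square_itg_cst 1 Doo.
pose c : R := 1 + \int[mu]_(x in D) 1.
have [f [if1 Ff _]] : exists f, [/\ itg mu D f,
    {ae mu, forall x, D x -> F ^~ x @ \oo --> f x} &
    forall n, \int[mu]_(x in D) `|f x - F n x| <= 2 * c / 2 ^+ n].
  apply: (fast_cauchy_lim mD) => n; first exact: itg_square_itg.
  (* The weight that balances Young's inequality: the squared increment is at most 16^(-n), so both
     terms are of order 4^(-n). *)
  have t0 : (0 : R) < 4 ^+ n by rewrite exprn_gt0.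
  have := Rintegral_young mD t0 (iB n.+1 n) s1.
  under [X in X <= _ -> _]eq_Rintegral do rewrite mulr1.
  under [X in _ <= (_ + _ * X) / 2 -> _]eq_Rintegral do rewrite expr1n.
  move=> /le_trans; apply.
  have h1 : 4 ^+ n * \int[mu]_(x in D) (F n.+1 x - F n x) ^+ 2 <= (4 ^+ n)^-1.
    rewrite -ler_pdivlMl// (le_trans (Fc n))// div1r -invfM -exprMn.
    by rewrite (_ : 4 * 4 = 16 :> R)//; lra.
  have h2 : (4 ^+ n)^-1 <= (2 ^+ n)^-1 :> R.
    by rewrite lef_pV2 ?posrE ?exprn_gt0// lerXn2r ?nnegrE// ler_nat.
  have h3 : 0 <= \int[mu]_(x in D) 1 by apply: Rintegral_ge0.
  have h4 : 0 <= (4 ^+ n)^-1 :> R by rewrite invr_ge0 ltW.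
  rewrite /c; move: h1 h2 h3 h4; set I := \int[mu]_(x in D) 1; set u := (4 ^+ n)^-1.
  by set v := (2 ^+ n)^-1; nra.
(* The first increment is split off, for all [n] at once. With (a + b)^2 <= 2 a^2 + 2 b^2 the step
   requires 2 (4/16) + 2 <= 4, which the ratio 16 allows. *)
have bnd m : forall n, \int[mu]_(x in D) (F (n + m)%N x - F n x) ^+ 2 <= 4 / 16 ^+ n.
  elim: m => [|m IH] n.
    rewrite addn0 (@eq_Rintegral _ _ _ _ _ (fun=> 0)) ?Rintegral_cst ?mul0r.
    - by rewrite divr_ge0// exprn_ge0.
    - by [].
    - by move=> x _; rewrite subrr expr0n.
  rewrite addnS -addSn (@eq_Rintegral _ _ _ _ _
     (fun x => ((F (n.+1 + m)%N x - F n.+1 x) + (F n.+1 x - F n x)) ^+ 2)); last first.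
    by move=> x _; rewrite addrA subrK.
  apply: (le_trans (Rintegral_sqrD (iB _ _) (iB _ _))).
  have := IH n.+1; have := Fc n; rewrite exprS invfM; set u := (16 ^+ n)^-1.
  have : 0 <= u by rewrite invr_ge0 exprn_ge0.
  by lra.
have mf : measurable_fun D f by exact: itg_meas if1.
have fat n : itg mu D (fun x => (f x - F n x) ^+ 2) /\
    \int[mu]_(x in D) (f x - F n x) ^+ 2 <= 4 / 16 ^+ n.
  apply: (@Rintegral_fatou_ae (fun m x => (F (n + m)%N x - F n x) ^+ 2)).
  - by move=> m; exact: (iB _ _).2.
  - by move=> m x _; exact: sqr_ge0.
  - apply: measurable_funX; apply: measurable_funB => //; exact: (iF n).1.
  - apply: filterS Ff => x h Dx; have {}h := h Dx.
    apply: cvg_sqr; apply: cvgB; last exact: cvg_cst.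
    by move: h; rewrite -(cvg_shiftn n); under eq_fun do rewrite addnC.
  - by move=> m; exact: bnd.
exists f; split=> //; last by move=> n; exact: (fat n).2.
have h : square_itg mu D (fun x => f x - F 0%N x).
  split; last exact: (fat 0%N).1.
  by apply: measurable_funB => //; exact: (iF 0%N).1.
have [_ h2] := square_itgD mD h (iF 0%N).
by split=> //; apply: (eq_itg mD _ h2) => x _; rewrite subrK.
Qed.

End almost_everywhere_limits.

Section midpoint_hull.
Context (R : realType) (X : Type) (mid : X -> X -> X) (x : nat -> X).

(** Midpoints suffice for the parallelogram identity, and a convex property of the tail reaches the
    hull by a two-case induction, without weights of convex combinations. *)
Inductive hull (p : nat) : X -> Prop :=
| hull_mem k : (p <= k)%N -> hull p (x k)
| hull_mid a b : hull p a -> hull p b -> hull p (mid a b).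

Lemma hull_mono p q a : (p <= q)%N -> hull q a -> hull p a.
Proof.
move=> pq; elim=> [k qk|b c _ hb _ hc]; last exact: hull_mid.
by apply: hull_mem; exact: leq_trans pq qk.
Qed.

(* The parallelogram identity makes near minimizers of [q] over the shrinking
   hulls a Cauchy sequence. *)
Lemma hull_cauchy (q : X -> R) (D : X -> X -> R) (C : R) (e : nat -> R) :
  (forall a, hull 0 a -> 0 <= q a) ->
  (forall a b, hull 0 a -> hull 0 b -> 0 <= D a b /\
     q (mid a b) = (q a + q b) / 2 - D a b / 4) ->
  (forall k, q (x k) <= C) -> (forall p, 0 < e p) ->
  (forall p, e p.+1 <= e p) ->
  exists w : nat -> X, (forall p, hull p (w p)) /\
    forall p, D (w p) (w p.+1) <= e p.
Proof.
move=> q0 qD xC e0 ed.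
have h0 p a : hull p a -> hull 0 a by exact: hull_mono.
have hC a : hull 0 a -> q a <= C.
  elim=> [k _//|b c hb IHb hc IHc]; have [] := qD b c hb hc; lra.
pose S p := [set q a | a in hull p].
have Slb p : has_lbound (S p) by exists 0 => _ [a ha <-]; exact/q0/(h0 p).
have Sn p : S p !=set0 by exists (q (x p)); exists (x p) => //; exact: hull_mem.
have infle p a : hull p a -> inf (S p) <= q a.
  by move=> ha; apply: ge_inf => //; exists a.
pose s := sup (range (fun p => inf (S p))).
have Sub : has_ubound (range (fun p => inf (S p))).
  by exists C => _ [p _ <-]; apply: le_trans (infle p _ (hull_mem (leqnn p))) (xC p).
have infs p : inf (S p) <= s by apply: ub_le_sup => //; exists p.
have infmono p p' : (p <= p')%N -> inf (S p) <= inf (S p').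
  move=> pp; apply: lb_le_inf => // _ [a ha <-]; apply: infle.
  exact: hull_mono pp ha.
(* The infima increase with the index to their supremum [s]. Two elements within e/12 above [s],
   whose midpoint is at least s - e/12, satisfy D <= 4 (e/12 + e/12) < e. *)
have ex j : exists pw : nat * X, [/\ (j <= pw.1)%N, s - e j / 12 <= inf (S pw.1),
    hull pw.1 pw.2 & q pw.2 <= s + e j / 12].
  have ej : 0 < e j / 12 by rewrite divr_gt0.
  have [_ [p _ <-] hp] := sup_adherent ej (conj (ex_intro _ _ (ex_intro2 _ _ 0%N I erefl)) Sub).
  have [_ [a ha <-] qa] := inf_adherent ej (conj (Sn (maxn j p)) (Slb (maxn j p))).
  exists (maxn j p, a); split=> //=; first exact: leq_maxl.
    by apply: le_trans (ltW hp) (infmono _ _ (leq_maxr _ _)).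
  by have := infs (maxn j p); lra.
have [pw hpw] := choice ex.
exists (fun j => (pw j).2); split=> j.
  by have [jp _ h _] := hpw j; exact: hull_mono jp h.
have [jp sj hj qj] := hpw j; have [jp' sj' hj' qj'] := hpw j.+1.
have [_] := qD _ _ (h0 _ _ hj) (h0 _ _ hj').
have hmid : s - e j / 12 <= q (mid (pw j).2 (pw j.+1).2).
  (* The midpoint lies in the larger of the two hulls, the one with the smaller index, and is
     bounded below by its infimum. *)
  have [le|/ltnW le] := leqP (pw j).1 (pw j.+1).1.
    by apply: (le_trans sj); apply: infle; apply: hull_mid => //; exact: hull_mono hj'.
  apply: (@le_trans _ _ (inf (S (pw j.+1).1))); last first.
    by apply: infle; apply: hull_mid => //; exact: hull_mono hj.
  by have := ed j; lra.
by have := ed j; have := e0 j; lra.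
Qed.

End midpoint_hull.

Section weak_compactness.
Context d (T : measurableType d) (R : realType) (mu : {measure set T -> \bar R}).
Context (D : set T) (mD : measurable D) (Doo : (mu D < +oo)%E) (I : finType).

Definition mean (a b : T -> R) : T -> R := fun x => (a x + b x) / 2.

Lemma itg_mean (a b : T -> R) : itg mu D a -> itg mu D b -> itg mu D (mean a b).
Proof.
move=> ha hb; apply: (eq_itg mD _ (itgZ mD 2^-1 (itgD mD ha hb))) => x _.
by rewrite mulrC.
Qed.

Lemma square_itg_mean (a b : T -> R) : square_itg mu D a -> square_itg mu D b ->
  square_itg mu D (mean a b).
Proof.
move=> ha hb; have [m i] := square_itgZ mD 2^-1 (square_itgD mD ha hb); split.
  by apply: eq_measurable_fun m => x _; rewrite mulrC.
by apply: (eq_itg mD _ i) => x _; rewrite mulrC.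
Qed.

Lemma Rintegral_sqr_mean (a b c : T -> R) : square_itg mu D a -> square_itg mu D b ->
  square_itg mu D c ->
  \int[mu]_(x in D) (mean a b x - c x) ^+ 2 =
  (\int[mu]_(x in D) (a x - c x) ^+ 2 + \int[mu]_(x in D) (b x - c x) ^+ 2) / 2 -
  (\int[mu]_(x in D) (b x - a x) ^+ 2) / 4.
Proof.
move=> ha hb hc.
have [_ i1] := square_itgB mD ha hc; have [_ i2] := square_itgB mD hb hc.
have [_ i3] := square_itgB mD hb ha.
rewrite (@eq_Rintegral _ _ _ _ _ (fun x => 2^-1 * ((a x - c x) ^+ 2 + (b x - c x) ^+ 2) -
   4^-1 * (b x - a x) ^+ 2)); last by move=> x _; rewrite /mean; lra.
rewrite RintegralB//; [|by apply: (itgZ mD); exact: (itgD mD)|exact: (itgZ mD)].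
rewrite (RintegralZl _ mD (itgD mD i1 i2)) (RintegralD mD i1 i2) (RintegralZl _ mD i3).
by rewrite mulrC [4^-1 * _]mulrC.
Qed.

Lemma Rintegral_dist_mean (a b c e : T -> R) : itg mu D a -> itg mu D b ->
  itg mu D c -> itg mu D e ->
  \int[mu]_(x in D) `|mean a b x - mean c e x| <=
  (\int[mu]_(x in D) `|a x - c x| + \int[mu]_(x in D) `|b x - e x|) / 2.
Proof.
move=> ia ib ic ie.
have i1 := itg_norm (itgB mD ia ic); have i2 := itg_norm (itgB mD ib ie).
rewrite mulrC -(RintegralD mD i1 i2) -(RintegralZl _ mD (itgD mD i1 i2)).
apply: le_Rintegral => //.
- by apply: itg_norm; apply: (itgB mD); exact: itg_mean.
- by apply: (itgZ mD); exact: (itgD mD).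
move=> x _; have := ler_normD (a x - c x) (b x - e x).
rewrite /mean (_ : (a x + b x) / 2 - (c x + e x) / 2 = 2^-1 * (a x - c x + (b x - e x))); last by lra.
by rewrite normrM ger0_norm ?invr_ge0//; lra.
Qed.

Lemma Rintegral_mean_mul (a b c : T -> R) : itg mu D (fun x => a x * c x) ->
  itg mu D (fun x => b x * c x) ->
  \int[mu]_(x in D) (mean a b x * c x) =
  (\int[mu]_(x in D) (a x * c x) + \int[mu]_(x in D) (b x * c x)) / 2.
Proof.
move=> i1 i2; rewrite mulrC -(RintegralD mD i1 i2) -(RintegralZl _ mD (itgD mD i1 i2)).
by apply: eq_Rintegral => x _; rewrite /mean; lra.
Qed.

Lemma Rintegral_mul_cvg0 (u g : nat -> T -> R) (C : R) :
  (forall p, square_itg mu D (u p)) -> (forall p, square_itg mu D (g p)) ->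
  (forall p, \int[mu]_(x in D) g p x ^+ 2 <= C) ->
  \int[mu]_(x in D) u p x ^+ 2 @[p --> \oo] --> 0 ->
  \int[mu]_(x in D) `|u p x * g p x| @[p --> \oo] --> 0.
Proof.
move=> hu hg gC u0; apply/cvgr0Pnorm_lt => e e0.
pose c := `|C| + 1; have c0 : 0 < c by rewrite ltr_wpDl.
(* Chosen so that the bounded factor contributes at most [e] in Young's inequality; the vanishing
   factor is below e/t eventually. *)
pose t := c / e; have t0 : 0 < t by rewrite divr_gt0.
have et0 : 0 < e / t by rewrite divr_gt0.
have : \forall p \near \oo, \int[mu]_(x in D) u p x ^+ 2 < e / t by exact: (cvgr_lt _ u0 _ et0).
apply: filterS => p up.
have I0 : 0 <= \int[mu]_(x in D) `|u p x * g p x| by apply: Rintegral_ge0.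
rewrite ger0_norm//; apply: (le_lt_trans (Rintegral_young mD t0 (hu p) (hg p))).
have h1 : t * \int[mu]_(x in D) u p x ^+ 2 < e by rewrite mulrC -ltr_pdivlMr.
have h2 : t^-1 * \int[mu]_(x in D) g p x ^+ 2 <= e.
  rewrite /t invf_div mulrAC ler_pdivrMr// ler_pM2l// (le_trans (gC p))//.
  by rewrite /c (le_trans (ler_norm C))// lerDl.
by lra.
Qed.

(** The pair (y, g) lies in the L^1 closure of [Phi]. With the test functions and their partial
    derivatives as [Phi], this is membership of [y] in W^{1,1}(Omega; Gamma_D) together with the
    information that [g] is its gradient. *)
Definition approx (Phi : set ((T -> R) * (I -> T -> R))) (y : T -> R)
    (g : I -> T -> R) :=
  forall eps : R, 0 < eps -> exists2 f, Phi f &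
    \int[mu]_(x in D) `|y x - f.1 x| +
    \sum_i \int[mu]_(x in D) `|g i x - f.2 i x| < eps.

(** A function, its gradient and the weighted gradient, kept together so that one choice of
    midpoints acts on all three. *)
Definition state : Type := ((T -> R) * (I -> T -> R) * (I -> T -> R))%type.

Definition mid (a b : state) : state := (mean a.1.1 b.1.1,
  fun i => mean (a.1.2 i) (b.1.2 i), fun i => mean (a.2 i) (b.2 i)).

(** The centre [c] is 0 when the approximating sequence is selected, and the desired state when the
    cost is bounded; the defect in the parallelogram identity is [dist2] in both cases. *)
Definition energy (c : T -> R) (a : state) : R :=
  \int[mu]_(x in D) (a.1.1 x - c x) ^+ 2 +
  \sum_i \int[mu]_(x in D) (a.2 i x) ^+ 2.

Definition dist2 (a b : state) : R :=
  \int[mu]_(x in D) (b.1.1 x - a.1.1 x) ^+ 2 +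
  \sum_i \int[mu]_(x in D) (b.2 i x - a.2 i x) ^+ 2.

Lemma energy_mid c (a b : state) : square_itg mu D c ->
  square_itg mu D a.1.1 -> square_itg mu D b.1.1 ->
  (forall i, square_itg mu D (a.2 i)) -> (forall i, square_itg mu D (b.2 i)) ->
  energy c (mid a b) = (energy c a + energy c b) / 2 - dist2 a b / 4.
Proof.
move=> hc ha hb va vb; rewrite /energy /dist2 Rintegral_sqr_mean//.
have s0 := square_itg_cst mD 0 Doo.
have sub0 (f : T -> R) : \int[mu]_(x in D) (f x - 0) ^+ 2 = \int[mu]_(x in D) f x ^+ 2.
  by apply: eq_Rintegral => x _; rewrite subr0.
rewrite (eq_bigr (fun i => 2^-1 * \int[mu]_(x in D) (a.2 i x) ^+ 2 +
   2^-1 * \int[mu]_(x in D) (b.2 i x) ^+ 2 -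
   4^-1 * \int[mu]_(x in D) (b.2 i x - a.2 i x) ^+ 2)); last first.
  by move=> i _; have := Rintegral_sqr_mean (va i) (vb i) s0; rewrite !sub0 => ->; lra.
by rewrite sumrB big_split/= -!mulr_sumr; lra.
Qed.

Lemma cvg0D (u v : nat -> R) : u p @[p --> \oo] --> 0 -> v p @[p --> \oo] --> 0 ->
  u p + v p @[p --> \oo] --> 0.
Proof. by move=> u0 v0; rewrite -[in X in _ --> X](addr0 0); exact: cvgD u0 v0. Qed.

Lemma cvg0_sum (u : I -> nat -> R) : (forall i, u i p @[p --> \oo] --> 0) ->
  \sum_i u i p @[p --> \oo] --> 0.
Proof.
move=> h; elim: (index_enum I) => [|i s IH].
  by under eq_fun do rewrite big_nil; exact: cvg_cst.
by under eq_fun do rewrite big_cons; exact: cvg0D (h i) IH.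
Qed.

(* [h] stands for rho^(-1/2) and [v k] for rho_k^(1/2) times the gradient [g k];
   the limit gradient is recovered as [h] times the limit of the [v k]. *)
Theorem weak_limit (Phi : set ((T -> R) * (I -> T -> R))) (h : T -> R)
    (y : nat -> T -> R) (g v : nat -> I -> T -> R) (C : R) :
  (forall f, Phi f -> itg mu D f.1 /\ forall i, itg mu D (f.2 i)) ->
  (forall f f', Phi f -> Phi f' ->
     Phi (mean f.1 f'.1, fun i => mean (f.2 i) (f'.2 i))) ->
  square_itg mu D h -> (forall k, square_itg mu D (y k)) ->
  (forall k i, square_itg mu D (v k i)) -> (forall k i, itg mu D (g k i)) ->
  (forall k, approx Phi (y k) (g k)) ->
  (forall k, \int[mu]_(x in D) y k x ^+ 2 +
     \sum_i \int[mu]_(x in D) v k i x ^+ 2 <= C) ->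
  (forall i, \int[mu]_(x in D) `|g k i x - h x * v k i x| @[k --> \oo] --> 0) ->
  exists (z : T -> R) (w : I -> T -> R),
    [/\ square_itg mu D z, forall i, square_itg mu D (w i),
        approx Phi z (fun i x => h x * w i x),
        forall (psi0 : T -> R) (psi : I -> T -> R) (c : R),
          square_itg mu D psi0 -> (forall i, square_itg mu D (psi i)) ->
          \int[mu]_(x in D) (y k x * psi0 x) +
            \sum_i \int[mu]_(x in D) (v k i x * psi i x) @[k --> \oo] --> c ->
          \int[mu]_(x in D) (z x * psi0 x) +
            \sum_i \int[mu]_(x in D) (w i x * psi i x) = c &
        forall (yd : T -> R) (p : nat) (c : R), square_itg mu D yd ->
          (forall k, (p <= k)%N -> \int[mu]_(x in D) (y k x - yd x) ^+ 2 +
            \sum_i \int[mu]_(x in D) v k i x ^+ 2 <= c) ->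
          \int[mu]_(x in D) (z x - yd x) ^+ 2 +
            \sum_i \int[mu]_(x in D) w i x ^+ 2 <= c].
Proof.
move=> Phii Phim hh hy hv ig ya yC gv.
pose x k : state := (y k, g k, v k).
pose good (a : state) := [/\ square_itg mu D a.1.1, forall i, itg mu D (a.1.2 i),
  forall i, square_itg mu D (a.2 i) & approx Phi a.1.1 a.1.2].
have sq_itg := itg_square_itg mD Doo.
have good_hull p a : hull mid x p a -> good a.
  elim=> [k _|b c _ [b1 b2 b3 b4] _ [c1 c2 c3 c4]]; first by split => //=.
  split=> /= [|i|i|]; [exact: square_itg_mean|exact: itg_mean|exact: square_itg_mean|].
  move=> e e0; have [f Ff fe] := b4 e e0; have [f' Ff' fe'] := c4 e e0.
  have [if1 if2] := Phii _ Ff; have [if1' if2'] := Phii _ Ff'.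
  exists (mean f.1 f'.1, fun i => mean (f.2 i) (f'.2 i)); first exact: Phim.
  have h1 := Rintegral_dist_mean (sq_itg _ b1) (sq_itg _ c1) if1 if1'.
  have h2 : \sum_i \int[mu]_(x in D) `|mean (b.1.2 i) (c.1.2 i) x - mean (f.2 i) (f'.2 i) x| <=
     2^-1 * (\sum_i \int[mu]_(x in D) `|b.1.2 i x - f.2 i x| +
             \sum_i \int[mu]_(x in D) `|c.1.2 i x - f'.2 i x|).
    rewrite -big_split/= mulr_sumr; apply: ler_sum => i _.
    by rewrite mulrC; exact: Rintegral_dist_mean.
  by move: fe fe' h1 h2; lra.
have s0 := square_itg_cst mD 0 Doo.
have dist0 a b : 0 <= dist2 a b.
  by apply: addr_ge0; [|apply: sumr_ge0 => i _]; apply: Rintegral_ge0 => z _; exact: sqr_ge0.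
have JD c p a b : square_itg mu D c -> hull mid x p a -> hull mid x p b ->
    energy c (mid a b) = (energy c a + energy c b) / 2 - dist2 a b / 4.
  by move=> hc /good_hull[? ? ? ?] /good_hull[? ? ? ?]; exact: energy_mid.
(* The tolerance 16^(-p) is the one required for an L^2 limit with almost everywhere convergence. *)
have [|||||W [hW WD]] := @hull_cauchy R state mid x (energy (fun=> 0)) dist2 C (fun p => 1 / 16 ^+ p).
- move=> a _; apply: addr_ge0; [|apply: sumr_ge0 => i _].
    by apply: Rintegral_ge0 => z _; exact: sqr_ge0.
  by apply: Rintegral_ge0 => z _; exact: sqr_ge0.
- by move=> a b ha hb; split=> //; exact: JD ha hb.
- move=> k; apply: le_trans (yC k); rewrite /energy/=.
  by rewrite lerD2r; under eq_Rintegral do rewrite subr0.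
- by move=> p; rewrite divr_gt0// exprn_gt0.
- move=> p; rewrite !div1r lef_pV2 ?posrE ?exprn_gt0// ler_eXn2l//.
  by rewrite ltr1n.
have gW p : good (W p) by exact: good_hull (hW p).
have sY p : square_itg mu D (W p).1.1 by have [] := gW p.
have sV i p : square_itg mu D ((W p).2 i) by have [_ _ ] := gW p.
have iG i p : itg mu D ((W p).1.2 i) by have [] := gW p.
have sum0 p : 0 <= \sum_i \int[mu]_(x in D) ((W p.+1).2 i x - (W p).2 i x) ^+ 2.
  by apply: sumr_ge0 => i _; apply: Rintegral_ge0 => z _; exact: sqr_ge0.
have [z [sz zY zc]] : exists z, [/\ square_itg mu D z,
    {ae mu, forall x, D x -> (fun p => (W p).1.1 x) @ \oo --> z x} &
    forall p, \int[mu]_(x in D) (z x - (W p).1.1 x) ^+ 2 <= 4 / 16 ^+ p].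
  apply: (square_fast_cauchy_lim mD Doo) => // p.
  by apply: le_trans (WD p); rewrite lerDl.
have exw i : exists w, [/\ square_itg mu D w,
    {ae mu, forall x, D x -> (fun p => (W p).2 i x) @ \oo --> w x} &
    forall p, \int[mu]_(x in D) (w x - (W p).2 i x) ^+ 2 <= 4 / 16 ^+ p].
  apply: (square_fast_cauchy_lim mD Doo) => // p.
  apply: le_trans (WD p); rewrite /dist2 (bigD1 i)//= addrCA lerDl addr_ge0//.
    by apply: Rintegral_ge0 => t _; exact: sqr_ge0.
  by apply: sumr_ge0 => j _; apply: Rintegral_ge0 => t _; exact: sqr_ge0.
have [w hw] := choice exw.
have sw i : square_itg mu D (w i) by have [] := hw i.
have wV i : {ae mu, forall x, D x -> (fun p => (W p).2 i x) @ \oo --> w i x} by have [] := hw i.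
have cvg16 (u : nat -> R) : (forall p, 0 <= u p <= 4 / 16 ^+ p) -> u p @[p --> \oo] --> 0.
  move=> u0; apply: (@squeeze_cvgr _ _ _ _ (fun=> 0) (geometric 4 16^-1)).
  - by apply: nearW => p; rewrite /= exprVn; exact: u0.
  - exact: cvg_cst.
  - by apply: cvg_geometric; rewrite ger0_norm// invf_lt1// ltr1n.
have z0 : \int[mu]_(x in D) (z x - (W p).1.1 x) ^+ 2 @[p --> \oo] --> 0.
  by apply: cvg16 => p; rewrite zc andbT; apply: Rintegral_ge0 => t _; exact: sqr_ge0.
have w0 i : \int[mu]_(x in D) (w i x - (W p).2 i x) ^+ 2 @[p --> \oo] --> 0.
  apply: cvg16 => p; have [_ _ ->] := hw i; rewrite andbT.
  by apply: Rintegral_ge0 => t _; exact: sqr_ge0.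
have mulz psi : square_itg mu D psi ->
    \int[mu]_(x in D) `|(z x - (W p).1.1 x) * psi x| @[p --> \oo] --> 0.
  move=> hpsi; apply: (@Rintegral_mul_cvg0 (fun p x => z x - (W p).1.1 x) (fun=> psi)) => //.
  by move=> p; exact: square_itgB.
have mulw i psi : square_itg mu D psi ->
    \int[mu]_(x in D) `|(w i x - (W p).2 i x) * psi x| @[p --> \oo] --> 0.
  move=> hpsi; apply: (@Rintegral_mul_cvg0 (fun p x => w i x - (W p).2 i x) (fun=> psi)) => //.
  by move=> p; exact: square_itgB.
have iw i : itg mu D (fun x => h x * w i x) by exact: square_itgM.
have iV p i : itg mu D (fun x => h x * (W p).2 i x) by exact: square_itgM.
(* With [h] independent of the index, the relation g = h v is linear; its L^1 defect is a convex
   function of the state, so a bound on the tail holds on the hull. *)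
have Gh i : \int[mu]_(x in D) `|(W p).1.2 i x - h x * (W p).2 i x| @[p --> \oo] --> 0.
  apply/cvgr0Pnorm_le => e e0.
  have [K _ HK] : \forall k \near \oo, \int[mu]_(x in D) `|g k i x - h x * v k i x| <= e.
    exact: (cvgr_le _ (gv i) _ e0).
  exists K => // p /= Kp; rewrite ger0_norm; last by apply: Rintegral_ge0.
  elim: (hW p) => [k pk|b c hb IHb hc IHc]; first by apply: HK; exact: leq_trans Kp pk.
  have [_ b2 b3 _] := good_hull _ _ hb; have [_ c2 c3 _] := good_hull _ _ hc.
  have := Rintegral_dist_mean (b2 i) (c2 i) (square_itgM mD hh (b3 i)) (square_itgM mD hh (c3 i)).
  rewrite [X in X <= _ -> _](@eq_Rintegral _ _ _ _ _
     (fun x => `|mean (b.1.2 i) (c.1.2 i) x - h x * mean (b.2 i) (c.2 i) x|)).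
    by move=> /le_trans; apply; move: IHb IHc; rewrite /=; lra.
  by move=> x0 _; rewrite /mean; congr (`| _ - _ |); lra.
exists z, w; split=> //.
- move=> e e0.
  have : \int[mu]_(x in D) `|(z x - (W p).1.1 x) * 1| + \sum_i (
      \int[mu]_(x in D) `|(w i x - (W p).2 i x) * h x| +
      \int[mu]_(x in D) `|(W p).1.2 i x - h x * (W p).2 i x|) @[p --> \oo] --> 0.
    apply: cvg0D; first exact/mulz/square_itg_cst.
    apply: cvg0_sum => i; apply: cvg0D => //.
    exact: mulw.
  have e2 : 0 < e / 2 by rewrite divr_gt0.
  move=> /cvgr_lt /(_ _ e2) [p _ /(_ p (leqnn p)) /= hp].
  have [_ _ _ Wa] := gW p; have [f Ff fe] := Wa _ e2; have [if1 if2] := Phii _ Ff.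
  exists f => //.
  have h1 : \int[mu]_(x in D) `|z x - f.1 x| <= \int[mu]_(x in D) `|(z x - (W p).1.1 x) * 1| +
      \int[mu]_(x in D) `|(W p).1.1 x - f.1 x|.
    have i1 := itg_norm (itgB mD (sq_itg _ sz) (sq_itg _ (sY p))).
    have i2 := itg_norm (itgB mD (sq_itg _ (sY p)) if1).
    have i3 := itg_norm (itgB mD (sq_itg _ sz) if1).
    under [X in _ <= X + _]eq_Rintegral do rewrite mulr1.
    rewrite -(RintegralD mD i1 i2); apply: le_Rintegral => //; first exact: (itgD mD).
    by move=> x0 _; exact: ler_distD.
  have h2 : \sum_i \int[mu]_(x in D) `|h x * w i x - f.2 i x| <= \sum_i (
      \int[mu]_(x in D) `|(w i x - (W p).2 i x) * h x| +
      \int[mu]_(x in D) `|(W p).1.2 i x - h x * (W p).2 i x|) +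
      \sum_i \int[mu]_(x in D) `|(W p).1.2 i x - f.2 i x|.
    rewrite -big_split/=; apply: ler_sum => i _.
    have i1 := itg_norm (square_itgM mD (square_itgB mD (sw i) (sV i p)) hh).
    have i2 := itg_norm (itgB mD (iG i p) (iV p i)).
    have i3 := itg_norm (itgB mD (iG i p) (if2 i)).
    rewrite -(RintegralD mD i1 i2) -(RintegralD mD (itgD mD i1 i2) i3).
    apply: le_Rintegral => //.
    - by apply: itg_norm; exact: (itgB mD).
    - by apply: (itgD mD) => //; exact: (itgD mD).
    move=> x0 _.
    have -> : h x0 * w i x0 - f.2 i x0 = (w i x0 - (W p).2 i x0) * h x0 -
       ((W p).1.2 i x0 - h x0 * (W p).2 i x0) + ((W p).1.2 i x0 - f.2 i x0) by lra.
    apply: (le_trans (ler_normD _ _)); rewrite lerD2r.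
    exact: ler_normB.
  by move: h1 h2 hp fe; rewrite /=; lra.
- move=> psi0 psi c hp0 hp Lc.
  pose L (a : state) := \int[mu]_(x in D) (a.1.1 x * psi0 x) +
     \sum_i \int[mu]_(x in D) (a.2 i x * psi i x).
  (* [L] is linear in the state, so the convex condition |c - L| <= e passes from the tail to the
     hull. *)
  have L1 : L (W p) @[p --> \oo] --> c.
    apply/cvgrPdist_le => e e0.
    have [K _ HK] : \forall k \near \oo, `|c - L (x k)| <= e.
      by move/cvgrPdist_le : Lc; exact.
    exists K => // p /= Kp; elim: (hW p) => [k pk|a b ha IHa hb IHb].
      by apply: HK; exact: leq_trans Kp pk.
    have [a1 _ a3 _] := good_hull _ _ ha; have [b1 _ b3 _] := good_hull _ _ hb.
    have -> : L (mid a b) = (L a + L b) / 2.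
      rewrite /L /= Rintegral_mean_mul; [|exact: square_itgM..].
      rewrite (eq_bigr (fun i => 2^-1 * \int[mu]_(x in D) (a.2 i x * psi i x) +
         2^-1 * \int[mu]_(x in D) (b.2 i x * psi i x))).
        by rewrite big_split/= -!mulr_sumr; lra.
      move=> i _; rewrite Rintegral_mean_mul; [|exact: square_itgM..].
      by lra.
    by move: IHa IHb; rewrite !ler_norml; lra.
  have L2 : L (W p) @[p --> \oo] --> \int[mu]_(x in D) (z x * psi0 x) +
            \sum_i \int[mu]_(x in D) (w i x * psi i x).
    have : \int[mu]_(x in D) `|(z x - (W p).1.1 x) * psi0 x| + \sum_i
        \int[mu]_(x in D) `|(w i x - (W p).2 i x) * psi i x| @[p --> \oo] --> 0.
      apply: cvg0D; first exact: mulz.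
      by apply: cvg0_sum => i; exact: mulw.
    move=> /cvgr0Pnorm_le h0; apply/cvgrPdist_le => e e0.
    apply: filterS (h0 e e0) => p; apply: le_trans.
    have gen (s t : T -> R) (q : T -> R) : square_itg mu D s -> square_itg mu D t ->
        square_itg mu D q ->
        `|\int[mu]_(x in D) (s x * q x) - \int[mu]_(x in D) (t x * q x)| <=
        \int[mu]_(x in D) `|(s x - t x) * q x|.
      move=> hs ht hq; have i1 := square_itgM mD hs hq; have i2 := square_itgM mD ht hq.
      have i3 := square_itgM mD (square_itgB mD hs ht) hq.
      rewrite -(RintegralB mD i1 i2); apply: le_trans (le_normr_Rintegral mD i3).
      by rewrite (@eq_Rintegral _ _ _ _ _ (fun x => (s x - t x) * q x))// => x0 _; rewrite mulrBl.
    rewrite opprD addrACA -sumrB [leRHS]ger0_norm.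
      apply: (le_trans (ler_normD _ _)); apply: lerD; first exact: gen.
      by apply: (le_trans (ler_norm_sum _ _ _)); apply: ler_sum => i _; exact: gen.
    by apply: addr_ge0; [|apply: sumr_ge0 => i _]; apply: Rintegral_ge0.
  by have := cvg_unique _ L2 L1; apply.
- move=> yd p c hyd hc.
  (* Sublevel sets of the energy are stable under midpoints, whatever the centre; Fatou's lemma then
     handles the limit. *)
  have EW q : (p <= q)%N -> energy yd (W q) <= c.
    move=> pq; elim: (hW q) => [k qk|a b ha IHa hb IHb]; first by apply: hc; exact: leq_trans qk.
    by rewrite (JD _ _ _ _ hyd ha hb); have := dist0 a b; lra.
  have ms q : itg mu D (fun x => ((W q).1.1 x - yd x) ^+ 2 + \sum_i (W q).2 i x ^+ 2).
    apply: (itgD mD); first exact: (square_itgB mD _ hyd).2.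
    by apply: (itg_sum mD) => i; exact: (sV i q).2.
  have mz : itg mu D (fun x => (z x - yd x) ^+ 2) by exact: (square_itgB mD _ hyd).2.
  have mw : itg mu D (fun x => \sum_i w i x ^+ 2).
    by apply: (itg_sum mD) => i; exact: (sw i).2.
  have [] := @Rintegral_fatou_ae _ _ _ mu D mD
    (fun q x => ((W (q + p)%N).1.1 x - yd x) ^+ 2 + \sum_i (W (q + p)%N).2 i x ^+ 2)
    (fun x => (z x - yd x) ^+ 2 + \sum_i w i x ^+ 2) c.
  - by move=> q; exact: ms.
  - by move=> q x0 _; rewrite addr_ge0 ?sqr_ge0 ?sumr_ge0// => i _; exact: sqr_ge0.
  - exact: (itg_meas (itgD mD mz mw)).
  - have wVs : {ae mu, forall x i, D x -> (fun q => (W q).2 i x) @ \oo --> w i x}.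
      by apply: filter_forall => i; exact: wV.
    apply: filterS2 zY wVs => x0 h1 h2 Dx.
    have shift (u : nat -> R) (l : R) : u @ \oo --> l -> u (q + p)%N @[q --> \oo] --> l.
      by rewrite -(cvg_shiftn p).
    apply: cvgD.
      apply: cvg_sqr; apply: cvgB; last exact: cvg_cst.
      by apply: (shift (fun q => (W q).1.1 x0)); exact: h1.
    apply: cvg_big => [|i _]; first exact: add_continuous.
    by apply: cvg_sqr; apply: (shift (fun q => (W q).2 i x0)); exact: h2.
  - move=> q; rewrite (RintegralD mD (square_itgB mD (sY _) hyd).2); last first.
      by apply: (itg_sum mD) => i; exact: (sV i _).2.
    rewrite (Rintegral_sum mD _ (fun i => (sV i _).2)).
    by apply: EW; exact: leq_addl.
  by move=> _; rewrite (RintegralD mD mz mw) (Rintegral_sum mD _ (fun i => (sw i).2)).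
Qed.

End weak_compactness.

(** * Functions vanishing on a part of the boundary *)

Section vanishing_trace.
Context {R : realType} {n : nat}.
Local Notation E := 'rV[R]_n.+1.
Local Notation leb := (@leb_rV R n.+1).
Context (Omega GammaD : set E) (oO : open Omega) (bO : bounded_set Omega).

Let mO : measurable Omega := open_measurable oO.

Lemma leb_open_bounded_fin : (leb Omega < +oo)%E.
Proof. exact: leb_bounded_fin mO bO. Qed.

Let Ooo := leb_open_bounded_fin.

Lemma partial_lin (a b : R) (phi psi : E -> R) i : Ck 1 phi -> Ck 1 psi ->
  partial i (fun x => a * phi x + b * psi x) =
  (fun x => a * partial i phi x + b * partial i psi x).
Proof.
move=> c1 c2; apply/funext => x; rewrite partialD; [|exact: CkZ..].
by rewrite !partialZ.
Qed.

Lemma Coo0_vanishing_lin (a b : R) (phi psi : E -> R) :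
  Coo0_vanishing GammaD phi -> Coo0_vanishing GammaD psi ->
  Coo0_vanishing GammaD (fun x => a * phi x + b * psi x).
Proof.
move=> [[k1 c1 _] g1] [[k2 c2 _] g2]; split.
  split=> // [k|]; first by apply: CkD; exact: CkZ.
  apply: (subclosed_compact _ (compactU c1 c2)); first exact: tsupport_closed.
  apply: tsupport_sub; first by apply: closedU; exact: tsupport_closed.
  move=> x; apply: contraNP => /not_orP[h1 h2].
  have -> : phi x = 0 by apply: contrapT => /eqP/tsupportP.
  have -> : psi x = 0 by apply: contrapT => /eqP/tsupportP.
  by rewrite !mulr0 addr0.
by move=> x Gx; rewrite g1// g2// !mulr0 addr0.
Qed.

Lemma Coo0_vanishing0 : Coo0_vanishing GammaD (fun=> 0).
Proof.
split=> //; split=> // [k|]; first exact: Ck_cst.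
have -> : tsupport (fun=> 0 : R) = set0 :> set E.
  rewrite -subset0; apply: tsupport_sub; first exact: closed0.
  by move=> x; rewrite eqxx.
exact: compact0.
Qed.

Definition tests : set ((E -> R) * ('I_n.+1 -> E -> R)) :=
  [set p | Coo0_vanishing GammaD p.1 /\ p.2 = fun i => partial i p.1].

Lemma tests_mean p q : tests p -> tests q ->
  tests (mean p.1 q.1, fun i => mean (p.2 i) (q.2 i)).
Proof.
move=> [p1 p2] [q1 q2].
have meanE (a b : E -> R) : mean a b = (fun x => 2^-1 * a x + 2^-1 * b x).
  by apply/funext => x; rewrite /mean mulrDl mulrC [b x * _]mulrC.
split=> /=; rewrite meanE; first exact: Coo0_vanishing_lin.
apply/funext => i; rewrite meanE p2 q2 partial_lin//; first by have [[/(_ 1%N)]] := p1.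
by have [[/(_ 1%N)]] := q1.
Qed.

Lemma itg_tests p : tests p ->
  itg leb Omega p.1 /\ forall i, itg leb Omega (p.2 i).
Proof.
move=> [[hp _] ->]; have [C C0 hC] := Coo0_bounds hp.
have [c1 c2] := Coo0_continuous hp; split=> [|i].
  by apply: (itg_bounded_continuous mO Ooo c1) => x; exact: (hC x).1.
by apply: (itg_bounded_continuous mO Ooo (c2 i)) => x; exact: (hC x).2.
Qed.

(** For test functions the defining identity is integration by parts, and against a fixed [psi] both
    of its sides are continuous in L^1. *)
Lemma approx_weak_grad y (g : 'I_n.+1 -> E -> R) : itg leb Omega y ->
  (forall i, itg leb Omega (g i)) -> approx leb Omega tests y g ->
  weak_grad_spec Omega y (fun x => \row_i g i x).
Proof.
move=> iy ig ya; split=> [i|psi hpsi i].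
  by apply: (eq_itg mO _ (ig i)) => x _; rewrite mxE.
rewrite [X in _ = - X](@eq_Rintegral _ _ _ _ _ (fun x => g i x * psi x)); last by move=> x _; rewrite mxE.
have [C C0 hC] := Coo0_bounds hpsi.
have [i1 i2] := itg_test_mul oO iy hpsi; have [i3 _] := itg_test_mul oO (ig i) hpsi.
apply/eqP; rewrite -subr_eq0 opprK -normr_le0; apply/ler_addgt0Pl => e e0.
rewrite addr0.
have e' : 0 < e / (C + 1) by rewrite divr_gt0// ltr_wpDl.
have [[phi dphi] [/= hphi dE] he] := ya _ e'; rewrite /= dE in he.
have [iphi [_ wphi]] := weak_grad_test oO bO hphi.1.
have [iphi1 iphi2] := @itg_tests (phi, dphi) (conj hphi dE); rewrite /= dE in iphi2.
have [j1 j2] := itg_test_mul oO iphi hpsi; have [j3 _] := itg_test_mul oO (iphi2 i) hpsi.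
have := wphi psi hpsi i.
rewrite [X in _ = - X](@eq_Rintegral _ _ _ _ _ (fun x => partial i phi x * psi x)); last first.
  by move=> x _; rewrite mxE.
move=> /eqP; rewrite -subr_eq0 opprK => /eqP wE.
have -> : \int[leb]_(x in Omega) (y x * partial i psi x) + \int[leb]_(x in Omega) (g i x * psi x) =
   \int[leb]_(x in Omega) ((y x - phi x) * partial i psi x) +
   \int[leb]_(x in Omega) ((g i x - partial i phi x) * psi x).
  rewrite -[LHS]subr0 -wE.
  rewrite (@eq_Rintegral _ _ _ _ _ (fun x => y x * partial i psi x - phi x * partial i psi x)
     (fun x => (y x - phi x) * _)); last by move=> x _; rewrite mulrBl.
  rewrite (@eq_Rintegral _ _ _ _ _ (fun x => g i x * psi x - partial i phi x * psi x)
     (fun x => (g i x - partial i phi x) * _)); last by move=> x _; rewrite mulrBl.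
  rewrite (RintegralB mO (i2 i) (j2 i)) (RintegralB mO i3 j3).
  by lra.
have gen (u w : E -> R) : itg leb Omega u -> itg leb Omega (fun x => u x * w x) ->
    (forall x, `|w x| <= C) ->
    `|\int[leb]_(x in Omega) (u x * w x)| <= C * \int[leb]_(x in Omega) `|u x|.
  move=> iu iuw wC; have iu' := itg_norm iu; rewrite -(RintegralZl _ mO iu').
  apply: (le_Rintegral_norm mO iuw (itgZ mO C iu')) => x _.
  by rewrite normrM mulrC ler_wpM2r.
apply: (le_trans (ler_normD _ _)).
have h1 := gen _ (partial i psi) (itgB mO iy iphi) ((itg_test_mul oO (itgB mO iy iphi) hpsi).2 i) (fun x => (hC x).2 i).
have h2 := gen _ psi (itgB mO (ig i) (iphi2 i)) (itg_test_mul oO (itgB mO (ig i) (iphi2 i)) hpsi).1 (fun x => (hC x).1).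
have h3 : \int[leb]_(x in Omega) `|g i x - partial i phi x| <=
    \sum_i \int[leb]_(x in Omega) `|g i x - partial i phi x|.
  by rewrite [leRHS](bigD1 i)//= lerDl sumr_ge0// => j _; exact: Rintegral_ge0.
have : C * (e / (C + 1)) <= e.
  rewrite mulrCA ler_piMr ?(ltW e0)// ler_pdivrMr ?mul1r ?lerDl//.
  by rewrite ltr_wpDl.
apply: le_trans; apply: (le_trans (lerD h1 h2)); rewrite -mulrDr.
by apply: ler_wpM2l => //; apply: le_trans (ltW he); exact: lerD.
Qed.

Lemma weak_grad_specP y g : itg leb Omega y -> weak_grad_spec Omega y g ->
  weak_grad_spec Omega y (weak_grad Omega y).
Proof.
move=> iy /(is_weak_gradP oO _ iy) gy; apply/(is_weak_gradP oO _ iy).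
by apply: (@xgetPex _ (fun=> 0) [set g | is_weak_grad Omega y g]); exists g.
Qed.

Lemma enorm_ge0 (v : E) : 0 <= enorm v.
Proof. exact: sqrtr_ge0. Qed.

Lemma dotv_ge0 (v : E) : 0 <= dotv v v.
Proof. by apply: sumr_ge0 => i _; rewrite -expr2 sqr_ge0. Qed.

Lemma enorm_sqr (v : E) : enorm v ^+ 2 = \sum_i v ord0 i ^+ 2.
Proof. by rewrite sqr_sqrtr ?dotv_ge0//; apply: eq_bigr => i _; rewrite expr2. Qed.

Lemma coord_le_enorm (v : E) i : `|v ord0 i| <= enorm v.
Proof.
rewrite -(@ler_pXn2r _ 2) ?nnegrE ?enorm_ge0// real_normK ?num_real// enorm_sqr.
by rewrite (bigD1 i)//= lerDl sumr_ge0// => j _; exact: sqr_ge0.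
Qed.

Lemma enorm_le_sum (v : E) : enorm v <= \sum_i `|v ord0 i|.
Proof.
have S0 : 0 <= \sum_i `|v ord0 i| by exact: sumr_ge0.
rewrite -(@ler_pXn2r _ 2) ?nnegrE ?enorm_ge0// enorm_sqr.
rewrite [leRHS]expr2 mulr_suml; apply: ler_sum => i _.
rewrite -(real_normK (num_real _)) expr2; apply: ler_wpM2l => //.
by rewrite (bigD1 i)//= lerDl sumr_ge0.
Qed.

Lemma itg_enorm (g : E -> E) : (forall i, itg leb Omega (fun x => g x ord0 i)) ->
  itg leb Omega (fun x => enorm (g x)).
Proof.
move=> ig; apply: (itg_le mO (g := fun x => \sum_i `|g x ord0 i|)).
- apply: (measurableT_comp (f := @Num.sqrt R)).
    by apply: continuous_measurable_fun; exact: sqrt_continuous.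
  apply: (measurable_sum) => i; apply: measurable_funM; exact: itg_meas (ig i).
- by move=> x _; rewrite ger0_norm ?enorm_ge0// enorm_le_sum.
- by apply: (itg_sum mO) => i; apply: itg_norm.
Qed.

(** The norm is defined through a chosen representative; uniqueness up to null sets allows any weak
    gradient in its place. *)
Lemma W11normE y g : itg leb Omega y -> weak_grad_spec Omega y g ->
  W11norm Omega y =
  (\int[leb]_(x in Omega) `|y x| + \int[leb]_(x in Omega) enorm (g x))%:E.
Proof.
move=> iy gy; have wy := weak_grad_specP iy gy.
rewrite EFinD (EFin_Rintegral mO (itg_norm iy)) (EFin_Rintegral mO (itg_enorm gy.1)).
congr (_ + _)%E; apply: ae_eq_integral => //.
- by have /integrableP[] := itg_enorm wy.1.
- by have /integrableP[] := itg_enorm gy.1.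
by apply: filterS (weak_grad_unique oO bO wy gy) => x h Ox; rewrite h.
Qed.

Lemma weak_grad_specB y phi g : itg leb Omega y -> weak_grad_spec Omega y g ->
  Coo0 setT phi -> weak_grad_spec Omega (y \- phi) (fun x => g x - grad phi x).
Proof.
move=> iy [ig hg] hphi; have [iphi [ig' hg']] := weak_grad_test oO bO hphi.
split=> [i|psi hpsi i].
  by apply: (eq_itg mO _ (itgB mO (ig i) (ig' i))) => x _; rewrite !mxE.
have [i1 i2] := itg_test_mul oO iy hpsi; have [i3 i4] := itg_test_mul oO iphi hpsi.
have [i5 _] := itg_test_mul oO (ig i) hpsi; have [i6 _] := itg_test_mul oO (ig' i) hpsi.
rewrite (@eq_Rintegral _ _ _ _ _ (fun x => y x * partial i psi x - phi x * partial i psi x)); last first.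
  by move=> x _; rewrite /= mulrBl.
rewrite [X in _ = - X](@eq_Rintegral _ _ _ _ _
   (fun x => g x ord0 i * psi x - grad phi x ord0 i * psi x)); last first.
  by move=> x _; rewrite [X in X * _]mxE [X in _ + X]mxE mulrBl.
by rewrite (RintegralB mO (i2 i) (i4 i)) (RintegralB mO i5 i6) hg// hg'//; lra.
Qed.

Lemma W11_vanishing_approx y : W11_vanishing Omega GammaD y ->
  [/\ itg leb Omega y, weak_grad_spec Omega y (weak_grad Omega y) &
    approx leb Omega tests y (fun i x => weak_grad Omega y x ord0 i)].
Proof.
move=> [[iy [g0 hg0]] hy]; have gy := weak_grad_specP iy ((is_weak_gradP oO _ iy).1 hg0).
split=> // e e0; set g := weak_grad Omega y in gy *.
(* Each of the n+1 partial derivatives is bounded by the Euclidean norm of the gradient; with the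
   function itself this makes n+2 terms. *)
have e' : 0 < e / n.+2%:R by rewrite divr_gt0.
have [phi hphi] := hy _ e'.
have [iphi [iph _]] := weak_grad_test oO bO hphi.1.
have gd := weak_grad_specB iy gy hphi.1.
rewrite (W11normE (itgB mO iy iphi) gd) lte_fin => h.
exists (phi, fun i => partial i phi) => //=.
have ie := itg_enorm gd.1.
have h1 i : \int[leb]_(x in Omega) `|g x ord0 i - partial i phi x| <=
    \int[leb]_(x in Omega) enorm (g x - grad phi x).
  apply: le_Rintegral => //.
    by apply: (eq_itg mO _ (itg_norm (itgB mO (gy.1 i) (iph i)))) => x _; rewrite mxE.
  by move=> x _; apply: le_trans (coord_le_enorm _ i); rewrite !mxE.
have h2 : \sum_i \int[leb]_(x in Omega) `|g x ord0 i - partial i phi x| <=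
    n.+1%:R * \int[leb]_(x in Omega) enorm (g x - grad phi x).
  apply: (le_trans (ler_sum _ (fun i _ => h1 i))).
  by rewrite sumr_const card_ord mulr_natl.
have h3 : 0 <= \int[leb]_(x in Omega) `|y x - phi x| by exact: Rintegral_ge0.
have h4 : 0 <= \int[leb]_(x in Omega) enorm (g x - grad phi x).
  by apply: Rintegral_ge0 => x _; exact: enorm_ge0.
move: h; rewrite ltr_pdivlMr// -[n.+2]addn1 natrD.
have : (0 : R) <= n.+1%:R by [].
move: h2 h3 h4; rewrite /=; set A := \int[_]_(x in _) `|_ - phi x|.
by set B := \int[_]_(x in _) enorm _; set N := n.+1%:R; nra.
Qed.

Lemma approx_W11_vanishing y g : itg leb Omega y ->
  (forall i, itg leb Omega (g i)) -> approx leb Omega tests y g ->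
  W11_vanishing Omega GammaD y /\
  {ae leb, forall x, Omega x -> forall i, weak_grad Omega y x ord0 i = g i x}.
Proof.
move=> iy ig ya; have gy := approx_weak_grad iy ig ya.
split; last first.
  apply: filterS (weak_grad_unique oO bO (weak_grad_specP iy gy) gy) => x h Ox i.
  by rewrite h// mxE.
split; first by split=> //; exists (fun x => \row_i g i x); exact/is_weak_gradP.
move=> e e0; have [[phi dphi] [/= hphi dE] he] := ya _ e0; rewrite /= dE in he.
exists phi => //; have [iphi [iph _]] := weak_grad_test oO bO hphi.1.
have gd := weak_grad_specB iy gy hphi.1.
rewrite (W11normE (itgB mO iy iphi) gd) lte_fin; apply: le_lt_trans he.
have i1 i : itg leb Omega (fun x => `|g i x - partial i phi x|).
  by apply: (eq_itg mO _ (itg_norm (itgB mO (ig i) (iph i)))) => x _; rewrite mxE.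
rewrite lerD2l -(Rintegral_sum mO _ i1); apply: le_Rintegral => //.
- exact: itg_enorm gd.1.
- exact: (itg_sum mO).
move=> x _; apply: (le_trans (enorm_le_sum _)).
by rewrite le_eqVlt; apply/orP; left; apply/eqP/eq_bigr => i _; rewrite !mxE.
Qed.

End vanishing_trace.

(** * The degenerate state equation *)

(** The inverse is the pointwise limit of the continuous functions x / (x^2 + 1/(k+1)), also at 0,
    where both give the default value 0. *)
Lemma measurable_inv (R : realType) : measurable_fun [set: R] (@GRing.inv R).
Proof.
pose F k (x : R) := x * (x ^+ 2 + k.+1%:R^-1)^-1.
have pos k (x : R) : 0 < x ^+ 2 + k.+1%:R^-1 by rewrite ltr_wpDl ?sqr_ge0// invr_gt0.
apply: (@measurable_fun_cvg _ _ _ _ F) => [k|x _].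
  apply: continuous_measurable_fun => x.
  apply: (@continuousM _ _ (fun x : R => x) (fun x => (x ^+ 2 + k.+1%:R^-1)^-1)).
    exact: cvg_id.
  apply: continuousV; first by rewrite gt_eqF.
  by apply: continuousD; [exact: exprn_continuous|exact: cvg_cst].
have [->|x0] := eqVneq x 0.
  by rewrite invr0 /F; under eq_fun do rewrite mul0r; exact: cvg_cst.
have -> : x^-1 = x * (x ^+ 2 + 0)^-1 by rewrite addr0 expr2 invfM mulrA divff// mul1r.
apply: cvgM; first exact: cvg_cst.
apply: cvgV; first by rewrite addr0 expf_neq0.
by apply: cvgD; [exact: cvg_cst|exact: cvg_harmonic].
Qed.

Section varying_coefficient.
Context {R : realType} {n : nat}.
Local Notation E := 'rV[R]_n.+1.
Local Notation leb := (@leb_rV R n.+1).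
Context (Omega GammaD : set E) (oO : open Omega) (bO : bounded_set Omega).
Context (xi1 xi2 : E -> R).

Let mO : measurable Omega := open_measurable oO.
Let Ooo := leb_open_bounded_fin oO bO.

(** Positivity of [xi1] is included because it is what makes sqrt(u) invertible almost
    everywhere. *)
Definition between (u : E -> R) :=
  {ae leb, forall x, Omega x -> 0 < xi1 x /\ xi1 x <= u x <= xi2 x}.

Lemma square_itg_between (F : R -> R) (b u : E -> R) : measurable_fun setT F ->
  (forall x t, 0 < xi1 x -> xi1 x <= t <= xi2 x -> F t ^+ 2 <= b x) ->
  itg leb Omega b -> measurable_fun Omega u -> between u ->
  square_itg leb Omega (F \o u).
Proof.
move=> mF Fb ib mu bu; apply: (square_itg_le_ae mO (g := b)) => //.
  exact: measurableT_comp.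
by apply: filterS bu => x h Ox; have [? ?] := h Ox; exact: Fb.
Qed.

(** Applied to the square root with b = xi2 and to its inverse with b = 1/xi1; in both cases the
    squared difference is dominated by 4 b. *)
Lemma cvg_square_between (F : R -> R) (b u : E -> R) (rho : nat -> E -> R) :
  measurable_fun setT F -> (forall t, 0 < t -> {for t, continuous F}) ->
  (forall x t, 0 < xi1 x -> xi1 x <= t <= xi2 x -> F t ^+ 2 <= b x) ->
  itg leb Omega b -> measurable_fun Omega u -> between u ->
  (forall k, measurable_fun Omega (rho k)) -> (forall k, between (rho k)) ->
  {ae leb, forall x, Omega x -> (fun k => rho k x) @ \oo --> u x} ->
  \int[leb]_(x in Omega) (F (rho k x) - F (u x)) ^+ 2 @[k --> \oo] --> 0.
Proof.
move=> mF cF Fb ib mu bu mr br ru.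
have mFu (w : E -> R) : measurable_fun Omega w -> measurable_fun Omega (F \o w).
  by move=> mw; exact: measurableT_comp.
have [] := @Rintegral_dominated_ae _ _ _ leb Omega mO
  (fun k x => (F (rho k x) - F (u x)) ^+ 2) (fun=> 0) (fun x => 4 * b x).
- by move=> k; apply: measurable_funX; apply: measurable_funB; exact: mFu.
- by [].
- apply: filterS2 bu ru => x h1 h2 Ox; have [x1 /andP[x2 x3]] := h1 Ox.
  have cFu := cF (u x) (lt_le_trans x1 x2).
  have e0 : (F (u x) - F (u x)) ^+ 2 = 0 by rewrite subrr expr0n.
  rewrite -e0; apply: cvg_sqr; apply: cvgB; last exact: cvg_cst.
  by apply: (cvg_comp _ _ (h2 Ox)); exact: cFu.
- exact: (itgZ mO).
- move=> k; apply: filterS2 bu (br k) => x h1 h2 Ox.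
  have [x1 x2] := h1 Ox; have [_ x3] := h2 Ox.
  have := Fb x _ x1 x2; have := Fb x _ x1 x3.
  rewrite ger0_norm ?sqr_ge0//; have := sqr_ge0 (F (rho k x) + F (u x)).
  by nra.
by rewrite Rintegral_cst// mul0r.
Qed.

Context (ixi1 : itg leb Omega (fun x => (xi1 x)^-1)) (ixi2 : itg leb Omega xi2).

Let sq (t : R) := Num.sqrt t.
Let isq (t : R) := (Num.sqrt t)^-1.

Let msq : measurable_fun setT sq.
Proof. by apply: continuous_measurable_fun; exact: sqrt_continuous. Qed.

Let misq : measurable_fun setT isq.
Proof. by apply: (measurableT_comp (@measurable_inv R)). Qed.

Let sqb x t : 0 < xi1 x -> xi1 x <= t <= xi2 x -> sq t ^+ 2 <= xi2 x.
Proof. by move=> x0 /andP[xt tx]; rewrite sqr_sqrtr// ltW// (lt_le_trans x0). Qed.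

Let isqb x t : 0 < xi1 x -> xi1 x <= t <= xi2 x -> isq t ^+ 2 <= (xi1 x)^-1.
Proof.
move=> x0 /andP[xt tx]; have t0 : 0 < t by exact: lt_le_trans xt.
by rewrite /isq exprVn sqr_sqrtr ?lef_pV2// ltW.
Qed.

Let csq (t : R) : 0 < t -> {for t, continuous sq}.
Proof. by move=> _; exact: sqrt_continuous. Qed.

Let cisq (t : R) : 0 < t -> {for t, continuous isq}.
Proof.
move=> t0; apply: continuousV; first by rewrite gt_eqF// sqrtr_gt0.
exact: sqrt_continuous.
Qed.

(** Reduces a varying weight to [weak_limit] in the unweighted L^2. Exchanging rho_k for r costs
    products of a bounded L^2 sequence with rho_k^(-1/2) - r^(-1/2), in the gradients, or with
    sqrt(rho_k) - sqrt(r), in the equation; both vanish in L^1. *)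
Theorem varying_coefficient_limit (rho : nat -> E -> R) (r : E -> R)
    (y : nat -> E -> R) (g : nat -> 'I_n.+1 -> E -> R) (C : R) :
  (forall k, measurable_fun Omega (rho k)) -> (forall k, between (rho k)) ->
  measurable_fun Omega r -> between r ->
  {ae leb, forall x, Omega x -> (fun k => rho k x) @ \oo --> r x} ->
  (forall k, square_itg leb Omega (y k)) -> (forall k i, itg leb Omega (g k i)) ->
  (forall k i, itg leb Omega (fun x => rho k x * g k i x ^+ 2)) ->
  (forall k, approx leb Omega (tests GammaD) (y k) (g k)) ->
  (forall k, \int[leb]_(x in Omega) y k x ^+ 2 +
     \sum_i \int[leb]_(x in Omega) (rho k x * g k i x ^+ 2) <= C) ->
  exists (z : E -> R) (w : 'I_n.+1 -> E -> R),
    [/\ square_itg leb Omega z /\ approx leb Omega (tests GammaD) z w,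
        forall i, itg leb Omega (w i),
        forall i, itg leb Omega (fun x => r x * w i x ^+ 2),
        forall phi (c : R), Coo0_vanishing GammaD phi ->
          \int[leb]_(x in Omega) (y k x * phi x) + \sum_i \int[leb]_(x in Omega)
             (rho k x * g k i x * partial i phi x) @[k --> \oo] --> c ->
          \int[leb]_(x in Omega) (z x * phi x) + \sum_i \int[leb]_(x in Omega)
             (r x * w i x * partial i phi x) = c &
        forall (yd : E -> R) (p : nat) (c : R), square_itg leb Omega yd ->
          (forall k, (p <= k)%N -> \int[leb]_(x in Omega) (y k x - yd x) ^+ 2 +
            \sum_i \int[leb]_(x in Omega) (rho k x * g k i x ^+ 2) <= c) ->
          \int[leb]_(x in Omega) (z x - yd x) ^+ 2 +
            \sum_i \int[leb]_(x in Omega) (r x * w i x ^+ 2) <= c].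
Proof.
move=> mrho brho mr br rr hy ig irg ya yC.
pose v k i x := sq (rho k x) * g k i x.
have mg k i : measurable_fun Omega (g k i) by exact: itg_meas (ig k i).
have ms k : measurable_fun Omega (sq \o rho k) by exact: measurableT_comp.
have mv k i : measurable_fun Omega (v k i).
  by apply: measurable_funM; [exact: ms|exact: mg].
have v2 k i : {ae leb, forall x, Omega x -> v k i x ^+ 2 = rho k x * g k i x ^+ 2}.
  apply: filterS (brho k) => x h Ox; have [x1 /andP[x2 _]] := h Ox.
  by rewrite /v exprMn sqr_sqrtr// ltW// (lt_le_trans x1).
have sv k i : square_itg leb Omega (v k i).
  apply: (square_itg_le_ae mO (mv k i) _ (irg k i)).
  by apply: filterS (v2 k i) => x h Ox; rewrite h.
have Iv2 k i : \int[leb]_(x in Omega) v k i x ^+ 2 = \int[leb]_(x in Omega) (rho k x * g k i x ^+ 2).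
  by apply: (Rintegral_ae_eq mO) (v2 k i) => //; exact: (sv k i).2.
have sh : square_itg leb Omega (isq \o r) by exact: square_itg_between misq isqb ixi1 mr br.
have sh_ k : square_itg leb Omega (isq \o rho k).
  exact: square_itg_between misq isqb ixi1 (mrho k) (brho k).
have ss : square_itg leb Omega (sq \o r) by exact: square_itg_between msq sqb ixi2 mr br.
have ss_ k : square_itg leb Omega (sq \o rho k).
  exact: square_itg_between msq sqb ixi2 (mrho k) (brho k).
have h0 := cvg_square_between misq cisq isqb ixi1 mr br mrho brho rr.
have s0 := cvg_square_between msq csq sqb ixi2 mr br mrho brho rr.
have vC k i : \int[leb]_(x in Omega) v k i x ^+ 2 <= C.
  apply: le_trans (yC k); rewrite Iv2 (bigD1 i)//= addrCA lerDl addr_ge0//.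
    by apply: Rintegral_ge0 => x _; exact: sqr_ge0.
  apply: sumr_ge0 => j _; rewrite -Iv2; apply: Rintegral_ge0 => x _; exact: sqr_ge0.
have vC' k : \int[leb]_(x in Omega) y k x ^+ 2 + \sum_i \int[leb]_(x in Omega) v k i x ^+ 2 <= C.
  by under eq_bigr do rewrite Iv2.
have gv i : \int[leb]_(x in Omega) `|g k i x - (isq \o r) x * v k i x| @[k --> \oo] --> 0.
  have := @Rintegral_mul_cvg0 _ _ _ leb Omega mO (fun k x => isq (rho k x) - isq (r x))
     (v ^~ i) C (fun k => square_itgB mO (sh_ k) sh) (sv ^~ i) (vC ^~ i) h0.
  apply: cvg_trans; apply: near_eq_cvg; apply: nearW => k.
  apply: (Rintegral_ae_eq mO).
  - exact: (itg_norm (square_itgM mO (square_itgB mO (sh_ k) sh) (sv k i))).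
  - exact: (itg_norm (itgB mO (ig k i) (square_itgM mO sh (sv k i)))).
  apply: filterS (brho k) => x h Ox; have [x1 /andP[x2 _]] := h Ox.
  have x3 : sq (rho k x) != 0 by rewrite gt_eqF// sqrtr_gt0 (lt_le_trans x1).
  by rewrite mulrBl /v mulrA /isq mulVf// mul1r.
have [z [w [sz sw za zw zJ]]] := weak_limit mO Ooo (@itg_tests _ _ _ GammaD oO bO)
  (@tests_mean _ _ GammaD) sh hy sv ig ya vC' gv.
have mw i : measurable_fun Omega (fun x => isq (r x) * w i x).
  by apply: measurable_funM; [exact: sh.1|exact: (sw i).1].
have w2 i : {ae leb, forall x, Omega x -> w i x ^+ 2 = r x * (isq (r x) * w i x) ^+ 2}.
  apply: filterS br => x h Ox; have [x1 /andP[x2 _]] := h Ox.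
  have rx : 0 < r x by exact: lt_le_trans x2.
  by rewrite exprMn /isq exprVn sqr_sqrtr ?(ltW rx)// mulrA divff ?mul1r// gt_eqF.
have irw i : itg leb Omega (fun x => r x * (isq (r x) * w i x) ^+ 2).
  apply: (itg_le_ae mO _ _ (sw i).2); first by apply: measurable_funM => //; exact: measurable_funX.
  by apply: filterS (w2 i) => x h Ox; rewrite -h// ger0_norm// sqr_ge0.
have Iw2 i : \int[leb]_(x in Omega) w i x ^+ 2 =
    \int[leb]_(x in Omega) (r x * (isq (r x) * w i x) ^+ 2).
  by apply: (Rintegral_ae_eq mO) (w2 i) => //; exact: (sw i).2.
exists z, (fun i x => isq (r x) * w i x); split=> //.
- by move=> i; exact: (square_itgM mO sh (sw i)).
- move=> phi c hphi lim; have [B B0 hB] := Coo0_bounds hphi.1.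
  have [c1 c2] := Coo0_continuous hphi.1.
  have sphi (e : E -> R) : continuous e -> (forall x, `|e x| <= B) ->
      square_itg leb Omega e.
    move=> ce eB; have me := measurable_continuous mO ce; split=> //.
    apply: (itg_bounded mO (M := B ^+ 2)) => //; first exact: measurable_funX.
    by move=> x _; rewrite normrX lerXn2r// nnegrE.
  have sdphi (u : E -> R) i : square_itg leb Omega u ->
      square_itg leb Omega (fun x => u x * partial i phi x) /\
      \int[leb]_(x in Omega) (u x * partial i phi x) ^+ 2 <=
      B ^+ 2 * \int[leb]_(x in Omega) u x ^+ 2.
    move=> [mu iu]; have le x : (u x * partial i phi x) ^+ 2 <= B ^+ 2 * u x ^+ 2.
      rewrite exprMn mulrC ler_wpM2r ?sqr_ge0//.
      by rewrite -(real_normK (num_real (partial i phi x))) lerXn2r ?nnegrE// (hB x).2.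
    have s1 : square_itg leb Omega (fun x => u x * partial i phi x).
      apply: (square_itg_le_ae mO _ _ (itgZ mO (B ^+ 2) iu)).
        by apply: measurable_funM => //; exact: measurable_continuous.
      by apply: aeW => x _; exact: le.
    split=> //; rewrite -(RintegralZl _ mO iu).
    by apply: le_Rintegral => //; [exact: s1.2|exact: (itgZ mO)].
  have E1 : \int[leb]_(x in Omega) (z x * phi x) + \sum_i \int[leb]_(x in Omega)
      (w i x * (sq (r x) * partial i phi x)) = c.
    apply: zw; first by apply: sphi => // x; exact: (hB x).1.
      by move=> i; exact: (sdphi _ i ss).1.
    pose b k := \int[leb]_(x in Omega) (y k x * phi x) + \sum_i \int[leb]_(x in Omega)
             (rho k x * g k i x * partial i phi x).
    pose a k := \int[leb]_(x in Omega) (y k x * phi x) + \sum_i \int[leb]_(x in Omega)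
             (v k i x * (sq (r x) * partial i phi x)).
    (* [b] is the given form and [a] the same form with the test field sqrt(r) grad phi, which no
       longer depends on [k], as the abstract limit theorem requires. *)
    have ab : a k - b k @[k --> \oo] --> 0.
      pose e k i := \int[leb]_(x in Omega) `|(sq (rho k x) - sq (r x)) * (v k i x * partial i phi x)|.
      have e0 : \sum_i e k i @[k --> \oo] --> 0.
        apply: (cvg0_sum (u := fun i k => e k i)) => i.
        apply: (@Rintegral_mul_cvg0 _ _ _ leb Omega mO (fun k x => sq (rho k x) - sq (r x))
          (fun k x => v k i x * partial i phi x) (B ^+ 2 * C)) => //.
        - by move=> k; exact: (square_itgB mO (ss_ k) ss).
        - by move=> k; exact: (sdphi _ i (sv k i)).1.
        - move=> k; apply: (le_trans (sdphi _ i (sv k i)).2).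
          by rewrite ler_wpM2l ?sqr_ge0.
      apply/cvgr0Pnorm_le => eps eps0; move/cvgr0Pnorm_le : e0 => /(_ _ eps0).
      apply: filterS => k; apply: le_trans; rewrite /a /b opprD addrACA subrr add0r.
      rewrite -sumrB [leRHS]ger0_norm; last by apply: sumr_ge0 => i _; exact: Rintegral_ge0.
      apply: (le_trans (ler_norm_sum _ _ _)); apply: ler_sum => i _; rewrite /e.
      have s1 := (sdphi _ i (sv k i)).1.
      have i1 : itg leb Omega (fun x => v k i x * (sq (r x) * partial i phi x)).
        exact: (square_itgM mO (sv k i) (sdphi _ i ss).1).
      have i2 : itg leb Omega (fun x => v k i x * (sq (rho k x) * partial i phi x)).
        exact: (square_itgM mO (sv k i) (sdphi _ i (ss_ k)).1).
      have [_ <-] : itg leb Omega (fun x => rho k x * g k i x * partial i phi x) /\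
          \int[leb]_(x in Omega) (v k i x * (sq (rho k x) * partial i phi x)) =
          \int[leb]_(x in Omega) (rho k x * g k i x * partial i phi x).
        apply: (itg_ae_eq mO i2).
          apply: measurable_funM; first exact: measurable_funM.
          exact: measurable_continuous.
        apply: filterS (brho k) => x h Ox; have [x1 /andP[x2 _]] := h Ox.
        have := sqr_sqrtr (ltW (lt_le_trans x1 x2)); rewrite -/(sq _) => e1.
        by rewrite -[in RHS]e1 /v expr2; lra.
      rewrite -(RintegralB mO i1 i2); apply: le_trans (le_normr_Rintegral mO (itgB mO i1 i2)) _.
      rewrite le_eqVlt; apply/orP; left; apply/eqP/eq_Rintegral => x _.
      by rewrite -normrN; congr (`|_|); lra.
    suff : a k @[k --> \oo] --> c by [].
    have -> : a = (fun k => b k + (a k - b k)) by apply/funext => k; rewrite addrC subrK.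
    by rewrite -[in X in _ --> X](addr0 c); exact: cvgD lim ab.
  rewrite -E1; congr (_ + _); apply: eq_bigr => i _; apply/esym.
  apply: (itg_ae_eq mO _ _ _).2.
  - exact: (square_itgM mO (sw i) (sdphi _ i ss).1).
  - apply: measurable_funM; first exact: measurable_funM.
    exact: measurable_continuous.
  apply: filterS br => x h Ox; have [x1 /andP[x2 _]] := h Ox.
  have rx : 0 < r x by exact: lt_le_trans x2.
  have := sqr_sqrtr (ltW rx); rewrite -/(sq _) => e1.
  have e2 : sq (r x) * isq (r x) = 1 by rewrite /isq divff// gt_eqF// sqrtr_gt0.
  transitivity (sq (r x) ^+ 2 * (isq (r x) * w i x) * partial i phi x); last by rewrite e1.
  transitivity (sq (r x) * isq (r x) * (w i x * (sq (r x) * partial i phi x))).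
    by rewrite e2 mul1r.
  by rewrite expr2; lra.
- move=> yd p c hyd hc; have := zJ yd p c hyd; under eq_bigr do rewrite Iw2; apply => k pk.
  by under eq_bigr do rewrite Iv2; exact: hc.
Qed.

End varying_coefficient.

(** * Existence of a state for a fixed control *)

Section state_equation.
Context {R : realType} {n : nat}.
Local Notation E := 'rV[R]_n.+1.
Local Notation leb := (@leb_rV R n.+1).
Context (Omega GammaD : set E) (oO : open Omega) (bO : bounded_set Omega).
Context (xi1 xi2 : E -> R).
Context (ixi1 : itg leb Omega (fun x => (xi1 x)^-1)) (ixi2 : itg leb Omega xi2).

Let mO : measurable Omega := open_measurable oO.
Let Ooo := leb_open_bounded_fin oO bO.

Lemma itg_between r : measurable_fun Omega r -> between Omega xi1 xi2 r ->
  itg leb Omega r.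
Proof.
move=> mr br; apply: itg_le_ae ixi2 => //.
apply: filterS br => x h Ox; have [x1 /andP[x2 x3]] := h Ox.
by rewrite ger0_norm// ltW// (lt_le_trans x1).
Qed.

Lemma square_itg_test phi : Coo0_vanishing GammaD phi -> square_itg leb Omega phi.
Proof.
move=> [hphi _]; have [B B0 hB] := Coo0_bounds hphi.
have [c1 _] := Coo0_continuous hphi.
have m1 := measurable_continuous mO c1; split=> //.
apply: (itg_bounded mO (M := B ^+ 2)) => //; first exact: measurable_funX.
by move=> x _; rewrite normrX lerXn2r ?nnegrE// (hB x).1.
Qed.

Definition form (r phi psi : E -> R) (x : E) : R :=
  phi x * psi x + \sum_i r x * (partial i phi x * partial i psi x).

Lemma itg_form_terms r phi psi : itg leb Omega r ->
  Coo0_vanishing GammaD phi -> Coo0_vanishing GammaD psi ->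
  itg leb Omega (fun x => phi x * psi x) /\
  forall i, itg leb Omega (fun x => r x * (partial i phi x * partial i psi x)).
Proof.
move=> ir hphi hpsi; split.
  exact: (square_itgM mO (square_itg_test hphi) (square_itg_test hpsi)).
move=> i; have [_ i1] := itg_test_mul oO ir hphi.1.
have [_ /(_ i) i2] := itg_test_mul oO (i1 i) hpsi.1.
by apply: (eq_itg mO _ i2) => x _; rewrite mulrA.
Qed.

Lemma itg_form r phi psi : itg leb Omega r -> Coo0_vanishing GammaD phi ->
  Coo0_vanishing GammaD psi -> itg leb Omega (form r phi psi).
Proof.
move=> ir hphi hpsi; have [i1 i2] := itg_form_terms ir hphi hpsi.
by apply: (itgD mO) => //; exact: (itg_sum mO).
Qed.

Lemma Rintegral_form r phi psi : itg leb Omega r -> Coo0_vanishing GammaD phi ->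
  Coo0_vanishing GammaD psi ->
  \int[leb]_(x in Omega) form r phi psi x = \int[leb]_(x in Omega) (phi x * psi x) +
  \sum_i \int[leb]_(x in Omega) (r x * (partial i phi x * partial i psi x)).
Proof.
move=> ir hphi hpsi; have [i1 i2] := itg_form_terms ir hphi hpsi.
by rewrite (RintegralD mO i1 (itg_sum mO _ i2)) (Rintegral_sum mO).
Qed.

Lemma form_lin r phi psi (t : R) x : Coo0_vanishing GammaD phi ->
  Coo0_vanishing GammaD psi ->
  form r (fun x => 1 * phi x + t * psi x) (fun x => 1 * phi x + t * psi x) x =
  form r phi phi x + 2 * t * form r phi psi x + t ^+ 2 * form r psi psi x.
Proof.
move=> [[/(_ 1%N) c1 _ _] _] [[/(_ 1%N) c2 _ _] _]; rewrite /form.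
rewrite (eq_bigr (fun i => r x * (partial i phi x * partial i phi x) +
  2 * t * (r x * (partial i phi x * partial i psi x)) +
  t ^+ 2 * (r x * (partial i psi x * partial i psi x)))).
  by rewrite !big_split/= -!mulr_sumr; lra.
by move=> i _; rewrite partial_lin//; lra.
Qed.

(* The form domain is the closure of the test functions, so a minimizing
   sequence for the quadratic functional can be taken among the test functions. *)
Theorem state_equation_solvable (r f : E -> R) : measurable_fun Omega r ->
  between Omega xi1 xi2 r -> square_itg leb Omega f ->
  exists (z : E -> R) (w : 'I_n.+1 -> E -> R),
    [/\ square_itg leb Omega z /\ approx leb Omega (tests GammaD) z w,
        forall i, itg leb Omega (w i),
        forall i, itg leb Omega (fun x => r x * w i x ^+ 2) &
        forall phi, Coo0_vanishing GammaD phi ->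
          \int[leb]_(x in Omega) (z x * phi x) + \sum_i \int[leb]_(x in Omega)
             (r x * w i x * partial i phi x) = \int[leb]_(x in Omega) (f x * phi x)].
Proof.
move=> mr br hf; have ir := itg_between mr br.
pose q phi x := 2^-1 * form r phi phi x - f x * phi x.
have ifp phi : Coo0_vanishing GammaD phi -> itg leb Omega (fun x => f x * phi x).
  by move=> h; exact: (square_itgM mO hf (square_itg_test h)).
have iq phi : Coo0_vanishing GammaD phi -> itg leb Omega (q phi).
  by move=> h; exact: (itgB mO (itgZ mO 2^-1 (itg_form ir h h)) (ifp _ h)).
pose Q phi := \int[leb]_(x in Omega) q phi x.
have form0 phi : {ae leb, forall x, Omega x -> 0 <= form r phi phi x - phi x ^+ 2}.
  apply: filterS br => x h Ox; have [x1 /andP[x2 _]] := h Ox.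
  rewrite /form expr2 addrAC subrr add0r; apply: sumr_ge0 => i _.
  by rewrite -expr2 mulr_ge0 ?sqr_ge0// ltW// (lt_le_trans x1).
(* Half of the quadratic part is kept; the other half dominates phi^2 / 4 and absorbs f phi through
   (phi/2 - f)^2 >= 0. *)
have Qlow phi : Coo0_vanishing GammaD phi ->
    4^-1 * \int[leb]_(x in Omega) form r phi phi x - \int[leb]_(x in Omega) f x ^+ 2 <= Q phi.
  move=> h; have i1 := itg_form ir h h.
  rewrite -(RintegralZl _ mO i1) -(RintegralB mO (itgZ mO _ i1) hf.2).
  apply: (le_Rintegral_ae mO _ (iq _ h)); first exact: (itgB mO (itgZ mO _ i1) hf.2).
  apply: filterS (form0 phi) => x /[apply]; rewrite /q.
  by have := sqr_ge0 (2^-1 * phi x - f x); nra.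
have F0 phi : Coo0_vanishing GammaD phi -> 0 <= \int[leb]_(x in Omega) form r phi phi x.
  move=> h; have e0 : \int[leb]_(x in Omega) (0 : R) = 0 by rewrite Rintegral_cst// mul0r.
  apply: le_trans (le_Rintegral_ae mO (itg0 leb Omega) (itg_form ir h h) _).
    by rewrite e0.
  by apply: filterS (form0 phi) => x /[apply]; have := sqr_ge0 (phi x); lra.
have Q0 phi : Coo0_vanishing GammaD phi -> - (\int[leb]_(x in Omega) f x ^+ 2) <= Q phi.
  by move=> h; apply: le_trans (Qlow _ h); have := F0 _ h; lra.
pose S := [set Q phi | phi in Coo0_vanishing GammaD].
have Slb : has_inf S.
  split; first by exists (Q (fun=> 0)); exists (fun=> 0) => //; exact: Coo0_vanishing0.
  by exists (- (\int[leb]_(x in Omega) f x ^+ 2)) => _ [phi h <-]; exact: Q0.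
pose t k : R := k.+1%:R^-1.
have t0 k : 0 < t k by rewrite invr_gt0.
have t1 k : t k <= 1 by rewrite invf_le1// ler1n.
have exphi k : exists phi, Coo0_vanishing GammaD phi /\ Q phi < inf S + t k ^+ 2.
  have tk : 0 < t k ^+ 2 by rewrite exprn_gt0.
  by have [_ [phi h <-] hQ] := inf_adherent tk Slb; exists phi.
have [phi hphi] := choice exphi.
have Sinf psi : Coo0_vanishing GammaD psi -> inf S <= Q psi.
  by move=> h; apply: ge_inf => //; [exact: Slb.2|exists psi].
have vphi k : Coo0_vanishing GammaD (phi k) by exact: (hphi k).1.
(* [phi k] minimizes up to t_k^2. Comparing it with phi_k + t_k psi and phi_k - t_k psi and dividing
   by t_k leaves a residual of order t_k in the Euler equation. *)
have res k psi : Coo0_vanishing GammaD psi ->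
    `|\int[leb]_(x in Omega) form r (phi k) psi x - \int[leb]_(x in Omega) (f x * psi x)| <=
    t k * (1 + 2^-1 * \int[leb]_(x in Omega) form r psi psi x).
  move=> hpsi.
  have h (s : R) : Q (fun x => 1 * phi k x + s * psi x) = Q (phi k) +
     s * (\int[leb]_(x in Omega) form r (phi k) psi x - \int[leb]_(x in Omega) (f x * psi x)) +
     2^-1 * s ^+ 2 * \int[leb]_(x in Omega) form r psi psi x.
    have i1 := itg_form ir (vphi k) hpsi; have i2 := itg_form ir hpsi hpsi.
    have i3 := itgB mO i1 (ifp _ hpsi).
    rewrite -(RintegralB mO i1 (ifp _ hpsi)) -(RintegralZl _ mO i3) -(RintegralZl _ mO i2).
    rewrite -(RintegralD mO (iq _ (vphi k)) (itgZ mO s i3)).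
    rewrite -(RintegralD mO (itgD mO (iq _ (vphi k)) (itgZ mO s i3)) (itgZ mO _ i2)).
    by apply: eq_Rintegral => x _; rewrite /q form_lin//; lra.
  have := Sinf _ (Coo0_vanishing_lin 1 (t k) (vphi k) hpsi).
  have := Sinf _ (Coo0_vanishing_lin 1 (- t k) (vphi k) hpsi).
  rewrite !h; have := (hphi k).2; have := t0 k.
  set F1 := \int[_]_(x in _) form r (phi k) psi x; set F2 := \int[_]_(x in _) form _ _ _ _.
  set F3 := \int[_]_(x in _) (f x * psi x).
  move=> tk h1 h2 h3.
  have h4 : t k * (F1 - F3) <= t k * (t k * (1 + 2^-1 * F2)) by lra.
  have h5 : t k * (F3 - F1) <= t k * (t k * (1 + 2^-1 * F2)) by lra.
  by move: h4 h5; rewrite !ler_pM2l// ler_norml => h4 h5; apply/andP; split; lra.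
(* The energy bound that [Qlow] gives for values of [Q] below inf S + 1. *)
pose C : R := 4 * (inf S + 1 + \int[leb]_(x in Omega) f x ^+ 2).
have eqs (u : E -> R) i x : r x * partial i u x ^+ 2 = r x * (partial i u x * partial i u x).
  by rewrite expr2.
have [||||||||||z [w [h1 h2 h3 h4 h5]]] := @varying_coefficient_limit _ _ Omega GammaD oO bO xi1 xi2
   ixi1 ixi2 (fun=> r) r phi (fun k i => partial i (phi k)) C.
- by [].
- by [].
- by [].
- by [].
- by apply: aeW => x _; exact: cvg_cst.
- by move=> k; exact: square_itg_test.
- by move=> k i; exact: (itg_tests oO bO (p := (phi k, fun i => partial i (phi k))) (conj (vphi k) erefl)).2.
- move=> k i; apply: (eq_itg mO _ ((itg_form_terms ir (vphi k) (vphi k)).2 i)) => x _.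
  by rewrite eqs.
- move=> k e e0; exists (phi k, fun i => partial i (phi k)); first by split=> //=; exact: vphi.
  have dist0 (u : E -> R) : \int[leb]_(x in Omega) `|u x - u x| = 0.
    rewrite (@eq_Rintegral _ _ _ _ _ (fun=> 0)) ?Rintegral_cst ?mul0r// => x _.
    by rewrite subrr normr0.
  by rewrite /= dist0 big1 ?addr0// => i _; rewrite dist0.
- move=> k; have hk := vphi k.
  rewrite (_ : _ + _ = \int[leb]_(x in Omega) form r (phi k) (phi k) x); last first.
    by rewrite (Rintegral_form ir hk hk).
  have h1 := Qlow _ hk; have h2 := (hphi k).2.
  have h3 : t k ^+ 2 <= 1 by rewrite expr_le1// ltW.
  by rewrite /C; move: h1 h2 h3; lra.
exists z, w; split=> // psi hpsi; apply: h4 => //.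
apply/cvgrPdist_le => e e0.
pose A := 1 + 2^-1 * \int[leb]_(x in Omega) form r psi psi x.
have A0 : 0 < A by rewrite ltr_pwDl// mulr_ge0// F0.
have eA : 0 < e / A by rewrite divr_gt0.
have : \forall k \near \oo, t k <= e / A by exact: (cvgr_le _ (@cvg_harmonic R) _ eA).
apply: filterS => k tk; have := res k psi hpsi; rewrite (Rintegral_form ir (vphi k) hpsi).
rewrite distrC (eq_bigr (fun i => \int[leb]_(x in Omega) (r x * partial i (phi k) x * partial i psi x))).
  by move=> /le_trans; apply; rewrite -ler_pdivlMr.
by move=> i _; apply: eq_Rintegral => x _; rewrite mulrA.
Qed.

End state_equation.

(** * The data and the admissible pairs in terms of real integrals *)

Section admissible_pairs.
Context {R : realType} {n : nat}.
Local Notation E := 'rV[R]_n.+1.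
Local Notation leb := (@leb_rV R n.+1).
Context (Omega GammaD : set E) (oO : open Omega) (bO : bounded_set Omega).

Let mO : measurable Omega := open_measurable oO.
Let Ooo := leb_open_bounded_fin oO bO.

Lemma L1loc_integrable (u : E -> \bar R) : L1loc u -> leb.-integrable Omega u.
Proof.
move=> hu; have [M M0 OM] := bounded_sub_box bO.
have cK := @compact_closed_box R n (rV_const (- M)) (rV_const M).
apply: integrableS (hu _ cK) => //; first exact: compact_measurable.
by move=> x /OM h i; have /andP[/ltW -> ->] := h i.
Qed.

Lemma L2loc_square_itg (u : E -> R) : L2loc u -> square_itg leb Omega u.
Proof.
move=> hu; have [M M0 OM] := bounded_sub_box bO.
have cK := @compact_closed_box R n (rV_const (- M)) (rV_const M).
set K := [set _ | _] in cK; have OK : Omega `<=` K.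
  by move=> x /OM h i; have /andP[/ltW -> ->] := h i.
have [mu iu] := hu _ cK; split.
  by apply: measurable_funS mu => //; exact: compact_measurable.
by apply: integrableS iu => //; exact: compact_measurable.
Qed.

(** In the extended reals the inverse of 0 is +oo, so integrability forces [xi] to be nonzero almost
    everywhere; the real inverse, with value 0 at 0, is dominated by it. *)
Lemma itg_inv_L1loc (xi : E -> R) : L1loc (EFin \o xi) ->
  L1loc (fun x => ((xi x)%:E^-1)%E) ->
  {ae leb, forall x, Omega x -> xi x != 0} /\
  itg leb Omega (fun x => (xi x)^-1).
Proof.
move=> /L1loc_integrable ixi /L1loc_integrable iinv; split.
  apply: filterS (integrable_ae mO iinv) => x h Ox; have := h Ox.
  by rewrite inver; case: eqP.
apply: le_integrable iinv => //.
  apply/measurable_EFinP; apply: measurableT_comp (@measurable_inv R) _.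
  exact: (@itg_meas _ _ _ leb _ _ ixi).
by move=> x _; rewrite /= inver; case: eqP => // _; rewrite leey.
Qed.

Context (xi1 xi2 : E -> R).
Context (ixi1 : itg leb Omega (fun x => (xi1 x)^-1)) (ixi2 : itg leb Omega xi2).
Context (r y : E -> R) (g : 'I_n.+1 -> E -> R).
Context (ir : itg leb Omega r) (br : between Omega xi1 xi2 r).
Context (iy : itg leb Omega y) (ig : forall i, itg leb Omega (g i)).
Context (wy : weak_grad_spec Omega y (weak_grad Omega y)).
Context (gE : {ae leb, forall x, Omega x -> forall i, weak_grad Omega y x ord0 i = g i x}).

Let wg := weak_grad Omega y.

Let mr := itg_meas ir.

Let r0 : {ae leb, forall x, Omega x -> 0 < r x}.
Proof.
apply: filterS br => x h Ox; have [x1 /andP[x2 _]] := h Ox.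
exact: lt_le_trans x2.
Qed.

Let mwg : measurable_fun Omega (fun x => enorm (wg x) ^+ 2).
Proof. by apply: measurable_funX; exact: (itg_meas (itg_enorm oO wy.1)). Qed.

Let enormE : {ae leb, forall x, Omega x -> r x * enorm (wg x) ^+ 2 = \sum_i r x * g i x ^+ 2}.
Proof.
apply: filterS gE => x h Ox; rewrite enorm_sqr mulr_sumr.
by apply: eq_bigr => i _; rewrite h.
Qed.

(** Almost everywhere the integrand is a sum of nonnegative terms, so each is integrable when the
    sum is. *)
Lemma Wnorm_lty : (Wnorm Omega r y < +oo)%E <->
  square_itg leb Omega y /\ forall i, itg leb Omega (fun x => r x * g i x ^+ 2).
Proof.
pose N x := y x ^+ 2 + r x * enorm (wg x) ^+ 2.
have my : measurable_fun Omega y := itg_meas iy.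
have mN : measurable_fun Omega N.
  by apply: measurable_funD; [exact: measurable_funX|exact: measurable_funM].
have N0 : {ae leb, forall x, Omega x -> 0 <= N x /\ N x = y x ^+ 2 + \sum_i r x * g i x ^+ 2}.
  apply: filterS2 r0 enormE => x h1 h2 Ox; rewrite /N h2//; split=> //.
  rewrite addr_ge0 ?sqr_ge0// sumr_ge0// => i _.
  by rewrite mulr_ge0 ?sqr_ge0// ltW// h1.
split=> [h|[[_ iy2] irg]]; last first.
  have iN : itg leb Omega N.
    apply: (itg_ae_eq mO (itgD mO iy2 (itg_sum mO (index_enum 'I_n.+1) irg)) mN _).1.
    by apply: filterS N0 => x h2 Ox; have [_ ->] := h2 Ox.
  by apply: poweR_lty; rewrite -[X in (X < _)%E](EFin_Rintegral mO iN) ltry.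
have iN : itg leb Omega N.
  have /lty_poweRy : (Wnorm Omega r y < +oo)%E by [].
  move=> /(_ _)/wrap[|hN]; first by rewrite invr_eq0.
  apply/integrableP; split; first exact/measurable_EFinP.
  apply: le_lt_trans hN; rewrite le_eqVlt; apply/orP; left; apply/eqP.
  apply: ae_eq_integral => //.
  - by apply: measurableT_comp => //; exact/measurable_EFinP.
  - exact/measurable_EFinP.
  by apply: filterS N0 => x h2 Ox; rewrite /= ger0_norm//; have [] := h2 Ox.
split.
  apply: (square_itg_le_ae mO my _ iN).
  apply: filterS2 N0 r0 => x h1 h2 Ox; have [_ ->] := h1 Ox; rewrite lerDl sumr_ge0// => i _.
  by rewrite mulr_ge0 ?sqr_ge0// ltW// h2.
move=> i; apply: (itg_le_ae mO _ _ iN).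
  by apply: measurable_funM => //; apply: measurable_funX; exact: (itg_meas (ig i)).
apply: filterS2 N0 r0 => x h1 h2 Ox; have [_ ->] := h1 Ox.
have rx := ltW (h2 Ox); rewrite ger0_norm; last by rewrite mulr_ge0 ?sqr_ge0.
rewrite (bigD1 i)//= addrCA lerDl addr_ge0 ?sqr_ge0// sumr_ge0// => j _.
by rewrite mulr_ge0 ?sqr_ge0.
Qed.

Context (sy : square_itg leb Omega y)
  (irg : forall i, itg leb Omega (fun x => r x * g i x ^+ 2)).

Lemma weak_formP (f phi : E -> R) : square_itg leb Omega f -> Coo0_vanishing GammaD phi ->
  (\int[leb]_(x in Omega) (r x * dotv (weak_grad Omega y x) (grad phi x) + y x * phi x)%:E =
   \int[leb]_(x in Omega) (f x * phi x)%:E)%E <->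
  \int[leb]_(x in Omega) (y x * phi x) +
    \sum_i \int[leb]_(x in Omega) (r x * g i x * partial i phi x) =
  \int[leb]_(x in Omega) (f x * phi x).
Proof.
move=> hf hphi; have sphi := square_itg_test oO bO hphi.
have ifp := square_itgM mO hf sphi; have iyp := square_itgM mO sy sphi.
have [c1 c2] := Coo0_continuous hphi.1.
(* The flux is integrable because r |g| <= r + r g^2. *)
have irg1 i : itg leb Omega (fun x => r x * g i x).
  apply: (itg_le_ae mO _ _ (itgD mO ir (irg i))).
    by apply: measurable_funM => //; exact: (itg_meas (ig i)).
  apply: filterS r0 => x h Ox; have rx := h Ox.
  rewrite normrM (gtr0_norm rx) -{2}(mulr1 (r x)) -mulrDr ler_pM2l//.
  by rewrite -(real_normK (num_real (g i x))); have := normr_ge0 (g i x); nra.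
have irgp i := (itg_test_mul oO (irg1 i) hphi.1).2 i.
have iS : itg leb Omega (fun x => y x * phi x + \sum_i r x * g i x * partial i phi x).
  by apply: (itgD mO) => //; exact: (itg_sum mO).
have mL : measurable_fun Omega
    (fun x => r x * dotv (wg x) (grad phi x) + y x * phi x).
  apply: measurable_funD; last exact: (itg_meas iyp).
  apply: measurable_funM => //; rewrite /dotv; apply: measurable_sum => i.
  apply: measurable_funM; first exact: (itg_meas (wy.1 i)).
  apply: (eq_measurable_fun (partial i phi)); first by move=> x _; rewrite mxE.
  exact: measurable_continuous.
have [iL LE] : itg leb Omega (fun x => r x * dotv (wg x) (grad phi x) + y x * phi x) /\
   \int[leb]_(x in Omega) (y x * phi x + \sum_i r x * g i x * partial i phi x) =
   \int[leb]_(x in Omega) (r x * dotv (wg x) (grad phi x) + y x * phi x).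
  apply: (itg_ae_eq mO iS mL); apply: filterS gE => x h Ox.
  rewrite addrC /dotv mulr_sumr; congr (_ + _); apply: eq_bigr => i _.
  by rewrite h// !mxE mulrA.
rewrite -(EFin_Rintegral mO iL) -(EFin_Rintegral mO ifp) -LE.
rewrite (RintegralD mO iyp (itg_sum mO _ irgp)) (Rintegral_sum mO _ irgp).
by split=> [[]|->].
Qed.

Lemma costE (yd : E -> R) : square_itg leb Omega yd ->
  cost Omega yd (r, y) =
  ((\int[leb]_(x in Omega) (y x - yd x) ^+ 2 +
    \sum_i \int[leb]_(x in Omega) (r x * g i x ^+ 2))%:E + div_variation Omega r)%E.
Proof.
move=> syd; rewrite /cost; congr (_ + _)%E; rewrite EFinD; congr (_ + _)%E.
  rewrite (EFin_Rintegral mO (square_itgB mO sy syd).2).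
  by apply: eq_integral => x _; rewrite real_normK// num_real.
have mL : measurable_fun Omega (fun x => enorm (wg x) ^+ 2 * r x) by exact: measurable_funM.
have [iL LE] : itg leb Omega (fun x => enorm (wg x) ^+ 2 * r x) /\
   \int[leb]_(x in Omega) (\sum_i r x * g i x ^+ 2) =
   \int[leb]_(x in Omega) (enorm (wg x) ^+ 2 * r x).
  apply: (itg_ae_eq mO (itg_sum mO _ irg) mL); apply: filterS enormE => x h Ox.
  by rewrite mulrC h.
by rewrite -(Rintegral_sum mO _ irg) LE (EFin_Rintegral mO iL).
Qed.

End admissible_pairs.

(** * Optimal controls *)

Section optimal_control.
Context {R : realType} {n : nat}.
Local Notation E := 'rV[R]_n.+1.
Local Notation leb := (@leb_rV R n.+1).
Context (Omega GammaD : set E) (oO : open Omega) (bO : bounded_set Omega).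

Let mO : measurable Omega := open_measurable oO.
Let Ooo := leb_open_bounded_fin oO bO.

Lemma divergence_bounded (phi : E -> E) : C10_vec Omega phi ->
  continuous (divergence phi) /\
  exists2 B, 0 <= B & forall x, `|divergence phi x| <= B.
Proof.
move=> [ck]; set K := tsupport _ => kphi _.
have cd i : continuous (partial i (fun x => phi x ord0 i)).
  by have [_ /(_ i)[]] := ck i.
have sup i x : partial i (fun x => phi x ord0 i) x != 0 -> K x.
  move=> h; have : tsupport (fun x => phi x ord0 i) x.
    by apply: contrapT => /(partial_out_tsupport i); move/eqP: h.
  apply: tsupport_sub; first exact: closed_closure.
  move=> u u0; apply: subset_closure => /=.
  by apply: contraNN u0 => /eqP ->.
have hB i : exists B, 0 <= B /\ forall x, `|partial i (fun x => phi x ord0 i) x| <= B.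
  have [B B0 h] := bounded_of_compact_support (cd i) kphi (sup i).
  by exists B.
have [B hB'] := choice hB; split.
  exact: (@Ck_sum _ _ 0 _ _ (fun i => partial i (fun x => phi x ord0 i)) cd).
exists (\sum_i B i); first by apply: sumr_ge0 => i _; have [] := hB' i.
move=> x; apply: (le_trans (ler_norm_sum _ _ _)); apply: ler_sum => i _.
by have [_] := hB' i; exact.
Qed.

Lemma itg_mul_divergence r phi : itg leb Omega r -> C10_vec Omega phi ->
  itg leb Omega (fun x => r x * divergence phi x).
Proof.
move=> ir /divergence_bounded[cd [B B0 hB]].
apply: (itg_le mO _ _ (itgZ mO B (itg_norm ir))).
  by apply: measurable_funM; [exact: (itg_meas ir)|exact: measurable_continuous].
by move=> x _; rewrite normrM mulrC ler_wpM2r.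
Qed.

Lemma Rintegral_le_div_variation r phi : itg leb Omega r -> C10_vec Omega phi ->
  (forall x, Omega x -> enorm (phi x) <= 1) ->
  ((\int[leb]_(x in Omega) (r x * divergence phi x))%:E <= div_variation Omega r)%E.
Proof.
move=> ir hphi phi1; rewrite (EFin_Rintegral mO (itg_mul_divergence ir hphi)).
by apply: ereal_sup_ubound; exists phi.
Qed.

Lemma div_variation_ge0 r : itg leb Omega r -> (0 <= div_variation Omega r)%E.
Proof.
move=> ir; have h0 : C10_vec Omega (fun _ : E => 0 : E).
  split; first by move=> i; exact: Ck_cst.
    set K := tsupport _; have -> : K = set0.
      rewrite -subset0; apply: tsupport_sub; first exact: closed0.
      by move=> x /eqP; apply; apply/funext => i; apply/funext => j; rewrite mxE.
    exact: compact0.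
  apply: subset_trans (sub0set _); apply: tsupport_sub; first exact: closed0.
  by move=> x /eqP; apply; apply/funext => i; apply/funext => j; rewrite mxE.
have div0 x : divergence (fun _ : E => 0 : E) x = 0.
  rewrite /divergence big1// => i _.
  rewrite (_ : (fun _ => _) = fun=> 0) ?partial_cst//.
  by apply/funext => u; rewrite mxE.
have := Rintegral_le_div_variation ir h0.
rewrite (@eq_Rintegral _ _ _ _ _ (fun=> 0)); last by move=> x _; rewrite div0 mulr0.
rewrite Rintegral_cst// mul0r; apply => x _.
rewrite /enorm /dotv big1 ?sqrtr0// => i _.
by rewrite mxE mul0r.
Qed.

Context (xi1 xi2 f yd : E -> R) (m : R).
Context (xi12 : {ae leb, forall x, 0 <= xi1 x <= xi2 x})
  (xi1n0 : {ae leb, forall x, Omega x -> xi1 x != 0}).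
Context (ixi1 : itg leb Omega (fun x => (xi1 x)^-1)) (ixi2 : itg leb Omega xi2).
Context (sf : square_itg leb Omega f) (syd : square_itg leb Omega yd).

Local Notation Rad := (R_ad Omega xi1 xi2 m).
Local Notation Xi := (Xi_W Omega GammaD xi1 xi2 m f).

(** The state constraints with the gradient as explicit data, in the form in which the limit
    theorems consume and produce them; the next lemmas relate this to [Xi_W] in both directions. *)
Definition weak_solution (r y : E -> R) (g : 'I_n.+1 -> E -> R) :=
  [/\ square_itg leb Omega y /\ approx leb Omega (tests GammaD) y g,
      forall i, itg leb Omega (g i),
      forall i, itg leb Omega (fun x => r x * g i x ^+ 2) &
      forall phi, Coo0_vanishing GammaD phi ->
        \int[leb]_(x in Omega) (y x * phi x) + \sum_i \int[leb]_(x in Omega)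
          (r x * g i x * partial i phi x) = \int[leb]_(x in Omega) (f x * phi x)].

Definition state_cost (r y : E -> R) (g : 'I_n.+1 -> E -> R) : R :=
  \int[leb]_(x in Omega) (y x - yd x) ^+ 2 +
  \sum_i \int[leb]_(x in Omega) (r x * g i x ^+ 2).

Lemma R_ad_between r : Rad r -> itg leb Omega r /\ between Omega xi1 xi2 r.
Proof.
move=> [[ir _] _ _ br]; split=> //.
apply: filterS3 br xi12 xi1n0 => x h1 h2 h3 Ox; split; last exact: h1.
by rewrite lt_neqAle eq_sym h3//; have /andP[] := h2.
Qed.

Lemma weak_solution_Xi r y g : Rad r -> weak_solution r y g ->
  Xi (r, y) /\ cost Omega yd (r, y) = ((state_cost r y g)%:E + div_variation Omega r)%E.
Proof.
move=> hr [[sy ya] ig irg hy]; have [ir br] := R_ad_between hr.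
have iy := itg_square_itg mO Ooo sy.
have [Wy gE] := approx_W11_vanishing oO bO iy ig ya.
have wy := weak_grad_specP oO iy (approx_weak_grad oO bO iy ig ya).
split; last exact: costE.
split=> //.
  by split=> //; apply/(Wnorm_lty oO ir br iy ig wy gE).
by move=> phi hphi; apply/(weak_formP oO bO ir br ig wy gE sy irg sf hphi); exact: hy.
Qed.

Lemma Xi_weak_solution r y : Xi (r, y) ->
  Rad r /\ weak_solution r y (fun i x => weak_grad Omega y x ord0 i).
Proof.
move=> [hr [Wy Wn] hy]; have [ir br] := R_ad_between hr.
have [iy wy ya] := W11_vanishing_approx oO bO Wy.
have gE : {ae leb, forall x, Omega x -> forall i,
    weak_grad Omega y x ord0 i = (fun i x => weak_grad Omega y x ord0 i) i x}.
  exact: aeW.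
have [sy irg] := (Wnorm_lty oO ir br iy wy.1 wy gE).1 Wn.
split=> //; split=> //; first exact: wy.1.
move=> phi hphi; apply/(weak_formP oO bO ir br wy.1 wy gE sy irg sf hphi).
exact: hy.
Qed.

Lemma gradient_energy_ge0 r y g : between Omega xi1 xi2 r -> weak_solution r y g ->
  0 <= \sum_i \int[leb]_(x in Omega) (r x * g i x ^+ 2).
Proof.
move=> br [_ ig irg _]; apply: sumr_ge0 => i _.
have e0 : \int[leb]_(x in Omega) (0 : R) = 0 by rewrite Rintegral_cst// mul0r.
apply: le_trans (le_Rintegral_ae mO (itg0 leb Omega) (irg i) _).
  by rewrite e0.
apply: filterS br => x h Ox; have [x1 /andP[x2 _]] := h Ox.
by rewrite mulr_ge0 ?sqr_ge0// ltW// (lt_le_trans x1).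
Qed.

Lemma state_cost_ge0 r y g : between Omega xi1 xi2 r -> weak_solution r y g ->
  0 <= state_cost r y g.
Proof.
move=> br hy; apply: addr_ge0; last exact: gradient_energy_ge0 hy.
by apply: Rintegral_ge0 => x _; exact: sqr_ge0.
Qed.

Theorem optimal_pair_exists : Rad !=set0 ->
  exists r y, Xi (r, y) /\
    cost Omega yd (r, y) = ereal_inf [set cost Omega yd p | p in Xi].
Proof.
move=> [r0 hr0]; set c := ereal_inf _.
have clb p : Xi p -> (c <= cost Omega yd p)%E.
  by move=> h; apply: ereal_inf_lbound; exists p.
(* The infimum is finite: it is nonnegative, and the solvable state equation for the given control
   provides a pair of finite cost. *)
have [c0 cE] : exists c0 : R, c = c0%:E.
  have [ir0 br0] := R_ad_between hr0.
  have [z [w hz]] := state_equation_solvable GammaD oO bO ixi1 ixi2 (itg_meas ir0) br0 sf.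
  have [Xz cz] := weak_solution_Xi hr0 hz.
  have cpos : (0 <= c)%E.
    apply: le_ereal_inf_tmp => _ [[r y] h <-].
    have [hr hy] := Xi_weak_solution h; have [_ ->] := weak_solution_Xi hr hy.
    have [ir br] := R_ad_between hr.
    by apply: adde_ge0; [rewrite lee_fin; exact: state_cost_ge0 hy|exact: div_variation_ge0].
  have coo : (c < +oo)%E.
    apply: le_lt_trans (clb _ Xz) _; rewrite cz.
    by have [[_ h] _ _ _] := hr0; rewrite lte_add_pinfty// ltry.
  by exists (fine c); rewrite fineK// ge0_fin_numE.
have t0 k : (0 : R) < k.+1%:R^-1 by rewrite invr_gt0.
have exp k : exists p, Xi p /\ (cost Omega yd p < (c0 + k.+1%:R^-1)%:E)%E.
  have cf : c \is a fin_num by rewrite cE.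
  have [_ [p h <-]] := lb_ereal_inf_adherent (t0 k) cf.
  by rewrite -/c cE -EFinD => h'; exists p.
have [p hp] := choice exp.
pose rho k := (p k).1; pose y k := (p k).2.
pose g k (i : 'I_n.+1) x := weak_grad Omega (y k) x ord0 i.
have Xk k : Rad (rho k) /\ weak_solution (rho k) (y k) (g k).
  by have [h _] := hp k; apply: Xi_weak_solution; rewrite /rho /y -surjective_pairing.
have irho k : itg leb Omega (rho k) by have [/R_ad_between[]] := Xk k.
have brho k : between Omega xi1 xi2 (rho k) by have [/R_ad_between[]] := Xk k.
have ck k : ((state_cost (rho k) (y k) (g k))%:E + div_variation Omega (rho k) <
    (c0 + k.+1%:R^-1)%:E)%E.
  have [h1 h2] := Xk k; have [_ <-] := weak_solution_Xi h1 h2.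
  by rewrite /rho /y -surjective_pairing; exact: (hp k).2.
have Vk k : (div_variation Omega (rho k) <= (c0 + 1)%:E)%E.
  have h := state_cost_ge0 (brho k) (Xk k).2.
  apply: (@le_trans _ _ ((state_cost (rho k) (y k) (g k))%:E + div_variation Omega (rho k))%E).
    by rewrite leeDr// lee_fin.
  apply: (le_trans (ltW (ck k))); rewrite lee_fin lerD2l.
  by rewrite invf_le1// ler1n.
have rb : {ae leb, forall x, Omega x -> forall k, `|rho k x| <= xi2 x}.
  have /ae_foralln : forall k, {ae leb, forall x, Omega x -> `|rho k x| <= xi2 x}.
    move=> k; apply: filterS (brho k) => x h Ox; have [x1 /andP[x2 x3]] := h Ox.
    by rewrite ger0_norm// ltW// (lt_le_trans x1).
  by apply: filterS => x h Ox k; exact: h.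
have [j [r [jp ir rr]]] := bv_compact oO bO irho ixi2 Vk rb.
have br : between Omega xi1 xi2 r.
  have /ae_foralln bk : forall k, {ae leb, forall x, Omega x -> 0 < xi1 x /\ xi1 x <= rho k x <= xi2 x}.
    exact: brho.
  apply: filterS2 bk rr => x h1 h2 Ox; have [x1 _] := h1 0%N Ox; split=> //.
  apply/andP; split.
    by apply: (cvgr_to_ge (h2 Ox)); apply: nearW => k; have [_ /andP[]] := h1 (j k) Ox.
  by apply: (cvgr_to_le (h2 Ox)); apply: nearW => k; have [_ /andP[]] := h1 (j k) Ox.
(* Used for u = div phi in the variation and for u = 1 in the mass constraint. *)
have dom (u : E -> R) B : continuous u -> (forall x, `|u x| <= B) ->
    \int[leb]_(x in Omega) (rho (j k) x * u x) @[k --> \oo] --> \int[leb]_(x in Omega) (r x * u x).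
  move=> cu uB; have mu := measurable_continuous mO cu.
  have [] // := @Rintegral_dominated_ae _ _ _ leb Omega mO (fun k x => rho (j k) x * u x)
    (fun x => r x * u x) (fun x => B * xi2 x).
  - by move=> k; apply: measurable_funM => //; exact: (itg_meas (irho _)).
  - by apply: measurable_funM => //; exact: (itg_meas ir).
  - by apply: filterS rr => x h Ox; apply: cvgM; [exact: h|exact: cvg_cst].
  - exact: (itgZ mO).
  - move=> k; apply: filterS rb => x h Ox; rewrite normrM mulrC.
    by apply: ler_pM => //; exact: h.
pose J k := state_cost (rho (j k)) (y (j k)) (g (j k)).
have tj k : (j k).+1%:R^-1 <= k.+1%:R^-1 :> R by rewrite lef_pV2 ?posrE// ler_nat ltnS.
have Jdiv k phi : C10_vec Omega phi -> (forall x, Omega x -> enorm (phi x) <= 1) ->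
    J k + \int[leb]_(x in Omega) (rho (j k) x * divergence phi x) <= c0 + k.+1%:R^-1.
  move=> hphi phi1; rewrite -lee_fin EFinD.
  apply: le_trans (leeD2l _ (Rintegral_le_div_variation (irho (j k)) hphi phi1)) _.
  by apply: (le_trans (ltW (ck (j k)))); rewrite lee_fin lerD2l.
have J1 k : J k <= c0 + 1.
  rewrite -lee_fin; apply: le_trans (leeDl _ (div_variation_ge0 (irho (j k)))) _.
  apply: (le_trans (ltW (ck (j k)))); rewrite lee_fin lerD2l.
  by rewrite invf_le1// ler1n.
have sy k : square_itg leb Omega (y k) by have [_ [[]]] := Xk k.
have [||||||||||z [w [[sz za] iw irw hw hJ]]] := @varying_coefficient_limit _ _ Omega GammaD
   oO bO xi1 xi2 ixi1 ixi2 (fun k => rho (j k)) r (fun k => y (j k)) (fun k => g (j k))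
   (2 * (c0 + 1) + 2 * \int[leb]_(x in Omega) yd x ^+ 2).
- by move=> k; exact: (itg_meas (irho _)).
- by move=> k; exact: brho.
- exact: (itg_meas ir).
- by [].
- by [].
- by move=> k.
- by move=> k; have [_ []] := Xk (j k).
- by move=> k; have [_ []] := Xk (j k).
- by move=> k; have [_ [[]]] := Xk (j k).
(* The cost bounds y - yd; writing y = (y - yd) + yd bounds y itself, hence the constant above. *)
- move=> k; have h1 := Rintegral_sqrD mO (square_itgB mO (sy (j k)) syd) syd.
  rewrite (@eq_Rintegral _ _ _ _ _ (fun x => y (j k) x ^+ 2)) in h1; last first.
    by move=> x _; rewrite subrK.
  have h2 := gradient_energy_ge0 (brho (j k)) (Xk (j k)).2.
  by have := J1 k; rewrite /J /state_cost; lra.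
have wz : weak_solution r z w.
  split=> // phi hphi; apply: hw => //.
  rewrite (_ : (fun k => _) = fun=> \int[leb]_(x in Omega) (f x * phi x)).
    exact: cvg_cst.
  by apply/funext => k; have [_ [_ _ _ h]] := Xk (j k); exact: h.
(* For one fixed field the state costs from [K] on stay below c0 + e minus the limit integral, so
   the lower bound for sublevels in [hJ] applies with a constant; the supremum over fields is taken
   in [Vr]. *)
have Jr phi : C10_vec Omega phi -> (forall x, Omega x -> enorm (phi x) <= 1) ->
    \int[leb]_(x in Omega) (r x * divergence phi x) <= c0 - state_cost r z w.
  move=> hphi phi1; have [cd [B B0 hB]] := divergence_bounded hphi.
  rewrite lerBrDr addrC; apply/ler_addgt0Pr => e e0.
  have e2 : 0 < e / 2 by rewrite divr_gt0.
  have [K _ HK] : \forall k \near \oo,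
      \int[leb]_(x in Omega) (r x * divergence phi x) - e / 2 <=
        \int[leb]_(x in Omega) (rho (j k) x * divergence phi x) /\
      k.+1%:R^-1 <= e / 2.
    have h1 : \forall k \near \oo, \int[leb]_(x in Omega) (r x * divergence phi x) - e / 2 <=
        \int[leb]_(x in Omega) (rho (j k) x * divergence phi x).
      by apply: (cvgr_ge _ (dom _ B cd hB)); rewrite ltrBlDr ltrDl.
    have h2 : \forall k \near \oo, (k.+1%:R^-1 : R) <= e / 2.
      exact: (cvgr_le _ (@cvg_harmonic R) _ e2).
    exact: filterI h1 h2.
  rewrite -lerBrDr; apply: (hJ yd K) => // k Kk; have [h1 h2] := HK k Kk.
  move: h1 h2 (Jdiv k phi hphi phi1); rewrite /J /state_cost.
  set t := k.+1%:R^-1; set D := \int[_]_(x in _) (rho _ _ * _); set P := \int[_]_(x in _) (r _ * _).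
  set A := \int[_]_(x in _) _; set B' := \sum_i _; move: (e : R) => e' h1 h2 h3.
  by move: (t : R) (A : R) (B' : R) (P : R) (D : R) h1 h2 h3 => t' a b p1 d1; lra.
have Vr : (div_variation Omega r <= (c0 - state_cost r z w)%:E)%E.
  apply: ge_ereal_sup => _ [phi [hphi phi1] <-].
  by rewrite -(EFin_Rintegral mO (itg_mul_divergence ir hphi)) lee_fin; exact: Jr.
have hr : Rad r.
  split=> //.
  - by split=> //; exact: le_lt_trans Vr (ltry _).
  - apply: filterS br => x h Ox; have [x1 /andP[x2 _]] := h Ox.
    exact: ltW (lt_le_trans x1 x2).
  - have Im k : \int[leb]_(x in Omega) rho (j k) x = m.
      have [[_ _ h _] _] := Xk (j k).
      by apply: EFin_inj; rewrite (EFin_Rintegral mO (irho _)).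
    have mul1 (u : E -> R) : \int[leb]_(x in Omega) (u x * 1) = \int[leb]_(x in Omega) u x.
      by apply: eq_Rintegral => x _; rewrite mulr1.
    have norm1 (x : E) : `|1 : R| <= 1 by rewrite normr1.
    have L := dom (fun=> 1) 1 (fun x => @cst_continuous _ _ (1 : R) x) norm1.
    rewrite mul1 (_ : (fun k => _) = fun=> m) in L; last by apply/funext => k; rewrite mul1.
    rewrite -(EFin_Rintegral mO ir); congr EFin.
    have L' : (fun _ : nat => m) @ \oo --> m by exact: cvg_cst.
    exact: (cvg_unique _ L L').
  - by apply: filterS br => x h Ox; have [] := h Ox.
have [Xr cr] := weak_solution_Xi hr wz.
exists r, z; split=> //; apply/eqP; rewrite eq_le clb// andbT cr cE.
apply: le_trans (leeD2l _ Vr) _.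
by rewrite -EFinD lee_fin addrC subrK.
Qed.

End optimal_control.
Theorem theorem4p6 (R : realType) (n : nat)
    (Omega GammaD GammaN : set 'rV[R]_n.+1)
    (xi1 xi2 f yd : 'rV[R]_n.+1 -> R) (m : R) :
  open Omega -> bounded_set Omega -> lipschitz_boundary Omega ->
  boundary Omega = GammaD `|` GammaN -> GammaD `&` GammaN = set0 ->
  0 < m ->
  L1loc (EFin \o xi1) -> L1loc (EFin \o xi2) ->
  {ae lebesgue_rV n.+1, forall x, 0 <= xi1 x <= xi2 x} ->
  L1loc (fun x => ((xi1 x)%:E^-1)%E) ->
  L2loc f -> L2 Omega yd ->
  R_ad Omega xi1 xi2 m !=set0 ->
  exists rho_opt y_opt : 'rV[R]_n.+1 -> R,
    [/\ Xi_W Omega GammaD xi1 xi2 m f (rho_opt, y_opt),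
        L1 Omega (EFin \o rho_opt),
        W11_vanishing Omega GammaD y_opt,
        W_ Omega GammaD rho_opt y_opt &
        cost Omega yd (rho_opt, y_opt) =
        ereal_inf [set cost Omega yd p | p in Xi_W Omega GammaD xi1 xi2 m f]].
Proof.
move=> oO bO _ _ _ _ xi1L xi2L xi12 xi1V fL ydL Rad0.
have [xi1n0 ixi1] := itg_inv_L1loc oO bO xi1L xi1V.
have ixi2 := L1loc_integrable oO bO xi2L; have sf := L2loc_square_itg oO bO fL.
have [r [y [Xry costry]]] :=
  @optimal_pair_exists _ _ _ GammaD oO bO _ _ _ _ m xi12 xi1n0 ixi1 ixi2 sf ydL Rad0.
exists r, y; have [[[ir _] _ _ _] Wy _] := Xry.
by split=> //; exact: Wy.1.
Qed.
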